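(* Assume that $\mathbb{E}[|X|^6]<\infty$ for $\mu\in\Theta$ (the distribution of $X$ need not be determined by $\mu$). For $\ell\ge\tau_\varepsilon$ let $W_\ell=\frac1{n_\ell}\sum_{i=1}^{n_\ell}(X_i-Z_\ell)^2$. Let $\{\delta_\ell\}_{\ell\in\mathbb{Z}}$ be a non-increasing sequence of positive numbers less than $1$, let $\rho\ge0$, and let the sample sizes $n_\ell$ be as in the multistage setting of the context with $\Upsilon_\ell=\ln\frac1{\delta_\ell}$, $\ell\in\mathbb{Z}$, and $C_\ell\to\infty$ as $\ell\to\infty$. For $\ell\ge\tau_\varepsilon$ let $\boldsymbol{D}_\ell=1$ if $$W_\ell+\frac\rho{n_\ell}\le\frac{n_\ell}{\ln\frac1{\delta_\ell}}\times\min\big\{[\mathscr{U}(Z_\ell,\varepsilon)-Z_\ell]^2,\ [\mathscr{L}(Z_\ell,\varepsilon)-Z_\ell]^2\big\},$$ and $\boldsymbol{D}_\ell=0$ otherwise; sampling is continued until $\boldsymbol{D}_\ell=1$ for some $\ell\ge\tau_\varepsilon$. Then for every $\mu\in\Theta$ (with the notation of the context): (I) $\Pr\{\mathbf{n}<\infty\}=1$ and $\mathbb{E}[\mathbf{n}]<\infty$. (II) $\Pr\{\jmath-1\le\liminf_{\varepsilon\downarrow0}\boldsymbol{l}\le\limsup_{\varepsilon\downarrow0}\boldsymbol{l}\le\jmath\}=1$; moreover $\Pr\{\lim_{\varepsilon\downarrow0}\boldsymbol{l}=\jmath\}=1$ provided ( * ) holds, where ( * ) is the condition: $\jmath=1$,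 or both $\jmath>1$ and $\Lambda_{\jmath-1}(\mu,\nu)<1$. (III) $\liminf_{\varepsilon\downarrow0}\Pr\{\mu\in\boldsymbol{\mathcal{I}}\}\ge2[\Phi(\xi_{\jmath-1})+\Phi(\xi_\jmath)]-3$; moreover $\lim_{\varepsilon\downarrow0}\Pr\{\mu\in\boldsymbol{\mathcal{I}}\}=2\Phi(\xi_\jmath)-1$ provided ( * ) holds. (IV) $\big(\frac{\xi_{\jmath-1}}{\mathcal{Z}}\big)^2\le\liminf_{\varepsilon\downarrow0}\frac{\mathbb{E}[\mathbf{n}]}{\mathcal{N}(\varepsilon,\delta,\mu,\nu)}\le\limsup_{\varepsilon\downarrow0}\frac{\mathbb{E}[\mathbf{n}]}{\mathcal{N}(\varepsilon,\delta,\mu,\nu)}\le\big(\frac{\xi_\jmath}{\mathcal{Z}}\big)^2$; moreover $\lim_{\varepsilon\downarrow0}\frac{\mathbb{E}[\mathbf{n}]}{\mathcal{N}(\varepsilon,\delta,\mu,\nu)}=\big(\frac{\xi_\jmath}{\mathcal{Z}}\big)^2$ provided ( * ) holds. (V) For all $\ell\in\mathbb{Z}$, $\Pr\{\boldsymbol{l}>\ell\}\le\Pr\{\boldsymbol{D}_\ell=0\}$ and $\lim_{\varepsilon\downarrow0}[\Pr\{\boldsymbol{D}_\ell=0\}-\Pr\{\boldsymbol{l}>\ell\}]=0$. (VI) $\underline{P}\le\Pr\{\mu\notin\boldsymbol{\mathcal{I}}\}\le\overline{P}\le Q$ and $\lim_{\varepsilon\downarrow0}|\Pr\{\mu\notin\boldsymbol{\mathcal{I}}\}-\overline{P}|=\lim_{\varepsilon\downarrow0}|\Pr\{\mu\notin\boldsymbol{\mathcal{I}}\}-\underline{P}|=0$;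 moreover $\lim_{\varepsilon\downarrow0}[Q-\Pr\{\mu\notin\boldsymbol{\mathcal{I}}\}]=0$ provided ( * ) holds. (VII) $\mathbb{E}[\mathbf{n}]\le n_{\tau_\varepsilon}+\sum_{\ell=\tau_\varepsilon}^\infty(n_{\ell+1}-n_\ell)\Pr\{\boldsymbol{D}_\ell=0\}$ and $\lim_{\varepsilon\downarrow0}\frac1{\mathbb{E}[\mathbf{n}]}\big[n_{\tau_\varepsilon}+\sum_{\ell=\tau_\varepsilon}^\infty(n_{\ell+1}-n_\ell)\Pr\{\boldsymbol{D}_\ell=0\}\big]=1$.
   Context: $X$ is a real random variable with mean $\mu=\mathbb{E}[X]$ and variance $\nu=\mathbb{E}[|X-\mu|^2]>0$; the set of possible values of $\mu$ is an interval $\Theta\subseteq\mathbb{R}$. $X_1,X_2,\dots$ are i.i.d. samples of $X$. $\Phi$ is the standard normal distribution function, $\delta\in(0,1)$ is fixed, $\mathcal{Z}=\Phi^{-1}(1-\delta/2)$. $\mathscr{L}(z,\varepsilon)$ and $\mathscr{U}(z,\varepsilon)$, for $z\in\mathbb{R}$, $\varepsilon>0$, are real functions such that: (i) they are continuous functions of $z$ and $\varepsilon>0$; (ii) for every $\varepsilon>0$, $\mathscr{L}(z,\varepsilon)\le z\le\mathscr{U}(z,\varepsilon)$ for all $z\in\mathbb{R}$ and $\mathscr{L}(\mu,\varepsilon)<\mu<\mathscr{U}(\mu,\varepsilon)$ for all $\mu\in\Theta$; (iii) for every $\mu\in\Theta$, as $(z,\varepsilon)\to(\mu,0)$ with $\varepsilon\downarrow0$,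 $\frac{z-\mathscr{L}(z,\varepsilon)}{\varepsilon}$ and $\frac{\mathscr{U}(z,\varepsilon)-z}{\varepsilon}$ both converge to $\kappa(\mu)>0$, where $\kappa$ is a continuous function of $\mu$. The functions $\mathcal{L}(z,\varepsilon)$, $\mathcal{U}(z,\varepsilon)$ are in the same class in the sense that for every $\mu\in\Theta$, as $z\to\mu$, $\varepsilon\downarrow0$ jointly, $\frac{z-\mathcal{L}(z,\varepsilon)}{\varepsilon}$ and $\frac{\mathcal{U}(z,\varepsilon)-z}{\varepsilon}$ also both converge to $\kappa(\mu)$. $\mathcal{N}(\varepsilon,\delta,\mu,\nu)=\frac{\nu\mathcal{Z}^2}{[\kappa(\mu)\varepsilon]^2}$. Multistage setting. $\{C_\ell\}_{\ell\in\mathbb{Z}}$ is an increasing sequence of positive numbers with $1<\inf_{\ell\in\mathbb{N}}\frac{C_{\ell+1}}{C_\ell}\le\sup_{\ell\in\mathbb{N}}\frac{C_{\ell+1}}{C_\ell}<\infty$; $\{\Upsilon_\ell\}_{\ell\in\mathbb{Z}}$ is a non-decreasing sequence of positive numbers with $1\le\inf_{\ell\in\mathbb{N}}\frac{\Upsilon_{\ell+1}}{\Upsilon_\ell}\le\sup_{\ell\in\mathbb{N}}\frac{\Upsilon_{\ell+1}}{\Upsilon_\ell}<\infty$. The starting index $\tau_\varepsilon$ is an integer-valued function of $\varepsilon$ with $\lim_{\varepsilon\downarrow0}\tau_\varepsilon=1$. The sample sizes $\{n_\ell\}_{\ell\ge\tau_\varepsilon}$ form an increasing sequence of positive integers depending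 on $\varepsilon$ such that $\frac{\varepsilon^2n_\ell}{C_\ell\Upsilon_\ell}\to1$ uniformly for $\ell\ge1$ as $\varepsilon\downarrow0$. $Z_\ell=\frac1{n_\ell}\sum_{i=1}^{n_\ell}X_i$ for $\ell\ge\tau_\varepsilon$. Decision variables $\boldsymbol{D}_\ell\in\{0,1\}$ for $\ell\ge\tau_\varepsilon$ are given in the claim, and $\boldsymbol{D}_\ell=0$ for $\ell<\tau_\varepsilon$. The stopping index $\boldsymbol{l}$ is the smallest $\ell\ge\tau_\varepsilon$ with $\boldsymbol{D}_\ell=1$; $\mathbf{n}=n_{\boldsymbol{l}}$; $\widehat{\boldsymbol\mu}=Z_{\boldsymbol{l}}$; $\boldsymbol{\mathcal{I}}=(\mathcal{L}(\widehat{\boldsymbol\mu},\varepsilon),\mathcal{U}(\widehat{\boldsymbol\mu},\varepsilon))$; $\boldsymbol{\mathcal{I}}_\ell=(\mathcal{L}(Z_\ell,\varepsilon),\mathcal{U}(Z_\ell,\varepsilon))$. For $\ell\in\mathbb{Z}$: $\xi_\ell=\kappa(\mu)\sqrt{\frac{C_\ell\Upsilon_\ell}{\nu}}$, $\Lambda_\ell(\mu,\nu)=\frac{\kappa^2(\mu)C_\ell}{\nu}$. $\jmath=\min\{\ell\ge1:\Lambda_\ell(\mu,\nu)>1\}$. Further $$\overline{P}=\sum_{\ell=\tau_\varepsilon}^\infty\Pr\{\mu\notin\boldsymbol{\mathcal{I}}_\ell,\boldsymbol{D}_{\ell-1}=0,\boldsymbol{D}_\ell=1\},\quad\underline{P}=1-\sum_{\ell=\tau_\varepsilon}^\infty\Pr\{\mu\in\boldsymbol{\mathcal{I}}_\ell,\boldsymbol{D}_{\ell-1}=0,\boldsymbol{D}_\ell=1\},$$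 $$Q=\sum_{\ell=\tau_\varepsilon}^\infty\min[\Pr\{\mu\notin\boldsymbol{\mathcal{I}}_\ell\},\Pr\{\boldsymbol{D}_{\ell-1}=0\},\Pr\{\boldsymbol{D}_\ell=1\}].$$
   Formalization: (I) is asserted for all sufficiently small ε only, since the sample sizes are constrained only as ε↓0 and (I) can fail at a fixed large ε; accordingly Pr{μ∉I} ≤ P̄ in (VI) is asserted for those ε with Pr{n<∞}=1. *)

(* Defs.v *)
From HB Require Import structures.
From mathcomp Require Import all_boot all_order all_algebra finmap.
From mathcomp Require Import all_classical all_reals all_analysis.

Set Implicit Arguments.
Unset Strict Implicit.
Unset Printing Implicit Defensive.

Import Order.TTheory GRing.Theory Num.Theory.
Import numFieldNormedType.Exports.

Local Open Scope classical_set_scope.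
Local Open Scope ring_scope.

Definition Phi {R : realType} (x : R) : R := fine (normal_prob 0 1 `]-oo, x]).

(* The smallest integer l >= a with p l; None if there is none. *)
Definition first_index (a : int) (p : int -> bool) : option int :=
  match pselect (exists k : nat, p (a + k%:Z)) with
  | left h => Some (a + (ex_minn h)%:Z)
  | right _ => None
  end.

Definition at_index {R : realType} (f : int -> R) (o : option int) : \bar R :=
  if o is Some l then (f l)%:E else +oo%E.

Definition sum_from {R : realType} (a : int) (f : int -> \bar R) : \bar R :=
  (\sum_(0 <= k <oo) f (a + k%:Z)%R)%E.

Definition ratio_inf {R : realType} (u : int -> R) : \bar R :=
  ereal_inf [set (u (l + 1) / u l)%:E | l in [set l : int | 1 <= l]].

Definition ratio_sup {R : realType} (u : int -> R) : \bar R :=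
  ereal_sup [set (u (l + 1) / u l)%:E | l in [set l : int | 1 <= l]].

(* The limits are joint in (z, eps); z is allowed to equal mu. *)
Definition asymptotic_margin {R : realType} (Theta : set R) (kappa : R -> R)
    (L U : R -> R -> R) : Prop :=
  forall mu, Theta mu ->
    ((fun p : R * R => (p.1 - L p.1 p.2) / p.2)
       @ filter_prod (nbhs mu) (0 : R)^'+ --> kappa mu) /\
    ((fun p : R * R => (U p.1 p.2 - p.1) / p.2)
       @ filter_prod (nbhs mu) (0 : R)^'+ --> kappa mu).

Definition mutually_independent d (T : measurableType d) (R : realType)
    (P : probability T R) (X : nat -> {RV P >-> R}) : Prop :=
  forall (J : {fset nat}) (B : nat -> set R),
    (forall i, i \in J -> measurable (B i)) ->
    P (\bigcap_(i in [set` J]) (X i @^-1` B i)) =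
    (\prod_(i <- J) P (X i @^-1` B i))%E.

(* X i is the (i+1)-st sample. *)
Definition iid_samples_of d (T : measurableType d) (R : realType)
    (P : probability T R) (X0 : {RV P >-> R}) (X : nat -> {RV P >-> R}) : Prop :=
  mutually_independent X /\
  forall i (B : set R), measurable B -> distribution P (X i) B = distribution P X0 B.

(* Data of a sampling scheme; the arguments of the four limit functions are z
   and eps. scrL and scrU define the stopping rule, calL and calU the
   confidence interval. tau eps is the starting index; size eps l is the sample
   size of stage l and is only meaningful for l >= tau eps. *)
Record scheme (R : realType) := Scheme {
  scrL : R -> R -> R;
  scrU : R -> R -> R;
  calL : R -> R -> R;
  calU : R -> R -> R;
  dlt : int -> R;
  rho : R;
  tau : R -> int;
  ssize : R -> int -> nat
}.

Definition Upsilon {R : realType} (S : scheme R) (l : int) : R :=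
  ln (1 / dlt S l).

Section multistage.
Context d (T : measurableType d) (R : realType) (P : probability T R).
Variables (S : scheme R) (X : nat -> {RV P >-> R}).

Definition mean_of (m : nat) (w : T) : R := (\sum_(i < m) X i w) / m%:R.

Definition Z (eps : R) (l : int) (w : T) : R := mean_of (ssize S eps l) w.

Definition W (eps : R) (l : int) (w : T) : R :=
  (\sum_(i < ssize S eps l) (X i w - Z eps l w) ^+ 2) / (ssize S eps l)%:R.

Definition D (eps : R) (l : int) (w : T) : bool :=
  (tau S eps <= l) &&
  (W eps l w + rho S / (ssize S eps l)%:R <=
   (ssize S eps l)%:R / Upsilon S l *
   Num.min ((scrU S (Z eps l w) eps - Z eps l w) ^+ 2)
           ((scrL S (Z eps l w) eps - Z eps l w) ^+ 2)).

Definition stop (eps : R) (w : T) : option int :=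
  first_index (tau S eps) (fun l => D eps l w).

(* +oo if sampling never stops *)
Definition stop_index (eps : R) (w : T) : \bar R :=
  at_index (fun l => l%:~R) (stop eps w).

Definition stop_size (eps : R) (w : T) : \bar R :=
  at_index (fun l => (ssize S eps l)%:R) (stop eps w).

Definition mean_stop_size (eps : R) : \bar R :=
  (\int[P]_w stop_size eps w)%E.

Definition stage_interval (eps : R) (l : int) (w : T) : set R :=
  `]calL S (Z eps l w) eps, calU S (Z eps l w) eps[.

(* By convention empty if sampling never stops. *)
Definition final_interval (eps : R) (w : T) : set R :=
  if stop eps w is Some l then stage_interval eps l w else set0.

Definition covered (eps mu : R) : set T := [set w | final_interval eps w mu].

Definition missed (eps mu : R) : set T := [set w | ~ final_interval eps w mu].

Definition decided (eps : R) (l : int) : set T := [set w | D eps l w].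

Definition undecided (eps : R) (l : int) : set T := [set w | ~~ D eps l w].

Definition stage_missed (eps mu : R) (l : int) : set T :=
  [set w | ~ stage_interval eps l w mu].

Definition stage_covered (eps mu : R) (l : int) : set T :=
  [set w | stage_interval eps l w mu].

Definition P_upper (eps mu : R) : \bar R :=
  sum_from (tau S eps) (fun l =>
    P (stage_missed eps mu l `&` undecided eps (l - 1) `&` decided eps l)).

Definition P_lower (eps mu : R) : \bar R :=
  (1 - sum_from (tau S eps) (fun l =>
    P (stage_covered eps mu l `&` undecided eps (l - 1)%R `&` decided eps l)))%E.

Definition Q (eps mu : R) : \bar R :=
  sum_from (tau S eps) (fun l =>
    Order.min (P (stage_missed eps mu l))
      (Order.min (P (undecided eps (l - 1))) (P (decided eps l)))).

Definition size_bound (eps : R) : \bar R :=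
  ((ssize S eps (tau S eps))%:R%:E +
   sum_from (tau S eps) (fun l =>
     ((ssize S eps (l + 1)%R)%:R - (ssize S eps l)%:R)%:E
       * P (undecided eps l)))%E.

End multistage.

(* Main.v *)
Require Import Defs.
From HB Require Import structures.
From mathcomp Require Import all_boot all_order all_algebra finmap.
From mathcomp Require Import all_classical all_reals all_analysis.
From mathcomp Require Import measurable_realfun.
From mathcomp Require Import ring lra zify.

Set Implicit Arguments.
Unset Strict Implicit.
Unset Printing Implicit Defensive.

Import Order.TTheory GRing.Theory Num.Theory.
Import numFieldNormedType.Exports.

Local Open Scope classical_set_scope.
Local Open Scope ring_scope.

(* Near mu the margins of the limit functions are about kappa * eps, and n_l is
   about C_l Upsilon_l / eps^2, so the test at stage l compares the sample
   variance with kappa^2 C_l: as eps -> 0 it succeeds if Lambda_l > 1 and fails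
   if Lambda_l < 1.  Chebyshev bounds, of order four for the sample mean and of
   order two for the mean of the squares, give
   n_{l+1} P(D_l = 0) = O(1 / C_l) for l >= j uniformly in eps; since C grows
   geometrically, the sum of these terms over l >= j is at most a constant K.
   Hence, up to the errors sum_{k <= j-2} P(D_k = 1) -> 0 and K / n_1 -> 0, the
   scheme stops at stage j - 1 or j (at j under the condition star), and
   (III)-(VII) follow by elementary inequalities on the stopping index.  The
   coverage of a fixed stage is the central limit theorem, proved by replacing
   the summands by Gaussians one at a time against a C^2 spline.  The almost
   sure statement (II) uses the strong law for nonnegative variables, obtained
   along squares, for (X - mu)^2 and (X - mu + 1)^2. *)

(** * Independent identically distributed sequences *)

Section iid_sequences.
Context d (T : measurableType d) (R : realType) (P : probability T R).

(** The orders of the two Chebyshev bounds are dictated by the weight [n_{l+1}]. The margins are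
    controlled only for [z] in a fixed neighbourhood of [mu], so the deviation allowed to the sample
    mean does not grow with [l]: order two would leave [O(1)] after weighting, which cannot be
    summed, while order four leaves [O(1 / n_l)], and [n_l] dominates a multiple of [C_l]. The
    sample variance may exceed [nu] by a multiple of [C_l], because the threshold of the test is
    itself proportional to [C_l]; order two then leaves [O(1 / C_l ^ 2)]. Since [C] is strictly
    increasing, [Lambda_l < 1] for every [l < j - 1], and only [Lambda_{j-1}] can equal 1, where the
    test has no limiting outcome. Hence the errors count decisions up to stage [j - 2] in general
    and up to [j - 1] under the condition star. The sizes depend on the continuous parameter [eps],
    so the almost sure statement needs convergence of the averages along all [n], which is then
    composed with [n_l -> oo]. *)

Definition iid (Y : nat -> T -> R) :=
  [/\ forall i, measurable_fun setT (Y i),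
      forall (J : {fset nat}) (B : nat -> set R),
        (forall i, i \in J -> measurable (B i)) ->
        P (\bigcap_(i in [set` J]) (Y i @^-1` B i)) =
        (\prod_(i <- J) P (Y i @^-1` B i))%E
    & forall i B, measurable B -> P (Y i @^-1` B) = P (Y 0%N @^-1` B)].

Lemma measurable_preimage (f : T -> R) (B : set R) :
  measurable_fun setT f -> measurable B -> measurable (f @^-1` B).
Proof. by move=> mf mB; rewrite -[X in measurable X]setTI; exact: mf. Qed.

Lemma iid_comp (h : R -> R) (Y : nat -> T -> R) :
  measurable_fun setT h -> iid Y -> iid (fun i => h \o Y i).
Proof.
move=> mh [mY indY idY].
have mhB (B : set R) : measurable B -> measurable (h @^-1` B).
  by move=> mB; rewrite -[X in measurable X]setTI; exact: mh.
split=> [i|J B mB|i B mB]; first exact: measurableT_comp.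
- by apply: (indY J (fun i => h @^-1` B i)) => i iJ; exact: mhB (mB i iJ).
- exact: (idY i (h @^-1` B) (mhB _ mB)).
Qed.

Definition partial_sum (Y : nat -> T -> R) (n : nat) (w : T) : R :=
  \sum_(i < n) Y i w.

Lemma measurable_partial_sum Y n : iid Y -> measurable_fun setT (partial_sum Y n).
Proof. by case=> mY _ _; apply: measurable_sum => i; exact: mY. Qed.

Lemma partial_sumS Y n w : partial_sum Y n.+1 w = partial_sum Y n w + Y n w.
Proof. by rewrite /partial_sum big_ord_recr. Qed.

(** The pi-system of rectangles in the coordinates below [n]. Independence of [Y n] is checked here
    and carried to the generated sigma-algebra by the pi-lambda theorem. *)
Let cylinder (Y : nat -> T -> R) n : set_system T :=
  [set E | exists2 B : nat -> set R, (forall i, measurable (B i)) &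
           E = \bigcap_(i in `I_n) (Y i @^-1` B i)].

Let cylinder_setI Y n : setI_closed (cylinder Y n).
Proof.
move=> _ _ [B mB ->] [B' mB' ->].
exists (fun i => B i `&` B' i); first by move=> i; exact: measurableI.
by apply/seteqP; split=> [w [BW B'w] i ni|w BB]; [split; [exact: BW|exact: B'w]|
  split=> i ni; have [] := BB i ni].
Qed.

Let cylinder_indep Y n (F : set R) (E : set T) : iid Y -> measurable F ->
  cylinder Y n E -> measurable E /\
  P (E `&` Y n @^-1` F) = (P E * P (Y n @^-1` F))%E.
Proof.
move=> [mY indY _] mF [B mB ->]; split.
  by apply: bigcap_measurableType => i _; exact: measurable_preimage.
have JE m : [set` [fset x in iota 0 m]%fset] = `I_m.
  by apply/seteqP; split => x /=; rewrite inE/= mem_iota.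
have nJ : n \notin [fset x in iota 0 n]%fset by rewrite inE mem_iota ltnn.
(* Gluing [F] at coordinate [n] allows the product formula to be used on the indices up to [n], and
   then again on those below [n]. *)
pose B' i := if i == n then F else B i.
have B'n : B' n = F by rewrite /B' eqxx.
have B'i i : (i < n)%N -> B' i = B i by move=> ni; rewrite /B' ltn_eqF.
transitivity (P (\bigcap_(i in [set` (n |` [fset x in iota 0 n])%fset])
    (Y i @^-1` B' i))).
  congr (P _); rewrite set_fsetU1 JE setIC.
  apply/seteqP; split => [w [Fw Bw] i []|w Bw].
  + by move=> ->; rewrite B'n.
  + by move=> ni; rewrite B'i//; exact: Bw.
  + split; first by have := Bw n (or_introl erefl); rewrite B'n.
    by move=> i ni; have := Bw i (or_intror ni); rewrite B'i.
rewrite indY => [|i _]; last by rewrite /B'; case: ifP.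
rewrite big_fsetU1//= B'n muleC; congr (_ * _)%E.
rewrite -JE indY//; apply: eq_big_seq => i; rewrite inE/= mem_iota => ni.
by rewrite B'i.
Qed.

(** For fixed [F], the events satisfying the product formula form a Dynkin system that contains the
    cylinders. *)
Let sigma_cylinder_indep Y n (F : set R) : iid Y -> measurable F ->
  <<s cylinder Y n >> `<=` [set E | measurable E /\
    P (E `&` Y n @^-1` F) = (P E * P (Y n @^-1` F))%E].
Proof.
move=> iidY mF; have [mY _ _] := iidY.
have mYF := measurable_preimage (mY n) mF.
apply: lambda_system_subset => //.
- apply/dynkin_lambda_system; split.
  + by split; [exact: measurableT|rewrite setTI probability_setT mul1e].
  + move=> E [mE EF]; split; first exact: measurableC.
    rewrite probability_setC// muleBl ?fin_num_measure// mul1e -EF.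
    by rewrite setIC -setDE measureD// 1?setIC// -ge0_fin_numE// fin_num_measure.
  + move=> E tE HE; split.
      by apply: bigcup_measurable => k _; have [] := HE k.
    rewrite setI_bigcupl measure_bigcup//=; last 2 first.
      by move=> k _; apply: measurableI => //; have [] := HE k.
      exact: trivIset_setIr.
    rewrite measure_bigcup//=; last by move=> k _; have [] := HE k.
    rewrite muleC -(fineK (fin_num_measure P _ mYF)) -nneseriesZl//.
    by apply: eq_eseriesr => k _; rewrite muleC fineK ?fin_num_measure//; have [] := HE k.
- by move=> E; exact: cylinder_indep.
Qed.

Lemma partial_sum_indep Y n (A B : set R) : iid Y -> measurable A -> measurable B ->
  P (partial_sum Y n @^-1` A `&` Y n @^-1` B) =
  (P (partial_sum Y n @^-1` A) * P (Y n @^-1` B))%E.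
Proof.
move=> iidY mA mB.
suff /(sigma_cylinder_indep iidY mB)[] : <<s cylinder Y n >> (partial_sum Y n @^-1` A) by [].
(* [T] with the sigma-algebra of the first [n] coordinates: the partial sum is measurable for it
   because each of its terms is. *)
pose GT := g_sigma_algebraType (cylinder Y n).
have mS : measurable_fun [set: GT] (fun w : GT => \sum_(i < n) Y i w).
  apply: measurable_sum => i _ C mC; rewrite setTI.
  apply: sub_sigma_algebra; exists (fun k => if k == i :> nat then C else setT).
    by move=> k; case: ifP.
  apply/seteqP; split => [w Cw k kn|w /(_ i (ltn_ord i))] /=; last by rewrite eqxx.
  by case: eqP => // ->.
by have := mS measurableT A mA; rewrite setTI.
Qed.

(** The form in which independence enters the moment bounds and the replacement argument: the next
    summand may be integrated out as a fresh copy of [Y 0]. The joint law equals the product law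
    because both agree on rectangles; Tonelli does the rest. *)
Lemma integral_partial_sumS Y n (f : R -> R -> \bar R) : iid Y ->
  measurable_fun setT (fun p : R * R => f p.1 p.2) -> (forall x y, (0 <= f x y)%E) ->
  (\int[P]_w f (partial_sum Y n w) (Y n w) =
   \int[P]_w \int[P]_w' f (partial_sum Y n w) (Y 0%N w'))%E.
Proof.
move=> iidY mf f0; have [mY _ idY] := iidY.
have mS := measurable_partial_sum n iidY.
pose mf2 (d' : measure_display) (T' : measurableType d') (g : T -> T')
  (mg : measurable_fun setT g) : {mfun T >-> T'} :=
  HB.pack g (isMeasurableFun.Build _ _ _ _ _ mg).
pose dS := distribution P (mf2 _ _ _ mS).
pose dY := distribution P (mf2 _ _ _ (mY 0%N)).
have mSY : measurable_fun setT (fun w => (partial_sum Y n w, Y n w)).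
  exact: measurable_fun_pair.
pose dSY := distribution P (mf2 _ _ _ mSY).
have mfx x : measurable_fun setT (f x).
  exact: (measurableT_comp mf (pair1_measurable x)).
transitivity (\int[dSY]_p f p.1 p.2)%E.
  by rewrite ge0_integral_distribution.
transitivity (\int[dS \x dY]_p f p.1 p.2)%E.
  apply: eq_measure_integral => A mA _; apply/esym/product_measure_unique => //.
  move=> B C mB mC.
  transitivity (P (partial_sum Y n @^-1` B `&` Y n @^-1` C)) => //.
  by rewrite partial_sum_indep// idY.
rewrite fubini_tonelli1//=.
rewrite (ge0_integral_distribution (mf2 _ _ _ mS)) /=; last 2 first.
  exact: measurable_fun_fubini_tonelli_F.
  by move=> y; exact: integral_ge0.
apply: eq_integral => w _ /=; rewrite /fubini_F.
by rewrite (ge0_integral_distribution (mf2 _ _ _ (mY 0%N)) (mfx (partial_sum Y n w))).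
Qed.
End iid_sequences.

(** * Moments and tails of partial sums *)

Section mean_is.
Context d (T : measurableType d) (R : realType) (m : {measure set T -> \bar R}).
Implicit Types (f g : T -> R) (u v : R).

(** Integrability and value together, so that moments combine linearly. The measure is arbitrary
    because the relation serves both for [P] and for Lebesgue measure with a Gaussian weight. *)
Definition mean_is f v :=
  m.-integrable setT (EFin \o f) /\ (\int[m]_w (f w)%:E = v%:E)%E.

Lemma mean_isD f g u v : mean_is f u -> mean_is g v ->
  mean_is (fun w => f w + g w) (u + v).
Proof.
move=> [fi fu] [gi gv]; split; first exact: (integrableD _ fi gi).
by rewrite EFinD -fu -gv -integralD_EFin.
Qed.

Lemma mean_isZ k f v : mean_is f v -> mean_is (fun w => k * f w) (k * v).
Proof.
move=> [fi fu]; split; first exact: (integrableZl _ _ fi).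
by rewrite EFinM -fu -integralZl.
Qed.

Lemma eq_mean_is f g v : f =1 g -> mean_is f v -> mean_is g v.
Proof. by move=> /funext ->. Qed.

Lemma mean_is_ge0 f v : measurable_fun setT f -> (forall w, 0 <= f w) ->
  (\int[m]_w (f w)%:E = v%:E)%E -> mean_is f v.
Proof.
move=> mf f0 fv; split => //; apply/integrableP; split.
  exact/measurable_EFinP.
under eq_integral do rewrite gee0_abs ?lee_fin//.
by rewrite fv ltry.
Qed.

Lemma mean_is_le f g u v : mean_is f u -> mean_is g v ->
  (forall w, f w <= g w) -> u <= v.
Proof.
move=> [fi fu] [gi gv] fg; rewrite -lee_fin -fu -gv.
by apply: le_integral => // w _; rewrite lee_fin.
Qed.

Lemma mean_is_dominated f g v : measurable_fun setT f ->
  (forall w, `|f w| <= g w) -> mean_is g v -> exists2 u, mean_is f u & `|u| <= v.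
Proof.
move=> mf fg gv; have [gi _] := gv.
have fi : m.-integrable setT (EFin \o f).
  apply: (le_integrable _ _ _ gi) => //; first exact/measurable_EFinP.
  move=> w _; rewrite /= lee_fin; apply: (le_trans (fg w)); exact: ler_norm.
have fu : mean_is f (fine (\int[m]_w (f w)%:E)).
  by split => //; rewrite fineK//; exact: integrable_fin_num.
exists (fine (\int[m]_w (f w)%:E)) => //.
rewrite ler_norml; apply/andP; split.
  rewrite -mulN1r; apply: (mean_is_le (mean_isZ (-1) gv) fu) => w.
  by rewrite mulN1r lerNl; apply: le_trans (fg w); rewrite -normrN ler_norm.
by apply: (mean_is_le fu gv) => w; exact: le_trans (ler_norm _) (fg w).
Qed.

End mean_is.

Lemma mean_is_cst d (T : measurableType d) (R : realType) (P : probability T R) (c : R) :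
  mean_is P (cst c) c.
Proof.
split; first exact: finite_measure_integrable_cst.
transitivity (c%:E * P setT)%E; first exact: (integral_cst P measurableT c%:E).
by rewrite probability_setT mule1.
Qed.

Lemma measurable_le d (T : measurableType d) (R : realType) (f g : T -> R) :
  measurable_fun setT f -> measurable_fun setT g -> measurable [set w | f w <= g w].
Proof. by move=> mf mg; rewrite -[X in measurable X]setTI; exact: measurable_fun_le. Qed.

Lemma measurable_lt d (T : measurableType d) (R : realType) (f g : T -> R) :
  measurable_fun setT f -> measurable_fun setT g -> measurable [set w | f w < g w].
Proof.
move=> mf mg; rewrite (_ : [set w | _] = ~` [set w | g w <= f w]).
  by apply: measurableC; exact: measurable_le.
by apply/seteqP; split => w /=; rewrite ltNge => /negP.
Qed.

Lemma markov_le d (T : measurableType d) (R : realType) (P : probability T R)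
    (g : T -> R) a v : measurable_fun setT g -> (forall w, 0 <= g w) -> 0 < a ->
  (\int[P]_w (g w)%:E <= v%:E)%E -> (P [set w | (a <= g w)%R] <= (v / a)%:E)%E.
Proof.
move=> mg g0 a0 gv; rewrite EFinM lee_pdivlMr// muleC.
apply: le_trans gv.
have mg' : measurable_fun setT (EFin \o g) by exact/measurable_EFinP.
have := le_integral_abse P measurableT mg' a0; rewrite setTI.
under eq_integral do rewrite gee0_abs ?lee_fin//.
by under eq_set do rewrite gee0_abs ?lee_fin//.
Qed.

Section moments.
Context d (T : measurableType d) (R : realType) (P : probability T R).
Variables (Y : nat -> T -> R).
Hypotheses (iidY : iid P Y) (Y_mean : mean_is P (Y 0%N) 0).

Let mY i : measurable_fun setT (Y i). Proof. by case: iidY. Qed.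
Let mS n : measurable_fun setT (partial_sum Y n). Proof. exact: measurable_partial_sum iidY. Qed.

Lemma second_moment s2 n : mean_is P (fun w => Y 0%N w ^+ 2) s2 ->
  mean_is P (fun w => partial_sum Y n w ^+ 2) (n%:R * s2).
Proof.
move=> Y2; apply: mean_is_ge0; first exact: measurable_funX.
  by move=> w; exact: sqr_ge0.
elim: n => [|n IH].
  rewrite mul0r; under eq_integral do rewrite /partial_sum big_ord0 expr0n/=.
  exact: integral0.
under eq_integral do rewrite partial_sumS.
rewrite (@integral_partial_sumS _ _ _ _ _ _ (fun x y => ((x + y) ^+ 2)%:E))//; last 2 first.
- apply/measurable_EFinP; apply: measurable_funX; apply: measurable_funD.
    exact: measurable_fst.
  exact: measurable_snd.
- by move=> x y; rewrite lee_fin sqr_ge0.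
have inner x : (\int[P]_w' ((x + Y 0%N w') ^+ 2)%:E = (x ^+ 2 + s2)%:E)%E.
  have [_ <-] : mean_is P (fun w => (x + Y 0%N w) ^+ 2) (x ^+ 2 + s2) => //.
  apply: (eq_mean_is (f := fun w => x ^+ 2 + (2 * x * Y 0%N w + Y 0%N w ^+ 2))) => [w|].
    by ring.
  have -> : x ^+ 2 + s2 = x ^+ 2 + (2 * x * 0 + s2) by rewrite mulr0 add0r.
  apply: mean_isD; first exact: mean_is_cst.
  by apply: mean_isD => //; exact: mean_isZ.
under eq_integral do rewrite inner.
have s20 : 0 <= s2.
  by rewrite -lee_fin; case: Y2 => _ <-; apply: integral_ge0 => w _; rewrite lee_fin sqr_ge0.
under eq_integral do rewrite EFinD.
rewrite ge0_integralD//=.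
- by rewrite IH integral_cst//= probability_setT mule1 -EFinD mulrSr mulrDl mul1r.
- by move=> w _; rewrite lee_fin sqr_ge0.
- by apply/measurable_EFinP; exact: measurable_funX.
Qed.

(** In [(x + y)^4] the term [4 x y^3] is absorbed by [2 x^2 y^2 + 2 y^4], the defect being
    [2 (y (x - y))^2]; so only second and fourth moments enter. One step adds at most
    [8 n s2^2 + 3 m4], which sums to order [n^2]. *)
Lemma fourth_moment s2 m4 n : mean_is P (fun w => Y 0%N w ^+ 2) s2 ->
  mean_is P (fun w => Y 0%N w ^+ 4) m4 ->
  (\int[P]_w (partial_sum Y n w ^+ 4)%:E <=
    (n%:R ^+ 2 * (8 * s2 ^+ 2 + 3 * m4))%:E)%E.
Proof.
move=> Y2 Y4.
have s20 : 0 <= s2.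
  by rewrite -lee_fin; case: Y2 => _ <-; apply: integral_ge0 => w _; rewrite lee_fin sqr_ge0.
have m40 : 0 <= m4.
  rewrite -lee_fin; case: Y4 => _ <-; apply: integral_ge0 => w _.
  by rewrite lee_fin exprn_even_ge0.
elim: n => [|n IH].
  under eq_integral do rewrite /partial_sum big_ord0 expr0n/=.
  by rewrite integral0 expr0n/= mul0r.
under eq_integral do rewrite partial_sumS.
rewrite (@integral_partial_sumS _ _ _ _ _ _ (fun x y => ((x + y) ^+ 4)%:E))//; last 2 first.
- apply/measurable_EFinP; apply: measurable_funX; apply: measurable_funD.
    exact: measurable_fst.
  exact: measurable_snd.
- by move=> x y; rewrite lee_fin exprn_even_ge0.
have inner x : (\int[P]_w' ((x + Y 0%N w') ^+ 4)%:E <=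
    (x ^+ 4)%:E + ((8 * s2) * x ^+ 2 + 3 * m4)%:E)%E.
  have -> : ((x ^+ 4)%:E + ((8 * s2) * x ^+ 2 + 3 * m4)%:E =
      (x ^+ 4 + (4 * x ^+ 3 * 0 + (8 * x ^+ 2 * s2 + 3 * m4)))%:E)%E.
    by rewrite -EFinD mulr0 add0r mulrAC.
  have [_ <-] : mean_is P (fun w => x ^+ 4 + (4 * x ^+ 3 * Y 0%N w +
      (8 * x ^+ 2 * Y 0%N w ^+ 2 + 3 * Y 0%N w ^+ 4)))
      (x ^+ 4 + (4 * x ^+ 3 * 0 + (8 * x ^+ 2 * s2 + 3 * m4))).
    apply: mean_isD; first exact: mean_is_cst.
    by apply: mean_isD; [exact: mean_isZ|apply: mean_isD; exact: mean_isZ].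
  apply: ge0_le_integral => //.
  - by move=> w _; rewrite lee_fin exprn_even_ge0.
  - apply/measurable_EFinP; apply: measurable_funX; exact: measurable_funD.
  - by apply/measurable_EFinP; repeat first [exact: measurable_funX |
      apply: measurable_funD | apply: measurable_funM | exact: mY].
  - move=> w _; rewrite lee_fin -subr_ge0.
    rewrite [leRHS](_ : _ = 2 * (Y 0%N w * (x - Y 0%N w)) ^+ 2); last by ring.
    by rewrite mulr_ge0// sqr_ge0.
have S2 := second_moment n Y2.
have B : mean_is P (fun w => 8 * s2 * partial_sum Y n w ^+ 2 + 3 * m4)
    (8 * s2 * (n%:R * s2) + 3 * m4).
  by apply: mean_isD; [exact: mean_isZ|exact: mean_is_cst].
apply: (@le_trans _ _ (\int[P]_w ((partial_sum Y n w ^+ 4)%:E +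
    ((8 * s2) * partial_sum Y n w ^+ 2 + 3 * m4)%:E)))%E.
  apply: ge0_le_integral => //.
  - by move=> w _; apply: integral_ge0 => w' _; rewrite lee_fin exprn_even_ge0.
  - apply: (@measurable_fun_fubini_tonelli_F _ _ T T R P
      (fun p => ((partial_sum Y n p.1 + Y 0%N p.2) ^+ 4)%:E)).
    + apply/measurable_EFinP; apply: measurable_funX; apply: measurable_funD.
        exact: measurableT_comp.
      exact: measurableT_comp.
    + by move=> x; rewrite lee_fin exprn_even_ge0.
  - apply/measurable_EFinP.
    by repeat first [exact: measurable_funX | exact: measurable_cst |
      apply: measurable_funD | apply: measurable_funM | exact: mS].
rewrite ge0_integralD//.
- have [_ ->] := B.
  rewrite (le_trans (leeD2r _ IH))// -EFinD lee_fin -natr1.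
  have n0 : (0 : R) <= n%:R by [].
  have h1 : 0 <= s2 ^+ 2 by exact: sqr_ge0.
  have := mulr_ge0 n0 h1; have := mulr_ge0 n0 m40; lra.
- by move=> w _; rewrite lee_fin exprn_even_ge0.
- by apply/measurable_EFinP; exact: measurable_funX.
- move=> w _; rewrite lee_fin; apply: addr_ge0; last by rewrite mulr_ge0.
  by rewrite mulr_ge0 ?sqr_ge0// mulr_ge0.
- apply/measurable_EFinP.
  by repeat first [exact: measurable_funX | exact: measurable_cst |
      apply: measurable_funD | apply: measurable_funM | exact: mS].
Qed.

Lemma tail_second_moment s2 n a : mean_is P (fun w => Y 0%N w ^+ 2) s2 -> 0 < a ->
  (P [set w | (a <= `|partial_sum Y n w|)%R] <= (n%:R * s2 / a ^+ 2)%:E)%E.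
Proof.
move=> Y2 a0; have [_ S2] := second_moment n Y2.
apply: (@le_trans _ _ (P [set w | (a ^+ 2 <= partial_sum Y n w ^+ 2)%R])); last first.
  apply: markov_le; rewrite ?exprn_gt0 ?S2//; first exact: measurable_funX.
  by move=> w; exact: sqr_ge0.
apply: le_measure; rewrite ?inE//.
- by apply: measurable_le => //; exact: measurableT_comp.
- by apply: measurable_le => //; exact: measurable_funX.
- move=> w /= aS; rewrite -(real_normK (num_real (partial_sum Y n w))).
  by rewrite ler_pXn2r// nnegrE// ltW.
Qed.

Lemma tail_fourth_moment s2 m4 n a : mean_is P (fun w => Y 0%N w ^+ 2) s2 ->
  mean_is P (fun w => Y 0%N w ^+ 4) m4 -> 0 < a ->
  (P [set w | (a <= `|partial_sum Y n w|)%R] <=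
    (n%:R ^+ 2 * (8 * s2 ^+ 2 + 3 * m4) / a ^+ 4)%:E)%E.
Proof.
move=> Y2 Y4 a0; have S4 := fourth_moment n Y2 Y4.
apply: (@le_trans _ _ (P [set w | (a ^+ 4 <= partial_sum Y n w ^+ 4)%R])); last first.
  apply: markov_le; rewrite ?exprn_gt0//; first exact: measurable_funX.
  by move=> w; rewrite exprn_even_ge0.
apply: le_measure; rewrite ?inE//.
- by apply: measurable_le => //; exact: measurableT_comp.
- by apply: measurable_le => //; exact: measurable_funX.
- move=> w /= aS.
  have -> : partial_sum Y n w ^+ 4 = `|partial_sum Y n w| ^+ 4.
    by rewrite -normrX ger0_norm// exprn_even_ge0.
  by rewrite ler_pXn2r// nnegrE// ltW.
Qed.

End moments.

(** * Gaussian averages *)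

Section gaussian.
Context {R : realType}.
Implicit Types (f : R -> R) (x s t u v : R).
Local Notation leb := (@lebesgue_measure R).

Lemma normal_pdf_mul x s t u v : 0 < s -> 0 < t ->
  let r := Num.sqrt (s ^+ 2 + t ^+ 2) in
  normal_pdf v t u * normal_pdf x s v =
  normal_pdf x r u * normal_pdf ((u * s ^+ 2 + x * t ^+ 2) / r ^+ 2) (s * t / r) v.
Proof.
move=> s0 t0 r.
have r2 : r ^+ 2 = s ^+ 2 + t ^+ 2 by rewrite sqr_sqrtr// addr_ge0// sqr_ge0.
have r0 : 0 < r by rewrite sqrtr_gt0 addr_gt0// exprn_gt0.
have q0 : 0 < s * t / r by rewrite divr_gt0// mulr_gt0.
rewrite !normal_pdfE ?gt_eqF//.
rewrite mulrACA [RHS]mulrACA /normal_fun -!expRD /normal_peak -!invfM.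
have pi2 : (0:R) <= pi *+ 2 by rewrite mulrn_wge0// pi_ge0.
have e1 z : 0 < z -> Num.sqrt (z ^+ 2 * pi *+ 2) = z * Num.sqrt (pi *+ 2).
  by move=> z0; rewrite -mulrnAr sqrtrM ?sqr_ge0// sqrtr_sqr gtr0_norm.
rewrite !e1//; congr (_^-1 * expR _).
  by field; rewrite gt_eqF.
have sne : s != 0 by rewrite gt_eqF.
have tne : t != 0 by rewrite gt_eqF.
have rne : s ^+ 2 + t ^+ 2 != 0 by rewrite -r2 gt_eqF// exprn_gt0.
have -> : (s * t / r) ^+ 2 = s ^+ 2 * t ^+ 2 / (s ^+ 2 + t ^+ 2).
  by rewrite -r2 !exprMn exprVn.
rewrite r2; field.
by rewrite tne sne rne.
Qed.

Lemma measurable_normal_pdf2 t : 0 < t ->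
  measurable_fun setT (fun p : R * R => normal_pdf p.1 t p.2).
Proof.
move=> t0; rewrite (_ : (fun p => _) = (fun p : R * R => normal_pdf 0 t (p.2 - p.1))).
  apply: measurableT_comp; first exact: measurable_normal_pdf.
  apply: measurable_funB; [exact: measurable_snd|exact: measurable_fst].
apply/funext => p; rewrite !normal_pdfE ?gt_eqF//.
by rewrite /normal_fun subr0.
Qed.

Definition gauss_avg s f x : \bar R :=
  (\int[leb]_u (f u * normal_pdf x s u)%:E)%E.

(** Variances add under repeated Gaussian smoothing: after Tonelli, [normal_pdf_mul] leaves a
    density in [v] whose integral is 1. *)
Lemma gauss_avg_avg s t f x : 0 < s -> 0 < t ->
  measurable_fun setT f -> (forall u, 0 <= f u) ->
  (\int[leb]_v (gauss_avg t f v * (normal_pdf x s v)%:E) =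
   gauss_avg (Num.sqrt (s ^+ 2 + t ^+ 2)) f x)%E.
Proof.
move=> s0 t0 mf f0; rewrite /gauss_avg.
pose F (p : R * R) : \bar R := (f p.2 * normal_pdf p.1 t p.2 * normal_pdf x s p.1)%:E.
have mF : measurable_fun setT F.
  apply/measurable_EFinP; apply: measurable_funM.
    apply: measurable_funM; last exact: measurable_normal_pdf2.
    exact: (measurableT_comp mf).
  by apply: measurableT_comp => //; exact: measurable_normal_pdf.
have F0 p : (0 <= F p)%E.
  by rewrite lee_fin !mulr_ge0// ?normal_pdf_ge0.
transitivity (\int[leb]_v \int[leb]_u F (v, u))%E.
  apply: eq_integral => v _; rewrite -ge0_integralZr//.
  - apply/measurable_EFinP; apply: measurable_funM => //; exact: measurable_normal_pdf.
  - by move=> u _; rewrite lee_fin mulr_ge0// normal_pdf_ge0.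
  - by rewrite lee_fin normal_pdf_ge0.
rewrite fubini_tonelli//; apply: eq_integral => u _.
rewrite /F/=.
under eq_integral do rewrite -mulrA normal_pdf_mul//.
under eq_integral do rewrite mulrA EFinM.
rewrite ge0_integralZl ?integral_normal_pdf ?mule1//.
- by apply/measurable_EFinP; exact: measurable_normal_pdf.
- by move=> v _; rewrite lee_fin normal_pdf_ge0.
- by rewrite lee_fin mulr_ge0// normal_pdf_ge0.
Qed.

Lemma gauss_avg_std s f x : 0 < s -> continuous f -> (forall u, 0 <= f u) ->
  gauss_avg s f x = (\int[leb]_y (f (x + s * y) * normal_pdf 0 1 y)%:E)%E.
Proof.
move=> s0 cf f0; rewrite /gauss_avg.
pose F := fun y : R => x + s * y.
have dF : F^`()%classic = cst s.
  apply/funext => y; rewrite /F derive1E deriveD// derive_cst add0r.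
  by rewrite deriveM// derive_cst derive_id scaler0 addr0 scaler1.
(* The factored form gives the limits of [F] at both infinities as a translation followed by a
   positive scaling. *)
have FE : F = (fun y => (y + x / s) * s).
  by apply/funext => y; rewrite /F; field; rewrite gt_eqF.
have cF : continuous F.
  move=> y; apply: cvgD; [exact: cvg_cst|apply: cvgM; [exact: cvg_cst|exact: cvg_id]].
rewrite (@increasing_ge0_integration_by_substitutionT _ F).
- apply: eq_integral => y _; congr EFin; rewrite /= dF /=.
  rewrite !normal_pdfE ?gt_eqF ?ltr01//= -mulrA; congr (_ * _).
  change (normal_peak s * normal_fun x s (x + s * y) * s = normal_peak 1 * normal_fun 0 1 y).
  have -> : normal_fun x s (x + s * y) = normal_fun 0 1 y.
    rewrite /normal_fun; congr expR.
    by field; rewrite gt_eqF.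
  rewrite mulrAC; congr (_ * _); rewrite /normal_peak.
  rewrite -mulrnAr sqrtrM ?sqr_ge0// sqrtr_sqr gtr0_norm// invfM.
  by rewrite expr1n mul1r mulrAC mulVf ?mul1r// gt_eqF.
- by move=> y z yz; rewrite /F ltrD2l ltr_pM2l.
- by rewrite dF => y; exact: cvg_cst.
- by rewrite dF; exact: is_cvg_cst.
- by rewrite dF; exact: is_cvg_cst.
- by move=> y; apply: derivableD => //; exact: derivableM.
- by rewrite FE; apply: gt0_cvgMlNy => //; exact: cvg_addrr_Ny.
- by rewrite FE; apply: gt0_cvgMly => //; exact: cvg_addrr.
- by move=> u; apply: cvgM; [exact: cf|apply: continuous_normal_pdf; rewrite gt_eqF].
- by move=> u; rewrite mulr_ge0// normal_pdf_ge0.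
Qed.

Lemma normal_pdf_even y : normal_pdf 0 1 (- y) = normal_pdf 0 1 y :> R.
Proof. by rewrite !normal_pdfE ?oner_neq0//= /normal_fun !subr0 sqrrN. Qed.

Lemma integralT_sym (f : R -> \bar R) : measurable_fun setT f -> (forall y, (0 <= f y)%E) ->
  (\int[leb]_y f (- y)%R = \int[leb]_y f y)%E.
Proof.
move=> mf f0.
transitivity (\int[pushforward leb (-%R : measurableTypeR R -> measurableTypeR R)]_y f y)%E.
  by rewrite ge0_integral_pushforward//=; exact: measurable_funN.
by apply: eq_measure_integral => A mA _; exact: lebesgue_measureN.
Qed.

(** With [z = |y|], the right side is at least [32 (1 + z^2 / 8)^2 = 32 + 8 z^2 + z^4 / 2], and
    [z^2 (z - 4)^2 >= 0] says that [z^4 / 2 + 8 z^2 >= 4 z^3]. *)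
Lemma expR_ge_sqr (y : R) : `|y| ^+ 3 <= 32 * expR (y ^+ 2 / 4).
Proof.
have e2 : expR (y ^+ 2 / 4) = expR (y ^+ 2 / 8) ^+ 2.
  by rewrite [RHS]expr2 -expRD; congr expR; field.
have e1 : 1 + y ^+ 2 / 8 <= expR (y ^+ 2 / 8) by exact: expR_ge1Dx.
have : (1 + y ^+ 2 / 8) ^+ 2 <= expR (y ^+ 2 / 4).
  rewrite e2 ler_pXn2r// nnegrE ?expR_ge0//.
  by rewrite addr_ge0// divr_ge0// sqr_ge0.
rewrite -(real_normK (num_real y)).
have := normr_ge0 y; move: `|y| => z z0 h.
have : 0 <= (z - 4) ^+ 2 * z ^+ 2 by rewrite mulr_ge0// sqr_ge0.
have : 0 <= z ^+ 3 by rewrite exprn_ge0.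
lra.
Qed.

(** Half of the exponent [y^2 / 2] absorbs the cube, leaving a multiple of the density with standard
    deviation [sqrt 2]. Only finiteness matters later, so the value stays existential. *)
Lemma gauss_moment3 : exists b : R, mean_is leb (fun y => `|y| ^+ 3 * normal_pdf 0 1 y) b.
Proof.
have s2 : Num.sqrt 2 != 0 :> R by rewrite gt_eqF// sqrtr_gt0.
suff [u hu _] : exists2 u : R, mean_is leb (fun y => `|y| ^+ 3 * normal_pdf 0 1 y) u &
    `|u| <= 32 * normal_peak 1 / normal_peak (Num.sqrt 2) * 1 by exists u.
apply: (@mean_is_dominated _ _ _ leb _ (fun y => 32 * normal_peak 1 / normal_peak (Num.sqrt 2)
    * normal_pdf 0 (Num.sqrt 2) y)).
- apply: measurable_funM; last exact: measurable_normal_pdf.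
  by apply: measurable_funX; exact: normr_measurable.
- move=> y; rewrite ger0_norm ?mulr_ge0 ?exprn_ge0 ?normal_pdf_ge0//.
  rewrite !normal_pdfE ?oner_neq0//= /normal_fun !subr0.
  rewrite [leRHS](_ : _ = normal_peak 1 * (32 * expR (- y ^+ 2 / (Num.sqrt 2 ^+ 2 *+ 2)))); last first.
    by field; rewrite gt_eqF// normal_peak_gt0.
  rewrite sqr_sqrtr// mulrCA ler_pM2l ?normal_peak_gt0 ?oner_neq0//.
  rewrite (_ : - y ^+ 2 / (2 *+ 2) = y ^+ 2 / 4 - y ^+ 2 / (1 ^+ 2 *+ 2)); last by field.
  by rewrite expRD mulNr mulrA ler_pM2r ?expR_gt0//; exact: expR_ge_sqr.
- apply: mean_isZ; split; last exact: integral_normal_pdf.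
  exact: integrable_normal_pdf.
Qed.

Lemma gauss_moment0 : mean_is leb (normal_pdf 0 1) 1.
Proof. by split; [exact: integrable_normal_pdf|exact: integral_normal_pdf]. Qed.

Lemma gauss_moment1 : mean_is leb (fun y => y * normal_pdf 0 1 y) 0.
Proof.
have [b hb] := gauss_moment3.
have m1 : measurable_fun setT (fun y : R => y * normal_pdf 0 1 y).
  by apply: measurable_funM => //; exact: measurable_normal_pdf.
have [u hu _] : exists2 u : R, mean_is leb (fun y => y * normal_pdf 0 1 y) u & `|u| <= 1 + b.
  apply: (@mean_is_dominated _ _ _ leb _ (fun y => normal_pdf 0 1 y + `|y| ^+ 3 * normal_pdf 0 1 y)) => //.
    move=> y; rewrite normrM (ger0_norm (normal_pdf_ge0 _ _ _)).
    rewrite -{2}[normal_pdf 0 1 y]mul1r -mulrDl ler_wpM2r ?normal_pdf_ge0//.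
    have := normr_ge0 y; move: `|y| => z z0.
    have [z1|z1] := leP z 1; first by rewrite (le_trans z1)// lerDl exprn_ge0.
    by rewrite ler_wpDl// -[leLHS]expr1 ler_weXn2l// ltW.
  exact: mean_isD gauss_moment0 hb.
split; first by have [] := hu.
have mf : measurable_fun setT (fun y : R => (y * normal_pdf 0 1 y)%:E).
  exact/measurable_EFinP.
pose f := (fun y : R => (y * normal_pdf 0 1 y)%:E); rewrite -/f in mf *.
rewrite integralE.
(* The integrand is odd, so the reflection [y -> - y] exchanges its positive and negative parts. *)
have -> : (\int[leb]_y f^\- y = \int[leb]_y f^\+ y)%E.
  have <- := @integralT_sym f^\+%E (measurable_funepos mf) (fun y => funepos_ge0 f y).
  apply: eq_integral => y _; rewrite funenegE funeposE /f normal_pdf_even.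
  by rewrite mulNr -EFinN.
rewrite subee//; apply: integrable_pos_fin_num => //.
by have [] := hu.
Qed.

Definition gfun (y : R) := expR (- (y ^+ 2 / 2)).

Let gfunE y : normal_pdf 0 1 y = normal_peak 1 * gfun y.
Proof.
rewrite normal_pdfE ?oner_neq0//= /normal_fun /gfun subr0 expr1n mulNr.
by congr (_ * expR (- (_ / _))).
Qed.

Let cgfun : continuous gfun.
Proof.
move=> y; apply: (@cvg_comp _ _ _ (fun y => - (y ^+ 2 / 2)) expR); last exact: continuous_expR.
apply: cvgN; apply: cvgM; last exact: cvg_cst.
exact: exprn_continuous.
Qed.

(** This antiderivative replaces the integration by parts that shows that the unit Gaussian has
    variance 1. *)
Let dgfun y : is_derive y (1:R) (fun y => - (y * gfun y)) ((y ^+ 2 - 1) * gfun y).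
Proof.
have d0 : is_derive y (1:R) (fun y => - (2^-1 * y ^+ 2)) (- y).
  by apply: is_derive_eq; rewrite /GRing.scale/=; field.
have d1 : is_derive y (1:R) gfun (- y * gfun y).
  have -> : gfun = (fun y => expR (- (2^-1 * y ^+ 2))).
    by apply/funext => z; rewrite /gfun [_ / 2]mulrC.
  by apply: is_derive_eq; rewrite /GRing.scale/=; field.
have [dH eH] := is_deriveN (is_deriveM (is_derive_id y 1) d1).
by apply: DeriveDef => //; rewrite eH /GRing.scale/=; ring.
Qed.

Let gtail (y : R) : 1 <= y -> 0 <= y * gfun y <= 2 / y.
Proof.
move=> y1; have y0 : 0 < y by exact: lt_le_trans y1.
apply/andP; split; first by rewrite mulr_ge0 ?expR_ge0 ?ltW.
rewrite ler_pdivlMr// /gfun expRN mulrAC.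
rewrite ler_pdivrMr ?expR_gt0// -ler_pdivrMl//.
have : 1 + y ^+ 2 / 2 <= expR (y ^+ 2 / 2) by exact: expR_ge1Dx.
by nra.
Qed.

Let cvg_gtail : - (y * gfun y) @[y --> +oo] --> (0 : R).
Proof.
apply/cvgrPdist_lt => e e0; near=> y.
have y1 : 1 <= y by near: y; exact: nbhs_pinfty_ge.
have y0 : 0 < y by exact: lt_le_trans y1.
have /andP[a b] := gtail y1.
rewrite sub0r opprK ger0_norm// (le_lt_trans b)// ltr_pdivrMr// mulrC -ltr_pdivrMr//.
by near: y; apply: nbhs_pinfty_gt; exact: num_real.
Unshelve. all: by end_near. Qed.

Let int_ge1 : (\int[leb]_(y in `[1%R, +oo[) ((y ^+ 2 - 1) * gfun y)%:E = (gfun 1)%:E)%E.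
Proof.
rewrite (@ge0_continuous_FTC2y _ _ (fun y => - (y * gfun y)) _ 0).
- by rewrite -EFinB sub0r opprK mul1r.
- move=> y y1; rewrite mulr_ge0 ?expR_ge0// subr_ge0.
  by rewrite -(expr1n _ 2) ler_pXn2r// nnegrE// (le_trans _ y1).
- apply: continuous_subspaceT => y; apply: cvgM; last exact: cgfun.
  apply: cvgB; [exact: exprn_continuous|exact: cvg_cst].
- exact: cvg_gtail.
- by move=> y _; have [] := dgfun y.
- apply: cvg_at_right_filter.
  by apply: cvgN; apply: cvgM; [exact: cvg_id|exact: cgfun].
- by move=> y _; rewrite derive1E; have [] := dgfun y.
Qed.

Let int_le1 : (\int[leb]_(y in `[0%R, 1%R]) ((1 - y ^+ 2) * gfun y)%:E = (gfun 1)%:E)%E.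
Proof.
have d y : is_derive y (1:R) (fun y => y * gfun y) ((1 - y ^+ 2) * gfun y).
  have := is_deriveN (dgfun y); rewrite -mulNr opprB.
  by rewrite (_ : - _ = (fun y => y * gfun y))//; apply/funext => z; rewrite !fctE opprK.
have c : continuous (fun y : R => y * gfun y).
  by move=> y; apply: cvgM; [exact: cvg_id|exact: cgfun].
rewrite (@continuous_FTC2 _ _ (fun y => y * gfun y))//.
- by rewrite -EFinB mul0r subr0 mul1r.
- apply: continuous_subspaceT => y; apply: cvgM; last exact: cgfun.
  apply: cvgB; [exact: cvg_cst|exact: exprn_continuous].
- split.
  + by move=> y _; have [] := d y.
  + apply: cvg_at_right_filter; exact: c.
  + apply: cvg_at_left_filter; exact: c.
- by move=> y _; rewrite derive1E; have [] := d y.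
Qed.

Let mgfun : measurable_fun setT gfun.
Proof. exact: continuous_measurable_fun. Qed.

(** [y^2 - 1] changes sign at 1, so the half line is cut there to keep every integrand nonnegative.
    The excess of [y^2 gfun] over [gfun] beyond 1 and its deficit below 1 both equal [gfun 1]. *)
Let int_sqr_pos : (\int[leb]_(y in `[0%R, +oo[) (y ^+ 2 * gfun y)%:E =
  \int[leb]_(y in `[0%R, +oo[) (gfun y)%:E)%E.
Proof.
have g0 y : 0 <= gfun y by exact: expR_ge0.
have m2 : measurable_fun setT (fun y : R => y ^+ 2) by exact: exprn_measurable.
have mq : measurable_fun setT (fun y => ((y : R) ^+ 2 * gfun y)%:E).
  by apply/measurable_EFinP; exact: measurable_funM.
have mg : measurable_fun setT (fun y => (gfun y)%:E) by exact/measurable_EFinP.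
have split01 (f : R -> \bar R) : measurable_fun setT f -> (forall y, (0 <= f y)%E) ->
    (\int[leb]_(y in `[0%R, +oo[) f y =
     \int[leb]_(y in `[0%R, 1%R]) f y + \int[leb]_(y in `[1%R, +oo[) f y)%E.
  move=> mf f0.
  have -> : `[0, +oo[%classic = `[0, 1] `|` `]1, +oo[ :> set R.
    apply/seteqP; split => y /=; rewrite !in_itv/= !andbT.
      by move=> ->; case: (leP y 1); [left|right].
    by case => [/andP[]//|]; move/ltW; exact: le_trans.
  rewrite ge0_integral_setU//=.
  - congr (_ + _)%E; apply: integral_itv_obnd_cbnd; exact: measurable_funTS.
  - exact: measurable_funTS.
  - rewrite disj_set2E; apply/eqP; rewrite -subset0 => y []/=.
    by rewrite !in_itv/= andbT => -[/andP[_ y1]]; rewrite ltNge y1.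
rewrite !split01//; last by move=> y; rewrite lee_fin mulr_ge0// sqr_ge0.
have h1 : (\int[leb]_(y in `[0%R, 1%R]) (gfun y)%:E =
    \int[leb]_(y in `[0%R, 1%R]) (y ^+ 2 * gfun y)%:E +
    \int[leb]_(y in `[0%R, 1%R]) ((1 - y ^+ 2) * gfun y)%:E)%E.
  rewrite -ge0_integralD//=.
  - by apply: eq_integral => y _; rewrite -EFinD -mulrDl addrC subrK mul1r.
  - by move=> y _; rewrite lee_fin mulr_ge0// sqr_ge0.
  - exact: measurable_funTS.
  - move=> y; rewrite in_itv/= => /andP[y0 y1]; rewrite lee_fin mulr_ge0// subr_ge0.
    by rewrite -(expr1n _ 2) ler_pXn2r// nnegrE.
  - apply/measurable_EFinP/measurable_funTS; apply: measurable_funM => //.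
    exact: measurable_funB.
have h2 : (\int[leb]_(y in `[1%R, +oo[) (y ^+ 2 * gfun y)%:E =
    \int[leb]_(y in `[1%R, +oo[) ((y ^+ 2 - 1) * gfun y)%:E +
    \int[leb]_(y in `[1%R, +oo[) (gfun y)%:E)%E.
  rewrite -ge0_integralD//=.
  - by apply: eq_integral => y _; rewrite -EFinD; congr EFin; ring.
  - move=> y; rewrite in_itv/= andbT => y1; rewrite lee_fin mulr_ge0// subr_ge0.
    by rewrite -(expr1n _ 2) ler_pXn2r// nnegrE// (le_trans _ y1).
  - apply/measurable_EFinP/measurable_funTS; apply: measurable_funM => //.
    exact: measurable_funB.
  - by move=> y _; rewrite lee_fin.
  - exact: measurable_funTS.
by rewrite h1 h2 int_ge1 int_le1 addeA.
Qed.

Lemma gauss_moment2 : mean_is leb (fun y => y ^+ 2 * normal_pdf 0 1 y) 1.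
Proof.
apply: mean_is_ge0.
- apply: measurable_funM; last exact: measurable_normal_pdf.
  exact: exprn_measurable.
- by move=> y; rewrite mulr_ge0 ?sqr_ge0 ?normal_pdf_ge0.
rewrite -(integral_normal_pdf 0 1).
under eq_integral do rewrite gfunE mulrCA EFinM.
under [RHS]eq_integral do rewrite gfunE EFinM.
have p0 : (0 <= (normal_peak 1 : R)%:E)%E by rewrite lee_fin normal_peak_ge0.
have m2 : measurable_fun setT (fun y : R => y ^+ 2) by exact: exprn_measurable.
rewrite !ge0_integralZl//; last 4 first.
- exact/measurable_EFinP.
- by move=> y _; rewrite lee_fin expR_ge0.
- by apply/measurable_EFinP; exact: measurable_funM.
- by move=> y _; rewrite lee_fin mulr_ge0 ?sqr_ge0 ?expR_ge0.
congr (_ * _)%E.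
have gN y : gfun (- y) = gfun y by rewrite /gfun sqrrN.
rewrite !ge0_symfun_integralT.
- by rewrite (_ : [set x | 0 <= x] = `[0, +oo[%classic) ?int_sqr_pos// set_itvcy.
- by move=> y; exact: expR_ge0.
- exact: cgfun.
- by move=> y /=; rewrite gN.
- by move=> y; rewrite mulr_ge0 ?sqr_ge0 ?expR_ge0.
- move=> y; apply: cvgM; last exact: cgfun.
  exact: exprn_continuous.
- by move=> y /=; rewrite gN sqrrN.
Qed.

End gaussian.

(** * Smooth steps *)

Section third_order.
Context {R : realType}.
Implicit Types f g : R -> R.

(* Unlike a bound on the third derivative, this also holds for the cubic splines
   below, which are only C^2 at their knots. *)
Definition third_order M f := exists f1 f2 : R -> R, forall x h : R,
  `|f (x + h) - (f x + f1 x * h + f2 x * h ^+ 2)| <= M * `|h| ^+ 3.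

Lemma third_orderD M N f g : third_order M f -> third_order N g ->
  third_order (M + N) (fun x => f x + g x).
Proof.
move=> [f1 [f2 fM]] [g1 [g2 gN]].
exists (fun x => f1 x + g1 x), (fun x => f2 x + g2 x) => x h.
have := fM x h; have := gN x h; set a := f _ - _; set b := g _ - _ => hb ha.
have -> : f (x + h) + g (x + h) - (f x + g x + (f1 x + g1 x) * h + (f2 x + g2 x) * h ^+ 2) = a + b.
  by rewrite /a /b; ring.
by rewrite (le_trans (ler_normD _ _))// mulrDl lerD.
Qed.

Lemma third_orderZ M k f : third_order M f -> third_order (`|k| * M) (fun x => k * f x).
Proof.
move=> [f1 [f2 fM]].
exists (fun x => k * f1 x), (fun x => k * f2 x) => x h.
have -> : k * f (x + h) - (k * f x + k * f1 x * h + k * f2 x * h ^+ 2) =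
    k * (f (x + h) - (f x + f1 x * h + f2 x * h ^+ 2)) by ring.
by rewrite normrM -mulrA ler_wpM2l.
Qed.

Lemma third_order_affine M k c f : third_order M f ->
  third_order (`|k| ^+ 3 * M) (fun x => f (k * x + c)).
Proof.
move=> [f1 [f2 fM]].
exists (fun x => k * f1 (k * x + c)), (fun x => k ^+ 2 * f2 (k * x + c)) => x h.
have := fM (k * x + c) (k * h).
have -> : k * x + c + k * h = k * (x + h) + c by ring.
rewrite normrM exprMn.
rewrite (_ : M * _ = `|k| ^+ 3 * M * `|h| ^+ 3); last by ring.
by rewrite (_ : _ + f2 _ * _ = f (k * x + c) + k * f1 (k * x + c) * h +
  k ^+ 2 * f2 (k * x + c) * h ^+ 2)//; ring.
Qed.

(** The truncated cube, building block of cubic splines; its second derivative [6 max(x, 0)] is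
    Lipschitz, which is all that [third_order] asks for. *)
Let cub (x : R) : R := Num.max x 0 ^+ 3.

Let cub_third_order : third_order 1 cub.
Proof.
exists (fun x => 3 * Num.max x 0 ^+ 2), (fun x => 3 * Num.max x 0) => x h.
rewrite mul1r /cub.
have [x0|x0] := leP x 0; have [xh0|xh0] := leP (x + h) 0.
- by rewrite !expr0n/= !mulr0 !mul0r !addr0 subrr normr0 exprn_ge0.
- rewrite !expr0n/= !mulr0 !mul0r !addr0 subr0 normrX.
  rewrite ler_pXn2r ?nnegrE// !ger0_norm//; lra.
- rewrite expr0n/=.
  rewrite (_ : _ - _ = h ^+ 3 - (x + h) ^+ 3); last by ring.
  have h0 : h < 0 by lra.
  rewrite -normrX (ltr0_norm (x := h ^+ 3)); last by rewrite exprn_odd_lt0.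
  rewrite (_ : h ^+ 3 - _ = (- (x + h)) ^+ 3 - (- h) ^+ 3); last by ring.
  have hx : (- (x + h)) ^+ 3 <= (- h) ^+ 3.
    by rewrite lerXn2r ?nnegrE//; lra.
  have : 0 <= (- (x + h)) ^+ 3 by rewrite exprn_ge0//; lra.
  by rewrite ler0_norm ?subr_le0// opprB; lra.
- by rewrite (_ : _ - _ = h ^+ 3) ?normrX//; ring.
Qed.

(** The third finite difference of the truncated cube divided by 6, that is, the integral of the
    quadratic B-spline with knots 0, 1, 2, 3; it rises from 0 to 1 on [[0, 3]]. *)
Let step (x : R) : R :=
  6^-1 * cub x + - 2^-1 * cub (1 * x + -1) + 2^-1 * cub (1 * x + -2) + - 6^-1 * cub (1 * x + -3).

Let step_third_order : exists M, third_order M step.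
Proof.
eexists; apply: third_orderD; last by apply: third_orderZ; apply: third_order_affine cub_third_order.
apply: third_orderD; last by apply: third_orderZ; apply: third_order_affine cub_third_order.
apply: third_orderD; last by apply: third_orderZ; apply: third_order_affine cub_third_order.
by apply: third_orderZ; exact: cub_third_order.
Qed.

Let cub0 x : x <= 0 -> cub x = 0.
Proof. by move=> x0; rewrite /cub max_r// expr0n. Qed.

Let cubE x : 0 <= x -> cub x = x ^+ 3.
Proof. by move=> x0; rewrite /cub max_l. Qed.

Let step_le0 x : x <= 0 -> step x = 0.
Proof. by move=> x0; rewrite /step !cub0; lra. Qed.

Let step_ge3 x : 3 <= x -> step x = 1.
Proof. by move=> x3; rewrite /step !cubE; lra. Qed.

Let step01 x : 0 <= step x <= 1.
Proof.
have [x0|x0] := leP x 0; first by rewrite step_le0// lexx ler01.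
have [x3|x3] := leP 3 x; first by rewrite step_ge3// ler01 lexx.
rewrite /step.
have [x1|x1] := leP x 1.
  have c1 : cub (1 * x + -1) = 0 by apply: cub0; lra.
  have c2 : cub (1 * x + -2) = 0 by apply: cub0; lra.
  have c3 : cub (1 * x + -3) = 0 by apply: cub0; lra.
  rewrite (@cubE x (ltW x0)).
  have : 0 <= x ^+ 3 by rewrite exprn_ge0// ltW.
  have : x ^+ 3 <= 1 by rewrite exprn_ile1// ltW.
  lra.
have [x2|x2] := leP x 2.
  have c2 : cub (1 * x + -2) = 0 by apply: cub0; lra.
  have c3 : cub (1 * x + -3) = 0 by apply: cub0; lra.
  have c1 : cub (1 * x + -1) = (1 * x + -1) ^+ 3 by apply: cubE; lra.
  rewrite (@cubE x (ltW x0)).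
  (* With [u = x - 1] and [v = 2 - x], so [u + v = 1], one has [6 step x = 5 u^3 + 12 u^2 v + 6 u
     v^2 + v^3], which lies coefficientwise between 0 and [6 (u + v)^3]. *)
  have u0 : 0 <= x - 1 by lra.
  have u1 : 0 <= 2 - x by lra.
  have := mulr_ge0 u0 u1.
  have := mulr_ge0 u0 (mulr_ge0 u0 u1).
  have := mulr_ge0 u1 (mulr_ge0 u0 u1).
  nra.
have c3 : cub (1 * x + -3) = 0 by apply: cub0; lra.
have c1 : cub (1 * x + -1) = (1 * x + -1) ^+ 3 by apply: cubE; lra.
have c2 : cub (1 * x + -2) = (1 * x + -2) ^+ 3 by apply: cubE; lra.
rewrite (@cubE x (ltW x0)).
(* Here [step x = 1 - (3 - x)^3 / 6]. *)
have u0 : 0 <= 3 - x by lra.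
have := exprn_ge0 3 u0.
have : (3 - x) ^+ 3 <= 1 by rewrite exprn_ile1//; lra.
by rewrite !exprS expr0; lra.
Qed.

Let continuous_step : continuous step.
Proof.
have ccub : continuous cub.
  have cm : continuous (fun y : R => (y + `|y|) / 2).
    move=> y; apply: cvgM; last exact: cvg_cst.
    by apply: cvgD; [exact: cvg_id|exact: norm_continuous].
  have -> : cub = (fun y => y ^+ 3) \o (fun y : R => (y + `|y|) / 2).
    by apply/funext => y; rewrite /cub maxr_absE addr0 subr0.
  by move=> x; apply: continuous_comp; [exact: cm|exact: exprn_continuous].
have caff (c : R) : continuous (fun x : R => 1 * x + c).
  move=> x; apply: cvgD; last exact: cvg_cst.
  by apply: cvgM; [exact: cvg_cst|exact: cvg_id].
have cc (k c : R) : continuous (fun x : R => k * cub (1 * x + c)).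
  move=> x; apply: cvgM; first exact: cvg_cst.
  by apply: (@cvg_comp _ _ _ (fun x : R => 1 * x + c) cub); [exact: caff|exact: ccub].
move=> x; apply: cvgD; last exact: cc.
apply: cvgD; last exact: cc.
apply: cvgD; last exact: cc.
apply: cvgM; [exact: cvg_cst|exact: ccub].
Qed.

Lemma smooth_step (a e : R) : 0 < e -> exists f : R -> R,
  [/\ continuous f, forall x, 0 <= f x <= 1, forall x, x <= a -> f x = 1,
      forall x, a + e <= x -> f x = 0 & exists M, third_order M f].
Proof.
(* The decreasing affine map that sends [a] to 3 and [a + e] to 0. *)
move=> e0; exists (fun x => step (- (3 / e) * x + 3 / e * (a + e))); split.
- move=> x; apply: (@cvg_comp _ _ _ (fun x : R => - (3 / e) * x + 3 / e * (a + e)) step); last exact: continuous_step.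
  apply: cvgD; last exact: cvg_cst.
  by apply: cvgM; [exact: cvg_cst|exact: cvg_id].
- by move=> x; exact: step01.
- move=> x xa; apply: step_ge3.
  rewrite (_ : _ + _ = 3 + 3 / e * (a - x)); last by field; rewrite gt_eqF.
  by rewrite lerDl mulr_ge0 ?subr_ge0// divr_ge0 ?ltW.
- move=> x xa; apply: step_le0.
  rewrite (_ : _ + _ = - (3 / e * (x - (a + e)))); last by ring.
  by rewrite oppr_le0 mulr_ge0 ?subr_ge0// divr_ge0 ?ltW.
- have [M hM] := step_third_order.
  by exists (`|- (3 / e)| ^+ 3 * M); exact: third_order_affine.
Qed.

End third_order.

(** * Lindeberg's replacement argument *)

Section lindeberg.
Context {R : realType}.
Local Notation leb := (@lebesgue_measure R).

(** The weight [w] lets one proof serve the sample ([P] with weight 1) and the Gaussian (Lebesgue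
    measure with the normal density). The main term depends on [V] only through its second moment,
    so it cancels between two centred variables of equal variance. *)
Lemma smooth_one_step d (T : measurableType d) (m : {measure set T -> \bar R})
    (V w : T -> R) (s2 b M : R) (f f1 f2 : R -> R) x :
  measurable_fun setT V -> measurable_fun setT w -> (forall t, 0 <= w t) ->
  mean_is m w 1 -> mean_is m (fun t => V t * w t) 0 ->
  mean_is m (fun t => V t ^+ 2 * w t) s2 -> mean_is m (fun t => `|V t| ^+ 3 * w t) b ->
  measurable_fun setT f -> (forall x, 0 <= f x <= 1) ->
  (forall x h : R, `|f (x + h) - (f x + f1 x * h + f2 x * h ^+ 2)| <= M * `|h| ^+ 3) ->
  exists2 u, mean_is m (fun t => f (x + V t) * w t) u &
    `|u - (f x + f2 x * s2)| <= M * b.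
Proof.
move=> mV mw w0 m0 m1 m2 m3 mf f01 fM.
have mfV : measurable_fun setT (fun t => f (x + V t) * w t).
  apply: measurable_funM => //; apply: (measurableT_comp mf).
  exact: measurable_funD.
have [u hu _] : exists2 u, mean_is m (fun t => f (x + V t) * w t) u & `|u| <= 1.
  apply: (mean_is_dominated mfV _ m0) => t.
  have /andP[a c] := f01 (x + V t).
  by rewrite ger0_norm ?mulr_ge0// ler_piMl.
exists u => //.
have hd : mean_is m (fun t => f (x + V t) * w t + -1 * (f x * w t + (f1 x * (V t * w t) +
    f2 x * (V t ^+ 2 * w t)))) (u + -1 * (f x * 1 + (f1 x * 0 + f2 x * s2))).
  apply: mean_isD => //; apply: mean_isZ; apply: mean_isD; first exact: mean_isZ.
  by apply: mean_isD; exact: mean_isZ.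
have -> : u - (f x + f2 x * s2) = u + -1 * (f x * 1 + (f1 x * 0 + f2 x * s2)) by ring.
have [hdi hdv] := hd.
have mh : measurable_fun setT (fun t => f (x + V t) * w t +
    -1 * (f x * w t + (f1 x * (V t * w t) + f2 x * (V t ^+ 2 * w t)))).
  by apply/measurable_EFinP; exact: measurable_int hdi.
have [|v [_ hv] hvb] := mean_is_dominated mh _ (mean_isZ M m3).
  move=> t /=.
  have -> : f (x + V t) * w t + -1 * (f x * w t + (f1 x * (V t * w t) + f2 x * (V t ^+ 2 * w t))) =
     (f (x + V t) - (f x + f1 x * V t + f2 x * V t ^+ 2)) * w t by ring.
  by rewrite normrM (ger0_norm (w0 t)) [leRHS]mulrA; exact: ler_wpM2r.
by move: hdv; rewrite hv => -[<-].
Qed.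

Lemma averages_le d (T : measurableType d) (m : {measure set T -> \bar R}) (w : T -> R)
    (A B : T -> \bar R) (e : R) :
  measurable_fun setT w -> (forall t, 0 <= w t) -> (\int[m]_t (w t)%:E = 1)%E ->
  measurable_fun setT A -> measurable_fun setT B ->
  (forall t, 0 <= A t)%E -> (forall t, 0 <= B t)%E -> 0 <= e ->
  (forall t, A t <= B t + e%:E)%E ->
  (\int[m]_t (A t * (w t)%:E) <= \int[m]_t (B t * (w t)%:E) + e%:E)%E.
Proof.
move=> mw w0 w1 mA mB A0 B0 e0 AB.
have mw' : measurable_fun setT (EFin \o w) by exact/measurable_EFinP.
have we0 t : (0 <= (w t)%:E)%E by rewrite lee_fin.
rewrite -[X in (_ + X)%E]mule1 -w1 -ge0_integralZl//.
rewrite -ge0_integralD//.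
- apply: ge0_le_integral => //.
  + by move=> t _; rewrite mule_ge0.
  + exact: emeasurable_funM.
  + apply: emeasurable_funD; first exact: emeasurable_funM.
    exact: emeasurable_funM.
  + move=> t _; rewrite -ge0_muleDl ?lee_fin//.
    exact: lee_wpmul2r.
- by move=> t _; rewrite mule_ge0.
- exact: emeasurable_funM.
- by move=> t _; rewrite mule_ge0.
- exact: emeasurable_funM.
Qed.

Variables (d : measure_display) (T : measurableType d) (P : probability T R).
Variables (Y : nat -> T -> R) (s2 b3 K3 M c : R) (f : R -> R).
Hypotheses (iidY : iid P Y) (Y1 : mean_is P (Y 0%N) 0).
Hypotheses (Y2 : mean_is P (fun t => Y 0%N t ^+ 2) s2) (Y3 : mean_is P (fun t => `|Y 0%N t| ^+ 3) b3).
Hypothesis hK3 : mean_is leb (fun y => `|y| ^+ 3 * normal_pdf 0 1 y) K3.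
Hypotheses (cf : continuous f) (f01 : forall x, 0 <= f x <= 1) (fM : third_order M f).
Hypotheses (c0 : 0 < c) (s20 : 0 < s2).

Let s := c * Num.sqrt s2.
Let s_gt0 : 0 < s. Proof. by rewrite mulr_gt0// sqrtr_gt0. Qed.

Let mf : measurable_fun setT f. Proof. exact: continuous_measurable_fun. Qed.
Let f0 x : 0 <= f x. Proof. by have /andP[] := f01 x. Qed.
Let mY i : measurable_fun setT (Y i). Proof. by case: iidY. Qed.

Let delta := M * (c ^+ 3 * b3 + s ^+ 3 * K3).

(** Both averages are expanded around the same main term, because [s ^ 2 = c ^ 2 * s2]; [delta] is
    the sum of the two cubic remainders. *)
Let one_step x : exists u v, [/\ mean_is P (fun t => f (x + c * Y 0%N t)) u,
  mean_is leb (fun y => f (x + s * y) * normal_pdf 0 1 y) v & `|u - v| <= delta].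
Proof.
have [f1 [f2 hf]] := fM.
have mcY : measurable_fun setT (fun t => c * Y 0%N t) by exact: measurable_funM.
have mw : measurable_fun setT (normal_pdf 0 1 : R -> R) by exact: measurable_normal_pdf.
have mbf : measurable_fun setT (fun y : R => s * y) by exact: measurable_funM.
have [|||u hu ub] := smooth_one_step (s2 := s ^+ 2) (b := c ^+ 3 * b3) x mcY
  (measurable_cst (1 : R)) (fun=> ler01) (mean_is_cst P 1) _ _ _ mf f01 hf.
- by apply: (eq_mean_is (f := fun t => c * Y 0%N t)) => [t|]; rewrite ?mulr1// -(mulr0 c); exact: mean_isZ.
- apply: (eq_mean_is (f := fun t => c ^+ 2 * Y 0%N t ^+ 2)) => [t|]; first by rewrite /= mulr1 exprMn.
  rewrite /s exprMn sqr_sqrtr ?ltW//; exact: mean_isZ.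
- apply: (eq_mean_is (f := fun t => c ^+ 3 * `|Y 0%N t| ^+ 3)) => [t|]; last exact: mean_isZ.
  by rewrite /= mulr1 normrM exprMn (gtr0_norm c0).
have [|||v hv vb] := smooth_one_step (m := leb) (s2 := s ^+ 2) (b := s ^+ 3 * K3) x mbf
  mw (fun y => normal_pdf_ge0 0 1 y) gauss_moment0 _ _ _ mf f01 hf.
- apply: (@eq_mean_is _ _ _ leb (fun t => s * (t * normal_pdf 0 1 t))) => [t|]; first by rewrite mulrA.
  by rewrite -[X in mean_is _ _ X](mulr0 s); apply: mean_isZ; exact: gauss_moment1.
- apply: (@eq_mean_is _ _ _ leb (fun t => s ^+ 2 * (t ^+ 2 * normal_pdf 0 1 t))) => [t|].
    by ring.
  by rewrite -[X in mean_is _ _ X]mulr1; apply: mean_isZ; exact: gauss_moment2.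
- apply: (@eq_mean_is _ _ _ leb (fun t => s ^+ 3 * (`|t| ^+ 3 * normal_pdf 0 1 t))) => [t|]; last exact: mean_isZ.
  by rewrite normrM (gtr0_norm s_gt0); ring.
exists u, v; split => //.
  by apply: (eq_mean_is _ hu) => t; rewrite /= mulr1.
have -> : u - v = (u - (f x + f2 x * s ^+ 2)) - (v - (f x + f2 x * s ^+ 2)) by ring.
by rewrite (le_trans (ler_normB _ _))// /delta mulrDr lerD.
Qed.

Let TT k x : \bar R := (\int[P]_t (f (x + c * partial_sum Y k t))%:E)%E.

Let mTT k : measurable_fun setT (TT k).
Proof.
apply: (@measurable_fun_fubini_tonelli_F _ _ _ T R P (fun p : R * T => (f (p.1 + c * partial_sum Y k p.2))%:E)).
- apply/measurable_EFinP; apply: (measurableT_comp mf); apply: measurable_funD => //.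
  apply: measurable_funM => //; apply: measurableT_comp => //.
  exact: measurable_partial_sum iidY.
- by move=> p; rewrite lee_fin.
Qed.

Let TT_ge0 k x : (0 <= TT k x)%E.
Proof. by apply: integral_ge0 => t _; rewrite lee_fin. Qed.

Let GG := fun r x => gauss_avg r f x.

Let mGG r : 0 < r -> measurable_fun setT (GG r).
Proof.
move=> r0.
apply: (@measurable_fun_fubini_tonelli_F _ _ _ _ R leb (fun p : R * R => (f p.2 * normal_pdf p.1 r p.2)%:E)).
- apply/measurable_EFinP; apply: measurable_funM; last exact: measurable_normal_pdf2.
  exact: measurableT_comp.
- by move=> p; rewrite lee_fin mulr_ge0// normal_pdf_ge0.
Qed.

Let GG_ge0 r x : (0 <= GG r x)%E.
Proof. by apply: integral_ge0 => t _; rewrite lee_fin mulr_ge0// normal_pdf_ge0. Qed.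

Let delta_ge0 : 0 <= delta.
Proof. by have [u [v [_ _ h]]] := one_step 0; exact: le_trans (normr_ge0 _) h. Qed.

Let TT1 x : (TT 1 x <= GG s x + delta%:E)%E.
Proof.
have [u [v [[_ hu] [_ hv] h]]] := one_step x.
have -> : TT 1 x = u%:E.
  by rewrite -hu; apply: eq_integral => t _; rewrite /partial_sum big_ord1.
rewrite /GG gauss_avg_std// hv -EFinD lee_fin.
by move: h; rewrite ler_norml => /andP[_ h2]; lra.
Qed.

Let TTS k x : TT k.+1 x = (\int[P]_t TT k (x + c * Y 0%N t))%E.
Proof.
rewrite /TT; under eq_integral do rewrite partial_sumS.
rewrite (@integral_partial_sumS _ _ _ _ _ k (fun a b => (f (x + c * (a + b)))%:E) iidY)//; last 2 first.
- apply/measurable_EFinP; apply: (measurableT_comp mf); apply: measurable_funD => //.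
  by apply: measurable_funM => //; apply: measurable_funD.
- by move=> a b; rewrite lee_fin.
rewrite (@fubini_tonelli _ _ T T R P P (fun p => (f (x + c * (partial_sum Y k p.1 + Y 0%N p.2)))%:E))//.
- apply: eq_integral => t _; apply: eq_integral => t' _ /=.
  by congr (f _)%:E; ring.
- apply/measurable_EFinP; apply: (measurableT_comp mf); apply: measurable_funD => //.
  apply: measurable_funM => //; apply: measurable_funD; apply: measurableT_comp => //.
  exact: measurable_partial_sum iidY.
- by move=> p; rewrite lee_fin.
Qed.

(** Translation and smoothing commute: shifting the centre of the Gaussian by [c * Y 0] amounts to
    shifting the argument of [f], and Tonelli then exchanges the two averages. *)
Let mid r x : 0 < r ->
  (\int[P]_t GG r (x + c * Y 0%N t) = \int[leb]_u (TT 1 u * (normal_pdf x r u)%:E))%E.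
Proof.
move=> r0.
have cfh (h : R) : continuous (fun u => f (u + h)).
  move=> u; apply: (@continuous_comp _ _ _ (fun u => u + h) f); last exact: cf.
  by apply: cvgD; [exact: cvg_id|exact: cvg_cst].
transitivity (\int[P]_t \int[leb]_u (f (u + c * Y 0%N t) * normal_pdf x r u)%:E)%E.
  apply: eq_integral => t _.
  have /= := @gauss_avg_std _ r (fun u => f (u + c * Y 0%N t)) x r0 (cfh _) (fun=> f0 _).
  rewrite /gauss_avg => ->; rewrite /GG gauss_avg_std//.
  by apply: eq_integral => y _; congr ((f _ * _)%:E); ring.
rewrite (@fubini_tonelli _ _ T _ R P leb (fun p => (f (p.2 + c * Y 0%N p.1) * normal_pdf x r p.2)%:E))/=.
- apply: eq_integral => u _; rewrite -ge0_integralZr//.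
  + by apply: eq_integral => t _; rewrite /partial_sum big_ord1.
  + apply/measurable_EFinP; apply: (measurableT_comp mf); apply: measurable_funD => //.
    by apply: measurable_funM => //; exact: measurable_partial_sum iidY.
  + by move=> t _; rewrite lee_fin.
  + by rewrite lee_fin normal_pdf_ge0.
- apply/measurable_EFinP; apply: measurable_funM.
    apply: (measurableT_comp mf); apply: measurable_funD => //.
    by apply: measurable_funM => //; exact: measurableT_comp.
  by apply: measurableT_comp => //; exact: measurable_normal_pdf.
- by move=> p; rewrite lee_fin mulr_ge0// normal_pdf_ge0.
Qed.

(** One exchange per induction step: the last [k + 1] summands are replaced inside the average over
    the first, [mid] moves that average inside, [TT1] replaces the remaining summand, and
    [gauss_avg_avg] merges the two Gaussians. Each replacement costs [delta]. *)
Let TT_close k x :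
  (TT k.+1 x <= GG (Num.sqrt k.+1%:R * s) x + (k.+1%:R * delta)%:E)%E.
Proof.
elim: k x => [|k IH] x /=; first by rewrite sqrtr1 !mul1r; exact: TT1.
set r := Num.sqrt k.+1%:R * s.
have r0 : 0 < r by rewrite mulr_gt0// sqrtr_gt0.
have rS : Num.sqrt (r ^+ 2 + s ^+ 2) = Num.sqrt k.+2%:R * s.
  rewrite /r exprMn sqr_sqrtr// -{2}[s ^+ 2]mul1r -mulrDl natr1 sqrtrM//.
  by rewrite sqrtr_sqr gtr0_norm.
have GS : GG (Num.sqrt k.+2%:R * s) x = (\int[leb]_v (GG s v * (normal_pdf x r v)%:E))%E.
  by rewrite -rS /GG gauss_avg_avg.
have e0 : 0 <= k.+1%:R * delta by rewrite mulr_ge0.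
have mxY : measurable_fun setT (fun t => x + c * Y 0%N t).
  by apply: measurable_funD => //; exact: measurable_funM.
have P1 : (\int[P]_t (cst (1 : R) t)%:E = 1)%E by have [] := mean_is_cst P 1.
have i1 := integral_normal_pdf x r.
have mw : measurable_fun setT (normal_pdf x r) by exact: measurable_normal_pdf.
have eE : ((k.+2%:R * delta)%:E = (k.+1%:R * delta)%:E + delta%:E)%E.
  by rewrite -EFinD -[k.+2%:R]natr1; congr EFin; ring.
rewrite TTS eE GS.
have avP (A : T -> \bar R) : (\int[P]_t (A t * (cst (1 : R) t)%:E) = \int[P]_t A t)%E.
  by apply: eq_integral => t _; rewrite mule1.
apply: (@le_trans _ _ (\int[P]_t GG r (x + c * Y 0%N t) + (k.+1%:R * delta)%:E)%E).
  rewrite -avP -[X in (_ <= X + _)%E]avP.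
  apply: averages_le => //.
  - exact: (measurableT_comp (mTT _)).
  - exact: (measurableT_comp (mGG r0)).
rewrite [leRHS]addeCA [leLHS]addeC leeD2l// mid//.
by apply: averages_le; [exact: mw|exact: normal_pdf_ge0|exact: i1|exact: mTT|exact: (mGG s_gt0)|
  exact: TT_ge0|exact: GG_ge0|exact: delta_ge0|exact: TT1].
Qed.

(** The normalisation makes the final Gaussian standard. An upper bound is enough, since the lower
    half of the limit theorem is obtained from the reflected variables [- Y]. *)
Lemma lindeberg_bound n : (0 < n)%N -> c * Num.sqrt s2 * Num.sqrt n%:R = 1 ->
  (\int[P]_t (f (c * partial_sum Y n t))%:E <= \int[leb]_y (f y * normal_pdf 0 1 y)%:E +
   (n%:R * (M * (c ^+ 3 * b3 + s ^+ 3 * K3)))%:E)%E.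
Proof.
case: n => // k _ h; have := TT_close k 0; rewrite mulrC in h; rewrite h /GG /gauss_avg /TT.
by under eq_integral do rewrite add0r.
Qed.

End lindeberg.

(** * The central limit theorem *)

Section central_limit.
Context {R : realType}.
Local Notation leb := (@lebesgue_measure R).

Lemma Phi_fin (x : R) : normal_prob 0 1 `]-oo, x] = (Phi x)%:E.
Proof. by rewrite /Phi fineK// fin_num_measure. Qed.

Lemma integral_le_Phi (f : R -> R) (a : R) : measurable_fun setT f ->
  (forall y, 0 <= f y <= 1) -> (forall y, a <= y -> f y = 0) ->
  (\int[leb]_y (f y * normal_pdf 0 1 y)%:E <= (Phi a)%:E)%E.
Proof.
move=> mf f01 f0; rewrite -Phi_fin /normal_prob.
have mg : measurable_fun setT (fun y : R => (normal_pdf 0 1 y)%:E).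
  by apply/measurable_EFinP; exact: measurable_normal_pdf.
rewrite integral_mkcond [leRHS]integral_mkcond.
apply: ge0_le_integral => //=.
- move=> y _; rewrite patchE; case: ifP => // _; rewrite lee_fin mulr_ge0 ?normal_pdf_ge0//.
  by have /andP[] := f01 y.
- rewrite patch_setT; apply/measurable_EFinP; apply: measurable_funM => //.
  exact: measurable_normal_pdf.
- by apply/(measurable_restrictT _ _).1 => //; exact: measurable_funTS.
- move=> y _; rewrite patch_setT patchE; have /andP[fy0 fy1] := f01 y.
  case: ifPn => [_|]; first by rewrite lee_fin ler_piMl// normal_pdf_ge0.
  by rewrite mem_setE in_itv/= -ltNge => ya; rewrite f0 ?mul0r// ltW.
Qed.

Lemma Phi_lipschitz (a e : R) : 0 <= e -> Phi a <= Phi (a + e) <= Phi a + e * normal_peak 1.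
Proof.
move=> e0.
have disj : [disjoint `]-oo, a] & `]a, a + e]]%classic.
  rewrite disj_set2E; apply/eqP; rewrite -subset0 => y []/=.
  by rewrite !in_itv/= => ya /andP[]; rewrite ltNge ya.
have U : `]-oo, a + e]%classic = `]-oo, a] `|` `]a, a + e] :> set R.
  apply/seteqP; split => y /=; rewrite !in_itv/=.
    by move=> ye; case: (leP y a) => ya; [left|right].
  by case => [ya|/andP[]//]; rewrite (le_trans ya)// lerDl.
have E : ((Phi (a + e))%:E = (Phi a)%:E + normal_prob 0 1 `]a, (a + e)%R])%E.
  by rewrite -!Phi_fin U measureU//; exact/disj_set2P.
have B : (normal_prob 0 1 `]a, (a + e)%R] <= (e * normal_peak 1)%:E)%E.
  rewrite /normal_prob.
  apply: (@le_trans _ _ (\int[leb]_(x in `]a, (a + e)%R]) (normal_peak 1)%:E))%E.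
    apply: ge0_le_integral => //=.
    - by move=> y _; rewrite lee_fin normal_pdf_ge0.
    - by apply: measurable_funTS; apply/measurable_EFinP; exact: measurable_normal_pdf.
    - by move=> y _; rewrite lee_fin normal_pdf_ub// oner_neq0.
  rewrite integral_cst//= lebesgue_measure_itv/= lte_fin ltrDl.
  case: ifPn => [_|]; last by rewrite mule0 lee_fin mulr_ge0// normal_peak_ge0.
  by rewrite -EFinB -EFinM lee_fin addrAC subrr add0r mulrC.
apply/andP; split; rewrite -lee_fin E; first by rewrite leeDl.
by rewrite EFinD leeD2l.
Qed.

Lemma Phi_sym (a : R) : Phi (- a) = 1 - Phi a.
Proof.
apply/eqP; rewrite -eqe EFinB -!Phi_fin.
have -> : normal_prob 0 1 `]-oo, (- a)] = normal_prob 0 1 (~` `]-oo, a]).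
  rewrite /normal_prob.
  rewrite setCitvl.
  have mg : measurable_fun setT (fun y : R => (normal_pdf 0 1 y)%:E).
    by apply/measurable_EFinP; exact: measurable_normal_pdf.
  rewrite integral_itv_obnd_cbnd; last exact: measurable_funTS.
  rewrite integral_mkcond [RHS]integral_mkcond -[RHS]integralT_sym; last 2 first.
  - by apply/(measurable_restrictT _ _).1 => //; exact: measurable_funTS.
  - by move=> y; rewrite patchE; case: ifP => // _; rewrite lee_fin normal_pdf_ge0.
  apply: eq_integral => y _; rewrite !patchE !mem_setE !in_itv/= andbT normal_pdf_even.
  by rewrite lerNr.
by rewrite probability_setC.
Qed.

Lemma Phi0 : Phi 0 = 2^-1 :> R.
Proof. by have := Phi_sym 0; rewrite oppr0; lra. Qed.

Variables (d : measure_display) (T : measurableType d) (P : probability T R).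
Variables (Y : nat -> T -> R) (s2 b3 : R).
Hypotheses (iidY : iid P Y) (Y1 : mean_is P (Y 0%N) 0).
Hypotheses (Y2 : mean_is P (fun t => Y 0%N t ^+ 2) s2) (Y3 : mean_is P (fun t => `|Y 0%N t| ^+ 3) b3).
Hypotheses (s20 : 0 < s2).

Let scaled n t := partial_sum Y n t / (Num.sqrt s2 * Num.sqrt n%:R).

Let error M K3 n : R := M * (b3 / Num.sqrt s2 ^+ 3 + K3) / Num.sqrt n%:R.

Let error_bound (f : R -> R) M K3 n : (0 < n)%N -> continuous f -> (forall x : R, 0 <= f x <= 1) ->
  third_order M f -> mean_is leb (fun y => `|y| ^+ 3 * normal_pdf 0 1 y) K3 ->
  (\int[P]_t (f (scaled n t))%:E <= \int[leb]_y (f y * normal_pdf 0 1 y)%:E + (error M K3 n)%:E)%E.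
Proof.
move=> n0 cf f01 fM hK3.
set c := (Num.sqrt s2 * Num.sqrt n%:R)^-1.
have q0 : 0 < Num.sqrt s2 by rewrite sqrtr_gt0.
have r0 : 0 < Num.sqrt (n%:R : R) by rewrite sqrtr_gt0 ltr0n.
have c0 : 0 < c by rewrite invr_gt0 mulr_gt0.
have := lindeberg_bound iidY Y1 Y2 Y3 hK3 cf f01 fM c0 s20 n0.
have -> : c * Num.sqrt s2 * Num.sqrt n%:R = 1 by rewrite /c; field; rewrite !gt_eqF.
move=> /(_ erefl).
have -> : n%:R * (M * (c ^+ 3 * b3 + (c * Num.sqrt s2) ^+ 3 * K3)) = error M K3 n.
  rewrite -[n%:R]sqr_sqrtr ?ler0n// /error /c; field.
  by rewrite !gt_eqF.
by rewrite /scaled; under eq_integral do rewrite mulrC.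
Qed.

Let cvg_error M K3 : error M K3 n @[n --> \oo] --> 0.
Proof.
rewrite /error -[X in _ --> X](mulr0 (M * (b3 / Num.sqrt s2 ^+ 3 + K3))).
apply: cvgM; first exact: cvg_cst.
apply/cvgrPdist_lt => e e0; near=> n.
have n0 : (0 : R) < n%:R by rewrite ltr0n; near: n; exact: nbhs_infty_gt.
have r0 : 0 < Num.sqrt (n%:R : R) by rewrite sqrtr_gt0.
rewrite sub0r normrN gtr0_norm ?invr_gt0// invf_plt ?posrE//.
have e1 : 0 <= e^-1 by rewrite invr_ge0 ltW.
rewrite -(ger0_norm e1) -sqrtr_sqr ltr_sqrt//.
by near: n; exact: nbhs_infty_gtr.
Unshelve. all: by end_near. Qed.

Let mscaled n : measurable_fun setT (scaled n).
Proof. by apply: measurable_funM => //; exact: measurable_partial_sum iidY. Qed.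

Let error_small M K3 e : 0 < e -> \forall n \near \oo, error M K3 n <= e.
Proof.
move=> e0; have /cvgrPdist_le/(_ _ e0) := @cvg_error M K3; apply: filterS => n.
by rewrite sub0r normrN; exact: le_trans (ler_norm _).
Qed.

Let integral_indicT (A : set T) : measurable A -> (\int[P]_t (\1_A t)%:E = P A)%E.
Proof. by move=> mA; rewrite integral_indic// setIT. Qed.

Lemma clt_upper (a e : R) : 0 < e -> \forall n \near \oo,
  (P [set t | (scaled n t <= a)%R] <= (Phi a + e)%:E)%E.
Proof.
move=> e0; have [K3 hK3] := @gauss_moment3 R.
have p0 : (0 : R) < normal_peak 1 by rewrite normal_peak_gt0// oner_neq0.
(* The smooth step falls from 1 to 0 over a width [r], and by the Lipschitz bound on [Phi] this
   width costs exactly [e / 2]. *)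
set r := e / 2 / normal_peak 1.
have r0 : 0 < r by rewrite !divr_gt0.
have [f [cf f01 f1 f0 [M fM]]] := smooth_step a r0.
have mf : measurable_fun setT f by exact: continuous_measurable_fun.
have fge0 x : 0 <= f x by have /andP[] := f01 x.
near=> n.
have n0 : (0 < n)%N by near: n; exact: nbhs_infty_gt.
have h := error_bound n0 cf f01 fM hK3.
have he : error M K3 n <= e / 2 by near: n; apply: error_small; rewrite divr_gt0.
have mA : measurable [set t | scaled n t <= a].
  exact: measurable_le.
apply: (@le_trans _ _ (\int[P]_t (f (scaled n t))%:E)%E).
  rewrite -[P _]integral_indicT//; apply: ge0_le_integral => //.
  - by apply/measurable_EFinP; exact: measurable_indic.
  - by apply/measurable_EFinP; exact: measurableT_comp.
  - move=> t _; rewrite lee_fin indicE; case: (boolP (t \in _)) => //= /set_mem/= ta.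
    by rewrite f1.
apply: (le_trans h); rewrite (_ : Phi a + e = Phi a + r * normal_peak 1 + e / 2); last first.
  by rewrite /r; field; rewrite gt_eqF.
rewrite [leRHS]EFinD; apply: leeD; last by rewrite lee_fin.
apply: (@le_trans _ _ (Phi (a + r))%:E); first exact: integral_le_Phi.
by rewrite lee_fin; have /andP[] := Phi_lipschitz a (ltW r0).
Unshelve. all: by end_near. Qed.

End central_limit.

(** The upper bound applied to [- Y] at [- a], followed by complementation, which is why the event
    here is strict. *)
Lemma clt_lower d (T : measurableType d) (R : realType) (P : probability T R)
    (Y : nat -> T -> R) (s2 b3 : R) : iid P Y -> mean_is P (Y 0%N) 0 ->
  mean_is P (fun t => Y 0%N t ^+ 2) s2 -> mean_is P (fun t => `|Y 0%N t| ^+ 3) b3 -> 0 < s2 ->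
  forall a e : R, 0 < e -> \forall n \near \oo,
  ((Phi a - e)%:E <= P [set t | (partial_sum Y n t / (Num.sqrt s2 * Num.sqrt n%:R) < a)%R])%E.
Proof.
move=> iidY Y1 Y2 Y3 s20 a e e0; pose Y' i := -%R \o Y i.
have Y'1 : mean_is P (Y' 0%N) 0.
  have := mean_isZ (-1) Y1; rewrite mulr0; apply: eq_mean_is => t.
  by rewrite mulN1r.
have Y'2 : mean_is P (fun t => Y' 0%N t ^+ 2) s2.
  by apply: (eq_mean_is _ Y2) => t; rewrite sqrrN.
have Y'3 : mean_is P (fun t => `|Y' 0%N t| ^+ 3) b3.
  by apply: (eq_mean_is _ Y3) => t; rewrite normrN.
have := clt_upper (iid_comp (measurable_funN (@measurable_id _ _ setT)) iidY) Y'1 Y'2 Y'3 s20 (- a) e0.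
apply: filterS => n up.
have mS : measurable_fun setT (fun t => partial_sum Y n t / (Num.sqrt s2 * Num.sqrt n%:R)).
  by apply: measurable_funM => //; exact: measurable_partial_sum iidY.
pose A := [set t | partial_sum Y' n t / (Num.sqrt s2 * Num.sqrt n%:R) <= - a].
have AE t : A t <-> a <= partial_sum Y n t / (Num.sqrt s2 * Num.sqrt n%:R).
  by rewrite /A /= /partial_sum sumrN mulNr lerN2.
have mA : measurable A.
  have -> : A = [set t | a <= partial_sum Y n t / (Num.sqrt s2 * Num.sqrt n%:R)].
    by apply/seteqP; split => t /AE.
  exact: measurable_le.
rewrite (_ : [set t | _] = ~` A); last first.
  apply/seteqP; split => t /= h; first by move=> /AE; rewrite leNgt h.
  by rewrite ltNge; apply/negP => /AE.
rewrite probability_setC// leeBrDr ?fin_num_measure//.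
apply: le_trans (leeD2l _ up) _; rewrite -EFinD lee_fin Phi_sym; lra.
Qed.

(** * A strong law of large numbers *)

Section slln.
Context {R : realType}.

Lemma exists_sqrtn n : exists k, (k ^ 2 <= n < k.+1 ^ 2)%N.
Proof.
elim: n => [|n [k /andP[kn nk]]]; first by exists 0%N.
have [nk'|nk'] := ltnP n.+1 (k.+1 ^ 2)%N; first by exists k; rewrite nk' andbT; exact: leqW.
exists k.+1; rewrite nk' /=; apply: (leq_ltn_trans nk).
by rewrite ltn_exp2r.
Qed.

(* Interpolation between consecutive squares, whose ratio tends to 1. *)
Lemma cvg_mean_squares (S : nat -> R) (m : R) : 0 <= m ->
  (forall i j, (i <= j)%N -> S i <= S j) ->
  S (k ^ 2)%N / (k ^ 2)%:R @[k --> \oo] --> m ->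
  S n / n%:R @[n --> \oo] --> m.
Proof.
move=> m0 ndS /cvgrPdist_le cS; apply/cvgrPdist_le => e e0.
(* For [k^2 <= n < (k+1)^2] with [k >= 1], the error at the squares costs at most
   [(e / 8) (k+1)^2 <= e k^2 / 2], and the gap costs [m (2 k + 1) <= 3 m k], again at most
   [e k^2 / 2] once [k >= 6 m / e]. *)
have h0 : 0 < e / 8 by rewrite divr_gt0.
have [K _ hK] := cS _ h0.
have [K' hK'] : exists K' : nat, 6 * m / e <= K'%:R.
  by exists (Num.truncn (6 * m / e)).+1; apply: ltW; exact: truncnS_gt.
exists ((maxn K (maxn K' 1)).+1 ^ 2)%N => // n /= Kn.
have [k /andP[kn nk]] := exists_sqrtn n.
have kK : (maxn K (maxn K' 1) <= k)%N.
  have := leq_ltn_trans Kn nk; rewrite ltn_exp2r// ltnS => h; exact: ltnW.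
move: kK; rewrite !geq_max => /and3P[k1 k2 k3].
have bnd (i : nat) : (K <= i)%N -> (0 < i)%N ->
    `|S (i ^ 2)%N - m * i%:R ^+ 2| <= e / 8 * i%:R ^+ 2.
  move=> Ki i0; have := hK i Ki.
  have q0 : (0 : R) < i%:R ^+ 2 by rewrite exprn_gt0// ltr0n.
  rewrite natrX => h.
  have -> : S (i ^ 2)%N - m * i%:R ^+ 2 = - (m - S (i ^ 2)%N / i%:R ^+ 2) * i%:R ^+ 2.
    by field; rewrite gt_eqF// ltr0n.
  by rewrite normrM normrN (gtr0_norm q0) ler_wpM2r// ltW.
have := bnd k.+1 (leqW k1) isT; have := bnd k k1 k3.
have x1 : (1 : R) <= k%:R by rewrite ler1n.
have aS : S (k ^ 2)%N <= S n by exact: ndS.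
have Sb : S n <= S (k.+1 ^ 2)%N by apply: ndS; exact: ltnW.
have Nx : (k%:R : R) ^+ 2 <= n%:R by rewrite -natrX ler_nat.
have Ny : n%:R <= (k%:R + 1 : R) ^+ 2 by rewrite natr1 -natrX ler_nat ltnW.
have mk : 6 * m <= e * k%:R.
  have : 6 * m / e <= k%:R by rewrite (le_trans hK')// ler_nat.
  by rewrite ler_pdivrMr// [_ * e]mulrC.
have N0 : (0 : R) < n%:R by apply: lt_le_trans Nx; rewrite exprn_gt0// ltr0n.
rewrite -[k.+1%:R]natr1; move: (k%:R : R) (n%:R : R) (S n) (S (k ^ 2)%N) (S (k.+1 ^ 2)%N)
  x1 aS Sb Nx Ny mk N0 => x N s a b x1 aS Sb Nx Ny mk N0.
rewrite !ler_norml => /andP[a1 a2] /andP[b1 b2].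
have -> : m - s / N = (m * N - s) / N by field; rewrite gt_eqF.
rewrite ler_pdivlMr// ler_pdivrMr//.
have x0 : 0 <= x by lra.
have e0' := ltW e0.
have h1 : 6 * m * x <= e * x ^+ 2 by rewrite expr2 mulrA ler_wpM2r.
have h2 : m <= m * x by rewrite ler_peMr.
have h3 : m * N <= m * (x + 1) ^+ 2 by rewrite ler_wpM2l.
have h4 : m * x ^+ 2 <= m * N by rewrite ler_wpM2l.
have h5 : e * (x + 1) ^+ 2 <= e * (4 * x ^+ 2) by rewrite ler_wpM2l//; nra.
have h6 : e * x ^+ 2 <= e * N by rewrite ler_wpM2l.
by apply/andP; split; lra.
Qed.

(** Induction on the stronger bound [2 - 1 / n], from [1 / (x + 1)^2 <= 1 / x - 1 / (x + 1)]. *)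
Lemma series_inv_sqr n : \sum_(0 <= k < n) ((k.+1%:R : R) ^+ 2)^-1 <= 2.
Proof.
suff : \sum_(0 <= k < n.+1) ((k.+1%:R : R) ^+ 2)^-1 <= 2 - n.+1%:R^-1.
  rewrite big_nat_recr//= => h.
  apply: (@le_trans _ _ (2 - n.+1%:R^-1)); last by rewrite lerBlDr lerDl invr_ge0.
  by apply: le_trans h; rewrite lerDl invr_ge0 sqr_ge0.
elim: n => [|n IH]; first by rewrite big_nat1 expr1n invr1; lra.
rewrite big_nat_recr//= (le_trans (lerD IH (lexx _)))//.
rewrite -[n.+2%:R]natr1.
have : (0 : R) < n.+1%:R by rewrite ltr0n.
move: (n.+1%:R : R) => x x0.
rewrite -subr_ge0 [leRHS](_ : _ = (x * (x + 1) ^+ 2)^-1).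
  by rewrite invr_ge0 mulr_ge0 ?sqr_ge0// ltW.
by field; rewrite !gt_eqF//; lra.
Qed.

(** Along squares the averages have variance [v / k^2], which is summable. The series of squared
    deviations thus has finite mean, so it converges almost surely and its terms tend to 0. *)
Lemma slln_squares d (T : measurableType d) (P : probability T R) (Y : nat -> T -> R) (m v : R) :
  iid P Y -> mean_is P (Y 0%N) m -> mean_is P (fun t => (Y 0%N t - m) ^+ 2) v ->
  {ae P, forall t, partial_sum Y (k ^ 2)%N t / (k ^ 2)%:R @[k --> \oo] --> m}.
Proof.
move=> iidY Ym Yv.
have mS n : measurable_fun setT (partial_sum Y n) by exact: measurable_partial_sum iidY.
pose Y' i := (fun y => y - m) \o Y i.
have iidY' : iid P Y' by apply: iid_comp => //; exact: measurable_funB.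
have Y'm : mean_is P (Y' 0%N) 0.
  by rewrite -(subrr m); apply: mean_isD => //; exact: mean_is_cst.
have S'E n t : partial_sum Y' n t = partial_sum Y n t - n%:R * m.
  by rewrite /partial_sum /Y' sumrB sumr_const card_ord mulr_natl.
pose A k t := ((partial_sum Y (k.+1 ^ 2)%N t / (k.+1 ^ 2)%:R - m) ^+ 2)%:E.
have mA k : measurable_fun setT (A k).
  apply/measurable_EFinP; apply: measurable_funX; apply: measurable_funB => //.
  exact: measurable_funM.
have A0 k t : (0 <= A k t)%E by rewrite lee_fin sqr_ge0.
have v0 : 0 <= v.
  by rewrite -lee_fin; case: Yv => _ <-; apply: integral_ge0 => t _; rewrite lee_fin sqr_ge0.
have intA k : (\int[P]_t A k t = (v / k.+1%:R ^+ 2)%:E)%E.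
  have [_ h] := second_moment iidY' Y'm (k.+1 ^ 2)%N Yv.
  have q0 : (0 : R) < k.+1%:R ^+ 2 by rewrite exprn_gt0.
  have -> : (v / k.+1%:R ^+ 2)%:E = ((((k.+1 ^ 2)%:R ^+ 2)^-1)%:E * ((k.+1 ^ 2)%:R * v)%:E :> \bar R)%E.
    by rewrite -EFinM natrX; congr EFin; field; rewrite gt_eqF.
  rewrite -h -ge0_integralZl ?lee_fin ?invr_ge0 ?sqr_ge0//.
  - apply: eq_integral => t _; rewrite /A -EFinM S'E natrX; congr EFin.
    by field; rewrite gt_eqF.
  - apply/measurable_EFinP; apply: measurable_funX; exact: measurable_partial_sum iidY'.
  - by move=> t _; rewrite lee_fin sqr_ge0.
have intS : P.-integrable setT (fun t => \sum_(0 <= k <oo) A k t)%E.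
  apply/integrableP; split; first exact: ge0_emeasurable_sum.
  under eq_integral do rewrite gee0_abs ?nneseries_ge0//.
  rewrite integral_nneseries//; apply: (@le_lt_trans _ _ (v * 2)%:E); last exact: ltry.
  apply: lime_le; first (apply: is_cvg_nneseries => k _ _; exact: integral_ge0).
  apply: nearW => n.
  under eq_bigr do rewrite intA.
  rewrite sumEFin lee_fin -mulr_sumr ler_wpM2l//; exact: series_inv_sqr.
have := integrable_ae measurableT intS.
apply: filterS => t /(_ I) fS.
have {}fS : (\sum_(0 <= k <oo) A k t < +oo)%E by rewrite -ge0_fin_numE// nneseries_ge0.
have cA : A k t @[k --> \oo] --> 0%E.
  apply: (@squeeze_cvge _ _ _ _ (cst 0%E) _ (fun k => \sum_(k <= i <oo) A i t)%E).
  - apply: nearW => k; rewrite A0/= (nneseries_split _ 1)//.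
    by rewrite addn1 big_nat1 leeDl// nneseries_ge0.
  - exact: cvg_cst.
  - exact: nneseries_tail_cvg.
rewrite -(cvg_shiftS (fun k => partial_sum Y (k ^ 2)%N t / (k ^ 2)%:R)).
apply/cvgrPdist_lt => e e0.
have e20 : 0 < e ^+ 2 by rewrite exprn_gt0.
have /fine_cvgP[_ /cvgrPdist_lt/(_ _ e20)] := cA.
apply: filterS => k /=; rewrite sub0r normrN normrX ltr_pXn2r ?nnegrE ?(ltW e0)//.
by rewrite distrC.
Qed.

(** Nonnegative summands make the partial sums monotone, as the interpolation between squares
    requires. *)
Theorem slln_ge0 d (T : measurableType d) (P : probability T R) (Y : nat -> T -> R) (m v : R) :
  iid P Y -> (forall i t, 0 <= Y i t) -> mean_is P (Y 0%N) m ->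
  mean_is P (fun t => (Y 0%N t - m) ^+ 2) v ->
  {ae P, forall t, partial_sum Y n t / n%:R @[n --> \oo] --> m}.
Proof.
move=> iidY Y0 Ym Yv; have := slln_squares iidY Ym Yv.
apply: filterS => t h; apply: cvg_mean_squares h.
  by rewrite -lee_fin; case: Ym => _ <-; apply: integral_ge0 => w _; rewrite lee_fin.
move=> i j ij; rewrite /partial_sum -!(big_mkord xpredT (fun i => Y i t)).
by rewrite [leRHS](@big_cat_nat _ _ _ i)//= lerDl sumr_ge0.
Qed.

End slln.

(** * Stopping at the first decision *)

Lemma first_index_Some (a l : int) (p : int -> bool) : first_index a p = Some l <->
  [/\ a <= l, p l & forall k, a <= k -> k < l -> ~~ p k].
Proof.
rewrite /first_index; case: pselect => [h|nh]; split.
- case: ex_minnP => m pm mmin [<-]; split => //; first by rewrite lerDl.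
  move=> k ak; rewrite -{1}(subrKC a k) ltrD2l => km; apply/negP => pk.
  have kE : k = a + (`|k - a|%N)%:Z by rewrite gez0_abs ?subr_ge0// subrKC.
  have := mmin `|k - a|%N; rewrite -kE => /(_ pk).
  by rewrite -lez_nat gez0_abs ?subr_ge0// leNgt km.
- move=> [al pl lmin]; case: ex_minnP => m pm mmin; congr Some.
  have lE : l = a + (`|l - a|%N)%:Z by rewrite gez0_abs ?subr_ge0// subrKC.
  apply/eqP; rewrite eq_le; apply/andP; split.
    by rewrite [leRHS]lE lerD2l lez_nat; apply: mmin; rewrite -lE.
  by rewrite leNgt; apply/negP => ml; have := lmin _ _ ml; rewrite pm lerDl => /(_ isT).
- by [].
- move=> [al pl _]; exfalso; apply: nh; exists `|l - a|%N.
  by rewrite gez0_abs ?subr_ge0// subrKC.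
Qed.

Lemma first_index_None (a : int) (p : int -> bool) : first_index a p = None <->
  forall k, a <= k -> ~~ p k.
Proof.
rewrite /first_index; case: pselect => [h|nh]; split => //.
- case: ex_minnP => m pm _ h'; have := h' (a + m%:Z).
  by rewrite pm lerDl => /(_ isT).
- move=> _ k ak; apply/negP => pk; apply: nh; exists `|k - a|%N.
  by rewrite gez0_abs ?subr_ge0// subrKC.
Qed.

(** * Series over integer stages *)

Section sum_from.
Context {R : realType}.
Implicit Types (f g : int -> \bar R).

Lemma sum_from_ge0 a f : (forall l, a <= l -> (0 <= f l)%E) -> (0 <= sum_from a f)%E.
Proof. by move=> f0; apply: nneseries_ge0 => k _ _; apply: f0; rewrite lerDl. Qed.

Lemma le_sum_from a f g : (forall l, a <= l -> (0 <= f l)%E) ->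
  (forall l, a <= l -> (f l <= g l)%E) -> (sum_from a f <= sum_from a g)%E.
Proof.
move=> f0 fg; apply: lee_nneseries => [k _ _|k _]; first by apply: f0; rewrite lerDl.
by apply: fg; rewrite lerDl.
Qed.

Lemma sum_fromD a f g : (forall l, a <= l -> (0 <= f l)%E) -> (forall l, a <= l -> (0 <= g l)%E) ->
  sum_from a (fun l => f l + g l)%E = (sum_from a f + sum_from a g)%E.
Proof.
move=> f0 g0; apply: nneseriesD => k _ _; first by apply: f0; rewrite lerDl.
by apply: g0; rewrite lerDl.
Qed.

Lemma sum_from_split a (m : nat) f : (forall l, a <= l -> (0 <= f l)%E) ->
  sum_from a f = (\sum_(0 <= k < m) f (a + k%:Z)%R + sum_from (a + m%:Z)%R f)%E.
Proof.
move=> f0; have f0' k : (0 <= f (a + k%:Z)%R)%E by apply: f0; rewrite lerDl.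
rewrite /sum_from (nneseries_split _ m)// add0n; congr (_ + _)%E.
rewrite -(nneseries_addn m)//; apply: eq_eseriesr => k _.
by rewrite PoszD addrA addrAC.
Qed.

Lemma le_term_sum_from a l f : (forall l, a <= l -> (0 <= f l)%E) -> a <= l ->
  (f l <= sum_from a f)%E.
Proof.
move=> f0 al; have lE : l = a + (`|l - a|%N)%:Z by rewrite gez0_abs ?subr_ge0// subrKC.
rewrite (@sum_from_split _ `|l - a|.+1)// big_nat_recr//= -lE -addeA.
rewrite addeCA leeDl// adde_ge0//.
  by apply: sume_ge0 => k _; apply: f0; rewrite lerDl.
apply: sum_from_ge0 => k; rewrite -addn1 PoszD addrA -lE => lk.
by apply: f0; rewrite (le_trans al)// (le_trans _ lk)// lerDl.
Qed.

End sum_from.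

Lemma le_measureU d (T : measurableType d) (R : realType) (P : probability T R) (A B C : set T) :
  measurable A -> measurable B -> measurable C -> A `<=` B `|` C -> (P A <= P B + P C)%E.
Proof.
move=> mA mB mC ABC; apply: le_trans (measureU2 _ mB mC).
by apply: le_measure; rewrite ?inE//; exact: measurableU.
Qed.

Section stopping.
Context d (T : measurableType d) (R : realType) (P : probability T R).
Variables (a : int) (p : int -> T -> bool).
Hypothesis mp : forall l, measurable [set w | p l w].

(** No decision at any stage up to [l], that is, a stopping index above [l]. This differs from being
    undecided at the single stage [l], and claims (V) and (VII) compare the two. *)
Definition run l := [set w | forall k, a <= k -> k <= l -> ~~ p k w].
Definition stopat l := [set w | first_index a (p ^~ w) = Some l].

Let mNp l : measurable [set w | ~~ p l w].
Proof.
rewrite (_ : [set w | _] = ~` [set w | p l w]); first exact: measurableC.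
by apply/seteqP; split => w /= /negP.
Qed.

Lemma measurable_run l : measurable (run l).
Proof.
rewrite (_ : run l = \bigcap_(k : nat) [set w | a + k%:Z <= l -> ~~ p (a + k%:Z) w]).
  apply: bigcapT_measurable => k; case: (boolP (a + k%:Z <= l)) => h.
    rewrite (_ : [set w | _] = [set w | ~~ p (a + k%:Z) w]) //.
    by apply/seteqP; split => w /=; [exact|].
  by rewrite (_ : [set w | _] = setT) //; apply/seteqP; split => w.
apply/seteqP; split => [w rw k _ /= kl|w rw k ak kl].
  by apply: rw => //; rewrite lerDl.
have kE : k = a + (`|k - a|%N)%:Z by rewrite gez0_abs ?subr_ge0// subrKC.
by rewrite kE; apply: (rw `|k - a|%N I); rewrite -kE.
Qed.

Lemma run_lt l : l < a -> run l = setT.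
Proof.
move=> la; apply/seteqP; split => // w _ k ak kl.
by have := le_lt_trans (le_trans ak kl) la; rewrite ltxx.
Qed.

Lemma stopatE l : a <= l -> stopat l = run (l - 1) `&` [set w | p l w].
Proof.
move=> al; apply/seteqP; split => [w /first_index_Some[_ pl h]|w [rw pl]].
  by split => // k ak; rewrite lerBrDr -ltzD1 ltrD2r => kl; exact: h.
apply/first_index_Some; split => // k ak kl; apply: rw => //.
by rewrite lerBrDr lezD1.
Qed.

Lemma stopat_lt l : l < a -> stopat l = set0.
Proof.
move=> la; apply/seteqP; split => // w /first_index_Some[al _ _].
by have := le_lt_trans al la; rewrite ltxx.
Qed.

Lemma measurable_stopat l : measurable (stopat l).
Proof.
have [la|al] := ltP l a; first by rewrite stopat_lt.
by rewrite stopatE//; apply: measurableI => //; exact: measurable_run.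
Qed.

Lemma trivIset_stopat : trivIset setT (fun k : nat => stopat (a + k%:Z)).
Proof.
apply/trivIsetP => i j _ _ ij; rewrite -subset0 => w [/= h1]; rewrite /stopat/= h1 => -[ji].
by move/addrI : ji ij => [->]; rewrite eqxx.
Qed.

Lemma runE l : run l =
  [set w | (l%:~R%:E < at_index (fun l => l%:~R) (first_index a (p ^~ w)) :> \bar R)%E].
Proof.
apply/seteqP; split => w /=.
  move=> rw; case E : first_index => [k|] /=; last by rewrite ltry.
  move/first_index_Some : E => [ak pk _]; rewrite lte_fin ltr_int ltNge.
  by apply/negP => kl; have := rw k ak kl; rewrite pk.
case E : first_index => [k|] /=; last first.
  by move/first_index_None : E => h _ k ak _; exact: h.
move/first_index_Some : E => [_ _ h]; rewrite lte_fin ltr_int => lk i ai il.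
by apply: h => //; exact: le_lt_trans lk.
Qed.

Variable sz : int -> nat.
Hypothesis sz_incr : forall k l, a <= k -> k < l -> (sz k < sz l)%N.

Let jump l : R := (sz (l + 1))%:R - (sz l)%:R.

Let jump_ge1 l : a <= l -> 1 <= jump l.
Proof.
move=> al; rewrite lerBrDr addrC natr1 ler_nat; apply: sz_incr => //.
by rewrite ltrDl.
Qed.

Let jump_ge0 l : a <= l -> 0 <= jump l.
Proof. by move=> al; rewrite (le_trans ler01)// jump_ge1. Qed.

Lemma sum_jump m : \sum_(0 <= k < m) jump (a + k%:Z) = (sz (a + m%:Z))%:R - (sz a)%:R.
Proof.
elim: m => [|m IH]; first by rewrite big_geq// addr0 subrr.
rewrite big_nat_recr//= IH /jump -addn1 PoszD [a + (_ + _)]addrA; ring.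
Qed.

(** Summation by parts: each stage at which sampling is still running contributes its jump. Sizes
    are strictly increasing integers, so jumps are at least 1 and the sum is infinite when sampling
    never stops. *)
Lemma at_index_size w : at_index (fun l => (sz l)%:R : R) (first_index a (p ^~ w)) =
  ((sz a)%:R%:E + sum_from a (fun l => (jump l)%:E * (\1_(run l) w)%:E))%E.
Proof.
have f0 l : a <= l -> (0 <= (jump l)%:E * (\1_(run l) w)%:E :> \bar R)%E.
  by move=> al; rewrite mule_ge0// lee_fin ?jump_ge0// indicE.
case E : first_index => [l|] /=.
  have := E => /first_index_Some[al pl h].
  have lE : l = a + (`|l - a|%N)%:Z by rewrite gez0_abs ?subr_ge0// subrKC.
  rewrite (sum_from_split `|l - a|)// -lE [X in (_ + (_ + X))%E]/sum_from eseries0.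
    rewrite adde0 (eq_big_nat _ _ (F2 := fun k => (jump (a + k%:Z))%:E)).
      by rewrite sumEFin sum_jump -lE -EFinD subrKC.
    move=> k /andP[_ kl]; rewrite indicE mem_set ?mule1//= => i ai ik.
    apply: h => //; apply: (le_lt_trans ik); rewrite [ltRHS]lE ltrD2l.
    by rewrite ltz_nat.
  move=> k _ _; rewrite indicE memNset ?mule0//= => rw.
  by have := rw l al; rewrite lerDl pl => /(_ isT).
move/first_index_None : E => h; apply/esym/eqP.
rewrite (_ : sum_from _ _ = +oo%E)//; apply/eqyP => A A0.
pose m := (Num.truncn A).+1.
apply: (@le_trans _ _ (\sum_(0 <= k < m) ((jump (a + k%:Z))%:E * (\1_(run (a + k%:Z)) w)%:E))%E).
  apply: (@le_trans _ _ (\sum_(0 <= k < m) 1%:E)%E).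
    rewrite sumEFin lee_fin sumr_const_nat subn0.
    by apply: ltW; exact: truncnS_gt.
  apply: lee_sum => k _; rewrite indicE mem_set ?mule1 ?lee_fin ?jump_ge1 ?lerDl//.
  by move=> i ai _; exact: h.
by apply: nneseries_lim_ge => k _ _; apply: f0; rewrite lerDl.
Qed.

Lemma measurable_at_index_size :
  measurable_fun setT (fun w => at_index (fun l => (sz l)%:R : R) (first_index a (p ^~ w))).
Proof.
under eq_fun do rewrite at_index_size.
apply: emeasurable_funD => //; apply: ge0_emeasurable_sum => k.
  by move=> w _ _; rewrite mule_ge0// lee_fin ?jump_ge0 ?lerDl// indicE.
move=> _; apply: emeasurable_funM => //; apply/measurable_EFinP.
by apply: measurable_indic; exact: measurable_run.
Qed.

Lemma integral_at_index_size :
  (\int[P]_w at_index (fun l => (sz l)%:R : R) (first_index a (p ^~ w)) =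
   (sz a)%:R%:E + sum_from a (fun l => (jump l)%:E * P (run l)))%E.
Proof.
under eq_integral do rewrite at_index_size.
have mt l : measurable_fun setT (fun w => ((jump l)%:E * (\1_(run l) w)%:E)%E).
  apply: emeasurable_funM => //; apply/measurable_EFinP.
  by apply: measurable_indic; exact: measurable_run.
have t0 (k : nat) w : (0 <= (jump (a + k%:Z))%:E * (\1_(run (a + k%:Z)) w)%:E)%E.
  by rewrite mule_ge0// lee_fin ?jump_ge0 ?lerDl// indicE.
rewrite ge0_integralD//=.
- congr (_ + _)%E; first by rewrite integral_cst//= probability_setT mule1.
  rewrite integral_nneseries//; apply: eq_eseriesr => k _.
  rewrite ge0_integralZl//.
  + by rewrite integral_indic ?setIT//; exact: measurable_run.
  + by apply/measurable_EFinP; apply: measurable_indic; exact: measurable_run.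
  + by rewrite lee_fin jump_ge0// lerDl.
- by move=> w _; apply: nneseries_ge0.
- exact: ge0_emeasurable_sum.
Qed.

(* Runs that never stop count on neither side. *)
Lemma probability_stopped (E : int -> set T) : (forall l, a <= l -> measurable (E l)) ->
  P [set w | if first_index a (p ^~ w) is Some l then E l w else False] =
  sum_from a (fun l => P (stopat l `&` E l)).
Proof.
move=> mE.
rewrite (_ : [set w | _] = \bigcup_k (stopat (a + k%:Z) `&` E (a + k%:Z))).
  rewrite measure_semi_bigcup//.
  - by move=> k; apply: measurableI; [exact: measurable_stopat|apply: mE; rewrite lerDl].
  - apply/trivIsetP => i j _ _ ij; have /trivIsetP/(_ i j I I ij) := trivIset_stopat.
    by rewrite -!subset0 => h w [[s1 _] [s2 _]]; apply: h; split.
  - apply: bigcup_measurable => k _.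
    by apply: measurableI; [exact: measurable_stopat|apply: mE; rewrite lerDl].
apply/seteqP; split => [w /=|w [k _ [/= -> Ew]]//].
case E1 : first_index => [l|//] El.
have := E1 => /first_index_Some[al _ _].
by exists `|l - a|%N => //; rewrite /stopat/= gez0_abs ?subr_ge0// subrKC.
Qed.

End stopping.

(** * Bounds for a stopped scheme *)

Section stopping_general.
Context d (T : measurableType d) (R : realType) (P : probability T R).
Variables (a : int) (p : int -> T -> bool).
Hypothesis mp : forall l, measurable [set w | p l w].
Hypothesis p_ge : forall l w, p l w -> a <= l.

Lemma measurable_undecided l : measurable [set w | ~~ p l w].
Proof.
rewrite (_ : [set w | _] = ~` [set w | p l w]); first exact: measurableC.
by apply/seteqP; split => w /= /negP.
Qed.

Lemma stopat_sub l : a <= l ->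
  stopat a p l `<=` [set w | ~~ p (l - 1) w] `&` [set w | p l w].
Proof.
move=> al; rewrite stopatE// => w [rw pl]; split => //=.
(* For [l = a] the preceding stage lies outside the run; there [p_ge] excludes a decision. *)
by apply/negP => pl1; have := rw _ (p_ge pl1) (lexx _); rewrite pl1.
Qed.

Lemma le_stopped_sum (E : int -> set T) : (forall l, a <= l -> measurable (E l)) ->
  (sum_from a (fun l => P (stopat a p l `&` E l)) <=
   sum_from a (fun l => P (E l `&` [set w | ~~ p (l - 1)%R w] `&` [set w | p l w])))%E.
Proof.
move=> mE; apply: le_sum_from => // l al; apply: le_measure; rewrite ?inE.
- by apply: measurableI; [exact: measurable_stopat|exact: mE].
- apply: measurableI => //; apply: measurableI; [exact: mE|exact: measurable_undecided].
- by move=> w [sw Ew]; have [] := stopat_sub al sw.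
Qed.

Lemma run_le_undecided l : (P (run a p l) <= P [set w | ~~ p l w])%E.
Proof.
apply: le_measure; rewrite ?inE; [exact: measurable_run|exact: measurable_undecided|].
move=> w rw /=; apply/negP => pl; have := rw l (p_ge pl) (lexx _).
by rewrite pl.
Qed.

End stopping_general.

Section stopping_bounds.
Context d (T : measurableType d) (R : realType) (P : probability T R).
Variables (p : int -> T -> bool) (sz : int -> nat) (m : nat) (K0 : R).
Hypothesis mp : forall l, measurable [set w | p l w].
Hypothesis p_ge : forall l w, p l w -> 1 <= l.
Hypothesis sz_gt0 : (0 < sz 1)%N.
Hypothesis sz_incr : forall k l : int, 1 <= k -> k < l -> (sz k < sz l)%N.

Let und l := [set w | ~~ p l w].
Let dec l := [set w | p l w].
Let j : int := 1 + m%:Z.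

(** The weight by the next size serves twice: divided by the first size, it makes the undecided
    probabilities from [j] on sum to at most [rate]; undivided, it bounds by [K0] what these stages
    add to the mean size. *)
Hypothesis tail_bound :
  (sum_from j (fun l => (sz (l + 1)%R)%:R%:E * P (und l)) <= K0%:E)%E.

(** The union bound for a decision at one of the stages [1, ..., h]. The value [h = m] covers the
    stages below [j], and [h = m.-1] those below [j - 1]. *)
Definition early h : R := \sum_(0 <= k < h) fine (P [set w | p (1 + k%:Z) w]).

Let mu l : measurable (und l). Proof. exact: measurable_undecided. Qed.
Let md l : measurable (dec l). Proof. exact: mp. Qed.

Let early_set h := [set w | exists2 k : nat, (k < h)%N & p (1 + k%:Z) w].

Let early_setS h : early_set h.+1 = early_set h `|` dec (1 + h%:Z).
Proof.
apply/seteqP; split => w /=.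
  by move=> [k]; rewrite ltnS leq_eqVlt => /predU1P[->|kh] pk; [right|left; exists k].
by case => [[k kh pk]|ph]; [exists k => //; exact: ltnW|exists h].
Qed.

Let mearly_set h : measurable (early_set h).
Proof.
elim: h => [|h IH]; last by rewrite early_setS; exact: measurableU.
by rewrite (_ : early_set 0 = set0)//; apply/seteqP; split => // w [k]; rewrite ltn0.
Qed.

Let P_early_set h : (P (early_set h) <= (early h)%:E)%E.
Proof.
rewrite /early; elim: h => [|h IH].
  have -> : early_set 0 = set0 by apply/seteqP; split => // w [k]; rewrite ltn0.
  by rewrite big_geq// measure0.
rewrite early_setS big_nat_recr//= EFinD fineK ?fin_num_measure//.
by apply: (le_trans (measureU2 _ _ _)) => //; rewrite leeD2r.
Qed.

Lemma early_ge0 h : 0 <= early h.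
Proof. by apply: sumr_ge0 => k _; exact: fine_ge0. Qed.

Let rate := K0 / (sz 1)%:R.

Let sz1 : (0 : R) < (sz 1)%:R. Proof. by rewrite ltr0n. Qed.

Let sz_ge1 l : 1 <= l -> (sz 1 <= sz l)%N.
Proof. by rewrite le_eqVlt => /predU1P[<-//|l1]; apply: ltnW; exact: sz_incr. Qed.

Let j1 : 1 <= j. Proof. by rewrite /j lerDl. Qed.

Let sum_und : (sum_from j (fun l => P (und l)) <= rate%:E)%E.
Proof.
apply: (@le_trans _ _ (sum_from j (fun l => ((sz 1)%:R^-1)%:E * ((sz (l + 1))%:R%:E * P (und l))))%E).
  apply: le_sum_from => // l jl; rewrite muleA -EFinM -[leLHS]mul1e.
  apply: lee_wpmul2r => //; rewrite lee_fin mulrC ler_pdivlMr// mul1r ler_nat.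
  by rewrite sz_ge1// ler_wpDr// (le_trans j1).
rewrite /sum_from nneseriesZl; last by move=> k _; rewrite mule_ge0.
by rewrite /rate mulrC EFinM; apply: lee_wpmul2l => //; rewrite lee_fin invr_ge0.
Qed.

Let rate_ge0 : 0 <= rate.
Proof. by rewrite -lee_fin; apply: le_trans sum_und; apply: sum_from_ge0. Qed.

Let P_und l : j <= l -> (P (und l) <= rate%:E)%E.
Proof. by move=> jl; apply: le_trans sum_und; apply: le_term_sum_from. Qed.

Let int_pos (k : int) : 1 <= k -> k = 1 + (`|k - 1|%N)%:Z.
Proof. by move=> k1; rewrite gez0_abs ?subr_ge0// subrKC. Qed.

Let not_run l (w : T) : ~ run 1 p l w -> exists2 k : nat, 1 + k%:Z <= l & p (1 + k%:Z) w.
Proof.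
move=> nr; apply: contrapT => h; apply: nr => k k1 kl; apply/negP => pk.
by apply: h; exists `|k - 1|%N; rewrite -int_pos.
Qed.

(* Being undecided at a stage after an earlier decision requires a decision
   before stage [j - 1] or no decision at a stage from [j] on. *)
Let und_not_run l : l <= 1 + m%:Z - 1 -> und l `\` run 1 p l `<=` early_set m.-1.
Proof.
rewrite [1 + _]addrC addrK => lm w [ul /not_run[k kl pk]]; exists k => //.
have k1l : 1 + k%:Z < l.
  by rewrite lt_neqAle kl andbT; apply: contraTneq pk => ->.
by have := lt_le_trans k1l lm; lia.
Qed.

Lemma undecided_le_run l : 1 <= l ->
  (P (und l) <= P (run 1 p l) + (early m.-1 + rate)%:E)%E.
Proof.
move=> l1; have [lj|jl] := ltP l j; last first.
  apply: (le_trans (P_und jl)); rewrite EFinD addeA leeDr// adde_ge0//.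
  by rewrite lee_fin early_ge0.
have sub : und l `<=` run 1 p l `|` early_set m.-1.
  move=> w uw; case: (pselect (run 1 p l w)) => rw; [by left|right].
  by apply: (@und_not_run l) => //; move: lj; rewrite /j; lia.
have mr := measurable_run 1 mp l.
apply: (le_trans (le_measureU P _ mr _ sub)) => //; rewrite leeD2l//.
by apply: (le_trans (P_early_set _)); rewrite lee_fin lerDl.
Qed.

Let P_not_stopat : (P (~` stopat 1 p j) <= (early m + rate)%:E)%E.
Proof.
rewrite EFinD; apply: le_trans (leeD (P_early_set m) (P_und (lexx j))).
apply: le_measureU => //; first by apply: measurableC; exact: measurable_stopat.
move=> w; rewrite stopatE// => /not_andP[/not_run[k]|/negP]; [left|by right].
by exists k => //; lia.
Qed.

Lemma stopped_sum_le (E : int -> set T) : (forall l, 1 <= l -> measurable (E l)) ->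
  (sum_from 1 (fun l => P (E l `&` und (l - 1)%R `&` dec l)) <=
   sum_from 1 (fun l => P (stopat 1 p l `&` E l)) + (m.+1%:R * early m.-1 + rate)%:E)%E.
Proof.
move=> mE.
(* Error charged to stage [l]. Each of the [m + 1] stages up to [j] pays for an early decision;
   beyond [j] the whole event lies in [und (l - 1)] with [l - 1 >= j], and these probabilities sum
   to at most [rate]. *)
pose e l : \bar R := if l <= j then (early m.-1)%:E else P (und (l - 1)).
have e0 l : (0 <= e l)%E by rewrite /e; case: ifP; rewrite ?lee_fin ?early_ge0.
apply: (@le_trans _ _ (sum_from 1 (fun l => P (stopat 1 p l `&` E l) + e l))%E).
  apply: le_sum_from => // l l1.
  have mS : measurable (stopat 1 p l `&` E l).
    by apply: measurableI; [exact: measurable_stopat|exact: mE].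
  have mF : measurable (E l `&` und (l - 1) `&` dec l).
    by apply: measurableI; [apply: measurableI; [exact: mE|exact: mu]|exact: md].
  rewrite /e; case: ifPn => lj; last first.
    rewrite (le_trans _ (leeDr _ _))//; apply: le_measure; rewrite ?inE//.
    by move=> w [[]].
  apply: le_trans (leeD2l _ (P_early_set m.-1)); apply: le_measureU => // w [[Ew uw] dw].
  case: (pselect (run 1 p (l - 1) w)) => rw; first by left; split => //; rewrite stopatE.
  by right; apply: (@und_not_run (l - 1)) => //; rewrite lerD2r.
rewrite sum_fromD// leeD2l//.
rewrite (@sum_from_split _ _ m.+1)// EFinD; apply: leeD.
  rewrite (eq_big_nat _ _ (F2 := fun=> (early m.-1)%:E)).
    by rewrite sumEFin sumr_const_nat subn0 mulr_natl.
  by move=> k /andP[_ km]; rewrite /e ifT// /j lerD2l lez_nat.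
apply: le_trans sum_und; rewrite le_eqVlt; apply/orP; left; apply/eqP.
apply: eq_eseriesr => k _; rewrite /e ifF; first by congr (P (und _)); rewrite /j; lia.
by apply/negP; rewrite /j; lia.
Qed.

Section covered.
Variable E : int -> set T.
Hypothesis mE : forall l, 1 <= l -> measurable (E l).

Definition covered_at_stop := [set w | if first_index 1 (p ^~ w) is Some l then E l w else False].
Let cov := covered_at_stop.

Lemma measurable_covered_at_stop : measurable cov.
Proof.
rewrite (_ : cov = \bigcup_k (stopat 1 p (1 + k%:Z) `&` E (1 + k%:Z))).
  apply: bigcup_measurable => k _.
  by apply: measurableI; [exact: measurable_stopat|apply: mE; rewrite lerDl].
apply/seteqP; split => [w|w [k _ [sk Ew]]]; rewrite /cov/covered_at_stop/=; last by rewrite sk.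
case E1 : first_index => [l|//] El; have := E1 => /first_index_Some[l1 _ _].
by exists `|l - 1|%N => //; rewrite /stopat/= -int_pos.
Qed.

Let le_on_stopat (A B : set T) : measurable A -> measurable B -> A `&` stopat 1 p j `<=` B ->
  (P A <= P B + (early m + rate)%:E)%E.
Proof.
move=> mA mB AB; have ms : measurable (~` stopat 1 p j).
  by apply: measurableC; exact: measurable_stopat.
apply: le_trans (leeD2l _ P_not_stopat); apply: le_measureU => // w Aw.
by case: (pselect (stopat 1 p j w)) => sw; [left; exact: AB|right].
Qed.

Lemma last_stage_le_covered : (P (E j) <= P cov + (early m + rate)%:E)%E.
Proof.
apply: le_on_stopat; [exact: mE|exact: measurable_covered_at_stop|].
by move=> w [Ew sw]; rewrite /cov/covered_at_stop/= sw.
Qed.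

Lemma covered_le_last_stage : (P cov <= P (E j) + (early m + rate)%:E)%E.
Proof.
apply: le_on_stopat; [exact: measurable_covered_at_stop|exact: mE|].
by move=> w []; rewrite /cov/covered_at_stop/= => + sw; rewrite sw.
Qed.

(** Up to the errors, the scheme stops at [j - 1] or at [j], without it being known which; on
    [E (j - 1)] and [E j] together it covers in both cases. Bonferroni's inequality bounds the
    intersection and produces the constant 1, hence the [- 3] of claim (III). *)
Lemma covered_ge : (0 < m)%N ->
  (P (E (j - 1)%R) + P (E j) <= P cov + (1 + early m.-1 + rate)%:E)%E.
Proof.
move=> m0; have mc := measurable_covered_at_stop.
have mj : measurable (E j) by exact: mE.
have mj1 : measurable (E (j - 1)) by apply: mE; rewrite /j; lia.
have mI : measurable (E (j - 1) `&` E j) by exact: measurableI.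
have h1 : (P (E (j - 1)%R) <= P (E (j - 1)%R `&` E j) + P (~` E j))%E.
  apply: le_measureU => //; first exact: measurableC.
  by move=> w Aw; case: (pselect (E j w)); [left|right].
have h2 : (P (E (j - 1)%R `&` E j) <= P cov + (early m.-1 + rate)%:E)%E.
  have mU : measurable (early_set m.-1 `|` und j) by exact: measurableU.
  have PU : (P (early_set m.-1 `|` und j) <= (early m.-1 + rate)%:E)%E.
    apply: (le_trans (measureU2 _ _ _)) => //; rewrite EFinD.
    by apply: leeD; [exact: P_early_set|exact: P_und].
  apply: le_trans (leeD2l _ PU); apply: le_measureU => //.
  move=> w [E1 E2]; case: (pselect ((early_set m.-1 `|` und j) w)) => [|/not_orP[ne nu]]; [by right|left].
  have pj : p j w by apply/negPn/negP.
  have npk k : 1 <= k -> k < j - 1 -> ~~ p k w.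
    move=> k1 kj; apply/negP => pk; apply: ne; exists `|k - 1|%N; last by rewrite -int_pos.
    by move: kj; rewrite /j; lia.
  have [pj1|npj1] := boolP (p (j - 1) w).
    rewrite /cov/covered_at_stop/= (_ : first_index _ _ = Some (j - 1))//.
    by apply/first_index_Some; split => //; rewrite /j; lia.
  rewrite /cov/covered_at_stop/= (_ : first_index _ _ = Some j)//.
  apply/first_index_Some; split => // k k1 kj.
  have [kj1|] := ltP k (j - 1); first exact: npk.
  move=> jk; have -> : k = j - 1 by lia.
  exact: npj1.
have [q qE] : exists q, P (E j) = q%:E.
  by exists (fine (P (E j))); rewrite fineK// fin_num_measure.
have hC : P (~` E j) = (1 - q)%:E by rewrite probability_setC// qE.
rewrite hC in h1; rewrite qE; apply: (@le_trans _ _ ((P (E (j - 1)%R `&` E j) + (1 - q)%:E) + q%:E)%E).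
  by rewrite leeD2r.
have -> : (1 + early m.-1 + rate)%:E = (1%:E + (early m.-1 + rate)%:E)%E by rewrite -EFinD addrA.
rewrite -addeA -EFinD subrK addeCA [leLHS]addeC; exact: leeD2l.
Qed.

(** A different member of the minimum is used in each range: deciding before [j], missing at [j],
    being undecided at [l - 1] after [j]. *)
Lemma Q_le :
  (sum_from 1 (fun l => Order.min (P (~` E l)) (Order.min (P (und (l - 1)%R)) (P (dec l)))) <=
   P (~` cov) + (2 * (early m + rate))%:E)%E.
Proof.
have min0 l : (0 <= Order.min (P (~` E l)) (Order.min (P (und (l - 1)%R)) (P (dec l))))%E.
  by rewrite !le_min !measure_ge0.
rewrite (@sum_from_split _ _ m.+1)// big_nat_recr//= -/j.
have h1 : (\sum_(0 <= k < m) Order.min (P (~` E (1 + k%:Z)%R)) (Order.min (P (und (1 + k%:Z - 1)%R)) (P (dec (1 + k%:Z)%R)))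
    <= (early m)%:E)%E.
  rewrite /early -sumEFin; apply: lee_sum => k _.
  by rewrite fineK ?fin_num_measure// !ge_min lexx !orbT.
have h2 : (Order.min (P (~` E j)) (Order.min (P (und (j - 1)%R)) (P (dec j))) <=
    P (~` cov) + (early m + rate)%:E)%E.
  apply: (@le_trans _ _ (P (~` E j))); first by rewrite ge_min lexx.
  apply: le_on_stopat.
  - by apply: measurableC; exact: mE.
  - by apply: measurableC; exact: measurable_covered_at_stop.
  - by move=> w [nE sw]; rewrite /cov/covered_at_stop/= sw.
have h3 : (sum_from (1 + m.+1%:Z)%R (fun l => Order.min (P (~` E l)) (Order.min (P (und (l - 1)%R)) (P (dec l)))) <= rate%:E)%E.
  apply: le_trans sum_und.
  apply: (@le_trans _ _ (sum_from (1 + m.+1%:Z)%R (fun l => P (und (l - 1)%R)))).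
    by apply: le_sum_from => // l _; rewrite !ge_min lexx orbT.
  rewrite le_eqVlt; apply/orP; left; apply/eqP.
  by apply: eq_eseriesr => k _; congr (P (und _)); rewrite /j; lia.
apply: (le_trans (leeD (leeD h1 h2) h3)).
rewrite [X in (X + _)%E]addeCA -addeA leeD2l// -!EFinD lee_fin; lra.
Qed.

End covered.

Let jump l : R := (sz (l + 1))%:R - (sz l)%:R.

Let jump_ge0 l : 1 <= l -> 0 <= jump l.
Proof. by move=> l1; rewrite subr_ge0 ler_nat ltnW// sz_incr// ltrDl. Qed.

Let mean := ((sz 1)%:R%:E + sum_from 1 (fun l => (jump l)%:E * P (run 1 p l)))%E.

Let tail_jump (F : int -> set T) : (forall l, 1 <= l -> (P (F l) <= P (und l))%E) ->
  (sum_from j (fun l => (jump l)%:E * P (F l)) <= K0%:E)%E.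
Proof.
move=> FU; apply: le_trans tail_bound; apply: le_sum_from => l jl.
  by rewrite mule_ge0// lee_fin jump_ge0// (le_trans j1).
have l1 := le_trans j1 jl.
apply: lee_pmul => //; rewrite ?lee_fin ?jump_ge0//; last exact: FU.
by rewrite /jump gerBl.
Qed.

(** The jumps below [j], with weights at most 1, telescope to [sz j]; the later ones are paid by
    [tail_bound], as a jump is at most the next size. *)
Lemma mean_le_size : (mean <= ((sz j)%:R + K0)%:E)%E.
Proof.
rewrite /mean (@sum_from_split _ _ m); last first.
  by move=> l l1; rewrite mule_ge0// lee_fin jump_ge0.
rewrite EFinD addeA; apply: leeD; last first.
  by apply: tail_jump => l _; exact: run_le_undecided.
apply: (@le_trans _ _ ((sz 1)%:R%:E + \sum_(0 <= k < m) (jump (1 + k%:Z))%:E)%E).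
  rewrite leeD2l//; apply: lee_sum => k _.
  rewrite -[leRHS]mule1; apply: lee_wpmul2l; first by rewrite lee_fin jump_ge0// lerDl.
  by rewrite probability_le1//; exact: measurable_run.
by rewrite sumEFin (sum_jump _ 1 sz) -EFinD subrKC.
Qed.

(** The first [h] jumps have running probability at least [1 - early h]. The case [h = 0] gives
    [sz 1 <= mean], which later serves as the denominator in claim (VII). *)
Lemma size_le_mean h : (((sz (1 + h%:Z))%:R * (1 - early h))%:E <= mean)%E.
Proof.
have e0 := early_ge0 h.
rewrite /mean (@sum_from_split _ _ h); last first.
  by move=> l l1; rewrite mule_ge0// lee_fin jump_ge0.
rewrite addeA; apply: (@le_trans _ _ ((sz 1)%:R%:E + \sum_(0 <= k < h) (jump (1 + k%:Z) * (1 - early h))%:E)%E).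
  rewrite sumEFin -mulr_suml (sum_jump _ 1 sz) -EFinD lee_fin.
  rewrite mulrBl addrCA lerDl subr_ge0 ler_piMr// gerBl//.
apply: (@le_trans _ _ ((sz 1)%:R%:E + \sum_(0 <= k < h) (jump (1 + k%:Z))%:E * P (run 1 p (1 + k%:Z)%R))%E); last first.
  rewrite leeDl// sum_from_ge0// => l hl; rewrite mule_ge0// lee_fin jump_ge0//.
  by rewrite (le_trans _ hl)// lerDl.
rewrite leeD2l// big_seq [leRHS]big_seq; apply: lee_sum => k; rewrite mem_index_iota => /andP[_ kh].
rewrite EFinM; apply: lee_wpmul2l; first by rewrite lee_fin jump_ge0// lerDl.
have mr := measurable_run 1 mp (1 + k%:Z).
have h1 : (P (~` run 1 p (1 + k%:Z)%R) <= (early h)%:E)%E.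
  apply: le_trans (P_early_set h); apply: le_measure; rewrite ?inE//; first exact: measurableC.
  by move=> w /not_run[i ik pi]; exists i => //; lia.
move: h1; rewrite probability_setC//.
have [q ->] : exists q, P (run 1 p (1 + k%:Z)%R) = q%:E.
  by exists (fine (P (run 1 p (1 + k%:Z)))); rewrite fineK// fin_num_measure.
by rewrite !lee_fin => ?; lra.
Qed.

(** Below [j] the errors of [undecided_le_run] are multiplied by jumps that telescope to at most
    [sz j]. The result need not be small, but it is small relative to the mean. *)
Lemma size_bound_le_mean :
  ((sz 1)%:R%:E + sum_from 1 (fun l => (jump l)%:E * P (und l)) <=
   mean + ((sz j)%:R * (early m.-1 + rate) + K0)%:E)%E.
Proof.
have e0 : 0 <= early m.-1 + rate by rewrite addr_ge0// early_ge0.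
have nn (F : int -> set T) l : 1 <= l -> (0 <= (jump l)%:E * P (F l))%E.
  by move=> l1; rewrite mule_ge0// lee_fin jump_ge0.
rewrite /mean -addeA leeD2l// (@sum_from_split _ _ m); last exact: nn.
rewrite EFinD addeA; apply: leeD; last exact: tail_jump.
apply: (@le_trans _ _ (\sum_(0 <= k < m) (jump (1 + k%:Z))%:E * P (run 1 p (1 + k%:Z)%R)
    + ((sz j)%:R * (early m.-1 + rate))%:E)%E); last first.
  rewrite leeD2r// [leRHS](@sum_from_split _ _ m); last exact: nn.
  rewrite leeDl// sum_from_ge0// => l hl; apply: nn; exact: le_trans j1 hl.
apply: (@le_trans _ _ (\sum_(0 <= k < m) ((jump (1 + k%:Z))%:E * P (run 1 p (1 + k%:Z)%R) +
    (jump (1 + k%:Z) * (early m.-1 + rate))%:E))%E).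
  apply: lee_sum => k _; rewrite EFinM -ge0_muleDr//.
  by apply: lee_wpmul2l; [rewrite lee_fin jump_ge0// lerDl|apply: undecided_le_run; rewrite lerDl].
rewrite big_split/= leeD2l// sumEFin -mulr_suml (sum_jump _ 1 sz) lee_fin.
by rewrite ler_wpM2r// gerBl.
Qed.

End stopping_bounds.

(** * Sample mean and sample variance *)

Section identically_distributed.
Context d (T : measurableType d) (R : realType) (P : probability T R).
Variables (X0 : {RV P >-> R}) (X : nat -> {RV P >-> R}).
Hypothesis X_iid : iid_samples_of X0 X.

Lemma iid_samples : iid P (fun i => X i).
Proof.
have [indX idX] := X_iid; split => [i|J B mB|i B mB]; first exact: measurable_funPT.
- exact: indX.
- by have := idX i B mB; have := idX 0%N B mB; rewrite /distribution /pushforward => -> ->.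
Qed.

Let integral_sample i (f : R -> \bar R) : measurable_fun setT f -> (forall y, (0 <= f y)%E) ->
  (\int[P]_w f (X i w) = \int[P]_w f (X0 w))%E.
Proof.
move=> mf f0; have [_ idX] := X_iid.
have h1 := ge0_integral_distribution (X i) mf f0; have h2 := ge0_integral_distribution X0 mf f0.
transitivity (\int[distribution P (X i)]_y f y)%E; first by rewrite h1.
transitivity (\int[distribution P X0]_y f y)%E; last by rewrite h2.
by apply: eq_measure_integral => A mA _; exact: idX.
Qed.

Lemma mean_is_sample i (h : R -> R) v : measurable_fun setT h ->
  mean_is P (fun w => h (X0 w)) v -> mean_is P (fun w => h (X i w)) v.
Proof.
move=> mh [hi hv].
have mhX (Y : {RV P >-> R}) : measurable_fun setT (EFin \o (fun w => h (Y w))).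
  by apply/measurable_EFinP; apply: (measurableT_comp mh).
have mE : measurable_fun setT (EFin \o h) by exact/measurable_EFinP.
split.
- apply/integrableP; split; first exact: mhX.
  rewrite (integral_sample i (f := fun y => `|(h y)%:E|%E))//; last exact: measurableT_comp.
  by have /integrableP[] := hi.
- have pos := integral_sample i (measurable_funepos mE) (funepos_ge0 (EFin \o h)).
  have neg := integral_sample i (measurable_funeneg mE) (funeneg_ge0 (EFin \o h)).
  rewrite -hv integralE [RHS]integralE; congr (_ - _)%E.
    transitivity (\int[P]_w ((EFin \o h)^\+ (X i w)))%E.
      by apply: eq_integral => w _; rewrite !funeposE.
    by rewrite pos; apply: eq_integral => w _; rewrite !funeposE.
  transitivity (\int[P]_w ((EFin \o h)^\- (X i w)))%E.
    by apply: eq_integral => w _; rewrite !funenegE.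
  by rewrite neg; apply: eq_integral => w _; rewrite !funenegE.
Qed.

End identically_distributed.

Section sample_moments.
Context d (T : measurableType d) (R : realType) (P : probability T R).
Variables (X0 : {RV P >-> R}) (X : nat -> {RV P >-> R}) (mu nu : R).
Hypothesis X_iid : iid_samples_of X0 X.
Hypothesis X0_moment6 : ('E_P[(fun w => `|X0 w| ^+ 6)%R] < +oo)%E.
Hypothesis X0_mean : 'E_P[X0]%E = mu%:E.
Hypothesis X0_var : 'V_P[X0]%E = nu%:E.

Let mX0 : measurable_fun setT X0. Proof. exact: measurable_funPT. Qed.

Let X0_6 : exists v, mean_is P (fun w => `|X0 w| ^+ 6) v.
Proof.
have f0 w : 0 <= `|X0 w| ^+ 6 by rewrite exprn_ge0.
exists (fine ('E_P[(fun w => `|X0 w| ^+ 6)%R])); apply: mean_is_ge0 => //.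
  by apply: measurable_funX; exact: measurableT_comp.
rewrite fineK ?unlock// ge0_fin_numE; last by apply: integral_ge0 => w _; rewrite lee_fin.
by move: X0_moment6; rewrite unlock.
Qed.

Let poly_dom (c : R) (x : R) : (x - c) ^+ 4 <= 8 * (1 + `|x| ^+ 6) + 8 * c ^+ 4.
Proof.
have h1 : (x - c) ^+ 4 <= 8 * x ^+ 4 + 8 * c ^+ 4.
  have := sqr_ge0 (x + c); have := sqr_ge0 (x ^+ 2 - c ^+ 2).
  have := sqr_ge0 ((x + c) ^+ 2).
  have e : (x - c) ^+ 2 <= 2 * (x ^+ 2 + c ^+ 2) by have := sqr_ge0 (x + c); rewrite !sqrrD; nra.
  have : ((x - c) ^+ 2) ^+ 2 <= (2 * (x ^+ 2 + c ^+ 2)) ^+ 2.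
    by rewrite ler_pXn2r// nnegrE ?sqr_ge0// mulr_ge0// addr_ge0 ?sqr_ge0.
  nra.
suff : x ^+ 4 <= 1 + `|x| ^+ 6 by lra.
have -> : x ^+ 4 = `|x| ^+ 4 by rewrite -normrX ger0_norm// exprn_even_ge0.
have := normr_ge0 x; move: `|x| => y y0.
have [y1|y1] := leP y 1.
  by rewrite (@le_trans _ _ 1) ?exprn_ile1// lerDl exprn_ge0.
by rewrite ler_wpDl// ler_weXn2l// ltW.
Qed.

Lemma sample_moment1 i : mean_is P (fun w => X i w - mu) 0.
Proof.
have [v6 h6] := X0_6.
have [u hu _] : exists2 u, mean_is P X0 u & `|u| <= 1 + v6.
  apply: (mean_is_dominated mX0 _ (mean_isD (mean_is_cst P 1) h6)) => w /=.
  have := normr_ge0 (X0 w); move: `|X0 w| => y y0.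
  have [y1|y1] := leP y 1; first by rewrite (le_trans y1)// lerDl exprn_ge0.
  by rewrite ler_wpDl// -[leLHS]expr1 ler_weXn2l// ltW.
have um : u = mu by case: hu => _; move: X0_mean; rewrite unlock => -> [].
apply: (mean_is_sample X_iid i (h := fun y => y - mu)); first exact: measurable_funB.
by have := mean_isD hu (mean_is_cst P (- mu)); rewrite um subrr.
Qed.

Lemma sample_moment2 i : mean_is P (fun w => (X i w - mu) ^+ 2) nu.
Proof.
apply: (mean_is_sample X_iid i (h := fun y => (y - mu) ^+ 2)).
  by apply: measurable_funX; exact: measurable_funB.
apply: mean_is_ge0 => [|w|].
- by apply: measurable_funX; exact: measurable_funB.
- exact: sqr_ge0.
- move: X0_var; rewrite /variance covariance.unlock expectation.unlock => <-.
  by move: X0_mean; rewrite expectation.unlock => ->.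
Qed.

Lemma sample_moment4 i : exists v, mean_is P (fun w => (X i w - mu) ^+ 4) v.
Proof.
have [v6 h6] := X0_6.
have m4 : measurable_fun setT (fun w => (X0 w - mu) ^+ 4).
  by apply: measurable_funX; exact: measurable_funB.
have [|u hu _] := mean_is_dominated m4 _
    (mean_isD (mean_isZ 8 (mean_isD (mean_is_cst P 1) h6)) (mean_is_cst P (8 * mu ^+ 4))).
  by move=> w /=; rewrite ger0_norm ?exprn_even_ge0//; exact: poly_dom.
by exists u; apply: (mean_is_sample X_iid i (h := fun y => (y - mu) ^+ 4)) => //;
  apply: measurable_funX; exact: measurable_funB.
Qed.

Let mXi i : measurable_fun setT (fun w => X i w - mu).
Proof. by apply: measurable_funB => //; exact: measurable_funPT. Qed.

Let pow_dominated i (h : R -> R) (a b c : R) : measurable_fun setT h ->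
  (forall y, `|h y| <= a * y ^+ 4 + (b * y ^+ 2 + c)) ->
  exists v, mean_is P (fun w => h (X i w - mu)) v.
Proof.
move=> mh hb; have [v4 h4] := sample_moment4 i.
have mhX : measurable_fun setT (fun w => h (X i w - mu)) by exact: measurableT_comp.
have [|u hu _] := mean_is_dominated mhX _
  (mean_isD (mean_isZ a h4) (mean_isD (mean_isZ b (sample_moment2 i)) (mean_is_cst P c))).
  by move=> w; exact: hb.
by exists u.
Qed.

Lemma sample_abs_moment3 i : exists v, mean_is P (fun w => `|X i w - mu| ^+ 3) v.
Proof.
apply: (pow_dominated i (h := fun y => `|y| ^+ 3) (a := 1) (b := 1) (c := 0)).
  by apply: measurable_funX; exact: normr_measurable.
move=> y; rewrite normrX normr_id !mul1r addr0.
have -> : y ^+ 4 = `|y| ^+ 4 by rewrite -normrX ger0_norm// exprn_even_ge0.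
rewrite -(real_normK (num_real y)); have := normr_ge0 y; move: `|y| => z z0.
have := mulr_ge0 z0 (mulr_ge0 z0 (sqr_ge0 (z - 2^-1))).
have := mulr_ge0 z0 z0; rewrite !exprS expr0; nra.
Qed.

Lemma sample_square_var i : exists v, mean_is P (fun w => ((X i w - mu) ^+ 2 - nu) ^+ 2) v.
Proof.
apply: (pow_dominated i (h := fun y => (y ^+ 2 - nu) ^+ 2) (a := 2) (b := 0) (c := 2 * nu ^+ 2)).
  by apply: measurable_funX; apply: measurable_funB => //; exact: exprn_measurable.
move=> y; rewrite ger0_norm ?sqr_ge0// mul0r add0r.
by have := sqr_ge0 (y ^+ 2 + nu); nra.
Qed.

Lemma sample_shifted_square_mean i :
  mean_is P (fun w => (X i w - mu + 1) ^+ 2) (nu + 1).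
Proof.
apply: (eq_mean_is (f := fun w => (X i w - mu) ^+ 2 + (2 * (X i w - mu) + cst 1 w))) => [w|].
  by rewrite /=; ring.
rewrite -[X in mean_is _ _ (_ + X)]add0r -{1}(mulr0 2).
apply: mean_isD; first exact: sample_moment2.
by apply: mean_isD; [apply: mean_isZ; exact: sample_moment1|exact: mean_is_cst].
Qed.

Lemma sample_shifted_square_var i :
  exists v, mean_is P (fun w => ((X i w - mu + 1) ^+ 2 - (nu + 1)) ^+ 2) v.
Proof.
(* The constants come from [(y^2 + 2 y - nu)^2 <= 3 (y^4 + 4 y^2 + nu^2)]. *)
apply: (pow_dominated i (h := fun y => ((y + 1) ^+ 2 - (nu + 1)) ^+ 2) (a := 3) (b := 12) (c := 3 * nu ^+ 2)).
  apply: measurable_funX; apply: measurable_funB => //; apply: measurable_funX.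
  exact: measurable_funD.
move=> y; rewrite ger0_norm ?sqr_ge0//.
have := sqr_ge0 (y ^+ 2 - 2 * y); have := sqr_ge0 (y ^+ 2 + nu); have := sqr_ge0 (2 * y + nu).
nra.
Qed.

End sample_moments.

Section sample_averages.
Context d (T : measurableType d) (R : realType) (P : probability T R).
Variables (X : nat -> {RV P >-> R}) (mu : R).

Definition dev (i : nat) (w : T) : R := X i w - mu.
Definition sqdev (i : nat) (w : T) : R := (X i w - mu) ^+ 2.

Definition sample_var n w : R := (\sum_(i < n) (X i w - mean_of X n w) ^+ 2) / n%:R.

Lemma mean_of_dev n w : (0 < n)%N -> mean_of X n w - mu = partial_sum dev n w / n%:R.
Proof.
move=> n0; rewrite /mean_of /partial_sum /dev sumrB sumr_const card_ord.
by rewrite mulrBl -[mu *+ n]mulr_natr mulfK// pnatr_eq0 -lt0n.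
Qed.

(** Recentring at [mu] leaves an average of i.i.d. terms minus the squared error of the mean. The
    sign matters: an error of the mean can only lower the sample variance. *)
Lemma sample_varE n w : (0 < n)%N ->
  sample_var n w = partial_sum sqdev n w / n%:R - (mean_of X n w - mu) ^+ 2.
Proof.
move=> n0; have nn : (n%:R : R) != 0 by rewrite pnatr_eq0 -lt0n.
rewrite /sample_var /partial_sum /sqdev; set z := mean_of X n w.
have -> : \sum_(i < n) (X i w - z) ^+ 2 = \sum_(i < n) ((X i w - mu) ^+ 2 +
    (2 * (mu - z) * dev i w + (mu - z) ^+ 2)).
  by apply: eq_bigr => i _; rewrite /dev; ring.
rewrite !big_split/= -mulr_sumr sumr_const card_ord -[_ *+ n]mulr_natr.
have -> : \sum_(i < n) dev i w = (z - mu) * n%:R by rewrite mean_of_dev// divfK.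
by field.
Qed.

Lemma measurable_mean_of n : measurable_fun setT (mean_of X n).
Proof.
apply: measurable_funM => //; apply: measurable_sum => i; exact: measurable_funPT.
Qed.

Lemma measurable_sample_var n : measurable_fun setT (sample_var n).
Proof.
apply: measurable_funM => //; apply: measurable_sum => i.
apply: measurable_funX; apply: measurable_funB; first exact: measurable_funPT.
exact: measurable_mean_of.
Qed.

End sample_averages.

Section sample_limits.
Context d (T : measurableType d) (R : realType) (P : probability T R).
Variables (X0 : {RV P >-> R}) (X : nat -> {RV P >-> R}) (mu nu : R).
Hypothesis X_iid : iid_samples_of X0 X.
Hypothesis X0_moment6 : ('E_P[(fun w => `|X0 w| ^+ 6)%R] < +oo)%E.
Hypothesis X0_mean : 'E_P[X0]%E = mu%:E.
Hypothesis X0_var : 'V_P[X0]%E = nu%:E.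
Hypothesis nu_gt0 : 0 < nu.

Let iid_dev : iid P (dev X mu).
Proof. by apply: (iid_comp (h := fun y => y - mu) _ (iid_samples X_iid)); exact: measurable_funB. Qed.

Let iid_sqdev : iid P (sqdev X mu).
Proof.
apply: (iid_comp (h := fun y => (y - mu) ^+ 2) _ (iid_samples X_iid)).
by apply: measurable_funX; exact: measurable_funB.
Qed.

Let dev1 := sample_moment1 X_iid X0_moment6 X0_mean 0.
Let dev2 := sample_moment2 X_iid X0_mean X0_var 0.

Lemma mean_tail : exists2 K : R, 0 <= K & forall n r, (0 < n)%N -> 0 < r ->
  (P [set w | (r <= `|mean_of X n w - mu|)%R] <= (K / (n%:R ^+ 2 * r ^+ 4))%:E)%E.
Proof.
have [m4 dev4] := sample_moment4 mu X_iid X0_moment6 0.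
have m40 : 0 <= m4.
  rewrite -lee_fin; case: dev4 => _ <-.
  by apply: integral_ge0 => w _; rewrite lee_fin exprn_even_ge0.
exists (8 * nu ^+ 2 + 3 * m4); first by rewrite addr_ge0// mulr_ge0// sqr_ge0.
move=> n r n0 r0; have n1 : (0 : R) < n%:R by rewrite ltr0n.
have := tail_fourth_moment iid_dev dev1 n dev2 dev4 (mulr_gt0 n1 r0).
rewrite (_ : n%:R ^+ 2 * _ / _ = (8 * nu ^+ 2 + 3 * m4) / (n%:R ^+ 2 * r ^+ 4)); last first.
  by field; rewrite !gt_eqF.
apply: le_trans; rewrite le_eqVlt; apply/orP; left; apply/eqP; congr (P _).
apply/seteqP; split => w /=; rewrite mean_of_dev// normrM normfV (ger0_norm (ltW n1)).
  by rewrite ler_pdivlMr// mulrC.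
by rewrite ler_pdivlMr// mulrC.
Qed.

Lemma square_tail : exists2 K : R, 0 <= K & forall n t, (0 < n)%N -> 0 < t ->
  (P [set w | (t <= `|partial_sum (sqdev X mu) n w / n%:R - nu|)%R] <= (K / (n%:R * t ^+ 2))%:E)%E.
Proof.
have [v hv] := sample_square_var X_iid X0_moment6 X0_mean X0_var 0.
have iid_c : iid P (fun i => (fun y => (y - mu) ^+ 2 - nu) \o X i).
  apply: iid_comp (iid_samples X_iid).
  by apply: measurable_funB => //; apply: measurable_funX; exact: measurable_funB.
have c1 : mean_is P ((fun y => (y - mu) ^+ 2 - nu) \o X 0%N) 0.
  by have := mean_isD dev2 (mean_is_cst P (- nu)); rewrite subrr.
exists v.
  rewrite -lee_fin; case: hv => _ <-.
  by apply: integral_ge0 => w _; rewrite lee_fin sqr_ge0.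
move=> n t n0 t0; have n1 : (0 : R) < n%:R by rewrite ltr0n.
have := tail_second_moment iid_c c1 n hv (mulr_gt0 n1 t0).
rewrite (_ : n%:R * v / _ = v / (n%:R * t ^+ 2)); last first.
  by field; rewrite !gt_eqF.
apply: le_trans; rewrite le_eqVlt; apply/orP; left; apply/eqP; congr (P _).
have SE w : partial_sum (fun i => (fun y => (y - mu) ^+ 2 - nu) \o X i) n w =
    n%:R * (partial_sum (sqdev X mu) n w / n%:R - nu).
  rewrite /partial_sum /sqdev /= sumrB sumr_const card_ord -[nu *+ n]mulr_natl.
  by field; rewrite gt_eqF.
apply/seteqP; split => w /=; rewrite SE normrM (ger0_norm (ltW n1)) ler_pM2l//.
Qed.

(** The difference of the two squares is [2 (X - mu) + 1], so two laws for nonnegative variables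
    yield the law for the signed [X - mu]; the first square alone then gives the sample variance. *)
Lemma slln_mean_var : {ae P, forall w, (mean_of X n w @[n --> \oo] --> mu) /\
  (sample_var X n w @[n --> \oo] --> nu)}.
Proof.
have [v1 h1] := sample_square_var X_iid X0_moment6 X0_mean X0_var 0.
have [v2 h2] := sample_shifted_square_var X_iid X0_moment6 X0_mean X0_var 0.
have iid_s : iid P (fun i => (fun y => (y - mu + 1) ^+ 2) \o X i).
  apply: iid_comp (iid_samples X_iid); apply: measurable_funX.
  by apply: measurable_funD => //; exact: measurable_funB.
have s1 := sample_shifted_square_mean X_iid X0_moment6 X0_mean X0_var 0.
have A := slln_ge0 iid_sqdev (fun i w => sqr_ge0 _) dev2 h1.
have B := slln_ge0 iid_s (fun i w => sqr_ge0 _) s1 h2.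
apply: filterS2 A B => w cA cB.
have cD : partial_sum (dev X mu) n w / n%:R @[n --> \oo] --> 0.
  have : 2^-1 * (partial_sum (fun i => (fun y => (y - mu + 1) ^+ 2) \o X i) n w / n%:R -
      partial_sum (sqdev X mu) n w / n%:R - 1) @[n --> \oo] --> 2^-1 * (nu + 1 - nu - 1).
    apply: cvgM; first exact: cvg_cst.
    by apply: cvgB; [exact: cvgB|exact: cvg_cst].
  rewrite (_ : 2^-1 * (nu + 1 - nu - 1) = 0); last by ring.
  move=> h; apply: cvg_trans h; apply: near_eq_cvg; near=> n.
  have n0 : (0 : R) < n%:R by rewrite ltr0n; near: n; exact: nbhs_infty_gt.
  rewrite /partial_sum.
  have -> : \sum_(i < n) ((fun y => (y - mu + 1) ^+ 2) \o X i) w =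
      \sum_(i < n) sqdev X mu i w + (2 * (\sum_(i < n) dev X mu i w) + n%:R).
    have -> : n%:R = \sum_(i < n) (1 : R) by rewrite sumr_const card_ord.
    rewrite mulr_sumr -2!big_split/=.
    by apply: eq_bigr => i _; rewrite /sqdev /dev/=; ring.
  by field; rewrite gt_eqF.
have cM : mean_of X n w @[n --> \oo] --> mu.
  rewrite -[X in _ --> X](add0r mu).
  have : partial_sum (dev X mu) n w / n%:R + mu @[n --> \oo] --> 0 + mu.
    by apply: cvgD => //; exact: cvg_cst.
  move=> h; apply: cvg_trans h; apply: near_eq_cvg; near=> n.
  have n0 : (0 < n)%N by near: n; exact: nbhs_infty_gt.
  by rewrite -mean_of_dev// subrK.
split => //.
have : partial_sum (sqdev X mu) n w / n%:R - (mean_of X n w - mu) * (mean_of X n w - mu) @[n --> \oo] -->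
    nu - (mu - mu) * (mu - mu).
  apply: cvgB => //.
  by apply: cvgM; (apply: cvgB; [exact: cM|exact: cvg_cst]).
rewrite subrr mulr0 subr0.
move=> h; apply: cvg_trans h; apply: near_eq_cvg; near=> n.
have n0 : (0 < n)%N by near: n; exact: nbhs_infty_gt.
by rewrite (sample_varE X mu w n0) expr2.
Unshelve. all: by end_near. Qed.

Lemma clt_mean (a e : R) : 0 < e -> \forall n \near \oo,
  (P [set w | ((mean_of X n w - mu) * Num.sqrt (n%:R / nu) <= a)%R] <= (Phi a + e)%:E)%E /\
  ((Phi a - e)%:E <= P [set w | ((mean_of X n w - mu) * Num.sqrt (n%:R / nu) < a)%R])%E.
Proof.
move=> e0; have [b3 h3] := sample_abs_moment3 X_iid X0_moment6 X0_mean X0_var 0.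
have A := clt_upper iid_dev dev1 dev2 h3 nu_gt0 a e0.
have B := clt_lower iid_dev dev1 dev2 h3 nu_gt0 a e0.
near=> n.
have n0 : (0 < n)%N by near: n; exact: nbhs_infty_gt.
have n1 : (0 : R) < n%:R by rewrite ltr0n.
have SE w : (mean_of X n w - mu) * Num.sqrt (n%:R / nu) =
    partial_sum (dev X mu) n w / (Num.sqrt nu * Num.sqrt n%:R).
  rewrite mean_of_dev// sqrtrM ?ler0n// sqrtrV ?ltW//.
  have q0 : 0 < Num.sqrt (n%:R : R) by rewrite sqrtr_gt0.
  have q1 : 0 < Num.sqrt nu by rewrite sqrtr_gt0.
  by rewrite -{1}[n%:R]sqr_sqrtr ?ler0n//; field; rewrite !gt_eqF.
split.
- under eq_set do rewrite SE.
  by near: n.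
- under eq_set do rewrite SE.
  by near: n.
Unshelve. all: by end_near. Qed.

End sample_limits.

(** * The multistage scheme *)

Section limits_from_bounds.
Context {R : realType}.
Local Notation F := ((0 : R)^'+).
Implicit Types (f : R -> \bar R) (v : R).

Lemma limf_einf_ge f v : (forall e : R, 0 < e -> \forall x \near F, ((v - e)%:E <= f x)%E) ->
  (v%:E <= limf_einf f F)%E.
Proof.
move=> fv; rewrite limf_einfE; apply/lee_subgt0Pr => e e0.
apply: le_trans (ereal_sup_ubound _); last first.
  by exists [set x | ((v - e)%:E <= f x)%E]; [exact: fv|reflexivity].
by apply: le_ereal_inf_tmp => _ [x /= h <-]; rewrite -EFinB.
Qed.

Lemma limf_esup_le f v : (forall e : R, 0 < e -> \forall x \near F, (f x <= (v + e)%:E)%E) ->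
  (limf_esup f F <= v%:E)%E.
Proof.
move=> fv; rewrite limf_esupE; apply/lee_addgt0Pr => e e0.
apply: le_trans (ereal_inf_lbound _) _.
  by exists [set x | (f x <= (v + e)%:E)%E]; [exact: fv|reflexivity].
by apply: ge_ereal_sup => _ [x /= h <-]; rewrite -EFinD.
Qed.

Lemma limf_einf_le_esup f : (limf_einf f F <= limf_esup f F)%E.
Proof.
rewrite limf_einfE limf_esupE; apply: ge_ereal_sup => _ [A FA <-].
apply: le_ereal_inf_tmp => _ [B FB <-].
have [x [Ax Bx]] := filter_ex (filterI FA FB).
by apply: (@le_trans _ _ (f x)); [apply: ereal_inf_lbound|apply: ereal_sup_ubound]; exists x.
Qed.

Lemma cvge_from_bounds f v : (forall e : R, 0 < e -> \forall x \near F,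
  ((v - e)%:E <= f x <= (v + e)%:E)%E) -> f x @[x --> F] --> v%:E.
Proof.
move=> fv; apply/fine_cvgP; split.
  near=> x.
  have /andP[l u] : ((v - 1)%:E <= f x <= (v + 1)%:E)%E by near: x; exact: fv.
  by move: l u; case: (f x).
apply/cvgrPdist_le => e e0; near=> x.
have : ((v - e)%:E <= f x <= (v + e)%:E)%E by near: x; exact: fv.
move=> /andP[l u]; have ffin : f x = (fine (f x))%:E by case: (f x) l u.
by rewrite ffin lee_fin in l; rewrite ffin lee_fin in u; rewrite /= ler_distlC l u.
Unshelve. all: by end_near. Qed.

Lemma cvge_lower f v (e : R) : f x @[x --> F] --> v%:E -> 0 < e ->
  \forall x \near F, ((v - e)%:E <= f x)%E.
Proof.
move=> /fine_cvgP[fin /cvgrPdist_le h] e0; near=> x.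
have ff : f x \is a fin_num by near: x; exact: fin.
have : `|v - (fine \o f) x| <= e by near: x; exact: h.
by rewrite /= ler_distlC => /andP[lo _]; rewrite -(fineK ff) lee_fin.
Unshelve. all: by end_near. Qed.

End limits_from_bounds.

(** * Neighbourhoods, growth ratios and perturbed thresholds *)

Section margins.
Context {R : realType}.

Lemma joint_limit_near (F : R * R -> R) (mu k : R) :
  F @ filter_prod (nbhs mu) (0 : R)^'+ --> k -> forall e, 0 < e ->
  exists2 r, 0 < r & forall z eps, `|z - mu| < r -> 0 < eps -> eps < r -> `|F (z, eps) - k| < e.
Proof.
move=> Fk e e0; have := Fk _ (nbhsx_ballx k e e0) => -[[A B] /= [nA nB] AB].
move: nA => /nbhs_ballP[r1 /= r10 h1].
move: nB => [r2 /= r20 h2].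
exists (Num.min r1 r2); first by rewrite lt_min r10.
move=> z eps; rewrite lt_min => /andP[z1 _] eps0; rewrite lt_min => /andP[_ e2].
have := AB (z, eps); rewrite /ball/= distrC; apply; split => /=.
  by apply: h1; rewrite /ball/= distrC.
by apply: h2 => //; rewrite /ball/= sub0r normrN gtr0_norm.
Qed.

Lemma ratio_supP (u : int -> R) : (forall l, 0 < u l) -> (ratio_sup u < +oo)%E ->
  exists2 g, 0 < g & forall l, 1 <= l -> u (l + 1) <= g * u l.
Proof.
move=> u0 ug; have ub l : 1 <= l -> ((u (l + 1) / u l)%:E <= ratio_sup u)%E.
  by move=> l1; apply: ereal_sup_ubound; exists l.
(* The ratio at stage 1 shows that the supremum is not [-oo]. *)
have u11 := ub 1 (lexx 1).
move: ub ug u11; case: (ratio_sup u) => // g ub _ u11.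
exists g.
  by apply: lt_le_trans (divr_gt0 (u0 (1 + 1)) (u0 1)) _; rewrite -lee_fin.
by move=> l l1; rewrite -ler_pdivrMr// -lee_fin ub.
Qed.

Lemma ratio_infP (u : int -> R) : (forall l, 0 < u l) -> (1 < ratio_inf u)%E ->
  exists2 q, 1 < q & forall l, 1 <= l -> q * u l <= u (l + 1).
Proof.
move=> u0 ug; have ub l : 1 <= l -> (ratio_inf u <= (u (l + 1) / u l)%:E)%E.
  by move=> l1; apply: ereal_inf_lbound; exists l.
have u11 := ub 1 (lexx 1).
move: ub ug u11; case: (ratio_inf u) => // g ub g1 u11.
by exists g => // l l1; rewrite -ler_pdivlMr// -lee_fin ub.
Qed.

(** A single slack [t] serves as the relative error of the sample sizes and as the error of the
    normalised margins. *)
Lemma perturbed_square (k c1 c2 : R) : 0 < k -> c1 < k ^+ 2 < c2 ->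
  exists t, [/\ 0 < t, t < k, t <= 1, c1 <= (1 - t) * (k - t) ^+ 2
    & (1 + t) * (k + t) ^+ 2 <= c2].
Proof.
(* For [0 < t <= 1], both [(1 + t) (k + t)^2] and [(1 - t) (k - t)^2] differ from [k^2] by at most
   [t * M]. *)
move=> k0 /andP[h1 h2]; pose M := k ^+ 2 + 4 * k + 2.
have M0 : 0 < M by rewrite /M; nra.
pose t := Num.min (Num.min 1 (k / 2)) (Num.min ((k ^+ 2 - c1) / M) ((c2 - k ^+ 2) / M)).
have t0 : 0 < t by rewrite !lt_min ltr01 !divr_gt0 ?subr_gt0.
have : t <= t by []; rewrite {2}/t !le_min => /andP[/andP[t1 tk] /andP[ta tb]].
rewrite ler_pdivlMr// in ta; rewrite ler_pdivlMr// in tb.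
have t3 : 0 <= t * (1 - t) by apply: mulr_ge0; [exact: ltW|rewrite subr_ge0].
have t2 : 0 <= t * (t * (1 - t)) by apply: mulr_ge0 => //; exact: ltW.
have t4 : 0 <= k * (t * (1 - t)) by apply: mulr_ge0 => //; exact: ltW.
have t5 : 0 < k * t by rewrite mulr_gt0.
have t6 : 0 < k * t ^+ 2 by rewrite mulr_gt0 ?exprn_gt0.
exists t; split => //.
- by lra.
- by rewrite /M in ta tb; nra.
- by rewrite /M in ta tb; nra.
Qed.

End margins.

Section scheme.
Context {R : realType} (S : scheme R) (C : int -> R) (k mu nu : R).
Hypotheses
  (k_gt0 : 0 < k)
  (nu_gt0 : 0 < nu)
  (scrL_lim : (fun p : R * R => (p.1 - scrL S p.1 p.2) / p.2)
     @ filter_prod (nbhs mu) (0 : R)^'+ --> k)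
  (scrU_lim : (fun p : R * R => (scrU S p.1 p.2 - p.1) / p.2)
     @ filter_prod (nbhs mu) (0 : R)^'+ --> k)
  (calL_lim : (fun p : R * R => (p.1 - calL S p.1 p.2) / p.2)
     @ filter_prod (nbhs mu) (0 : R)^'+ --> k)
  (calU_lim : (fun p : R * R => (calU S p.1 p.2 - p.1) / p.2)
     @ filter_prod (nbhs mu) (0 : R)^'+ --> k)
  (C_gt0 : forall l, 0 < C l)
  (C_incr : forall k l : int, k < l -> C k < C l)
  (dlt01 : forall l, 0 < dlt S l < 1)
  (dlt_noninc : forall k l : int, k <= l -> dlt S l <= dlt S k)
  (rho_ge0 : 0 <= rho S)
  (tau_lim : (tau S eps)%:~R @[eps --> 0^'+] --> (1 : R))
  (ssize_gt0 : forall (eps : R) (l : int), 0 < eps -> tau S eps <= l -> (0 < ssize S eps l)%N)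
  (ssize_unif : forall e : R, 0 < e -> \forall eps \near 0^'+,
     forall l : int, 1 <= l ->
       `|eps ^+ 2 * (ssize S eps l)%:R / (C l * Upsilon S l) - 1| < e).

(** * Sample sizes and test thresholds for small [eps] *)

Lemma C_le (a b : int) : a <= b -> C a <= C b.
Proof. by rewrite le_eqVlt => /orP[/eqP->//|/C_incr/ltW]. Qed.

Lemma Upsilon_gt0 l : 0 < Upsilon S l.
Proof.
have /andP[h0 h1] := dlt01 l.
by rewrite /Upsilon ln_gt0// div1r invf_gt1.
Qed.

Lemma Upsilon_le (a b : int) : a <= b -> Upsilon S a <= Upsilon S b.
Proof.
move=> /dlt_noninc h; have /andP[ha _] := dlt01 a; have /andP[hb _] := dlt01 b.
by rewrite /Upsilon !div1r ler_ln ?posrE ?invr_gt0// lef_pV2.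
Qed.

Lemma tau_eq1 : \forall eps \near (0 : R)^'+, tau S eps = 1.
Proof.
have h : \forall eps \near (0 : R)^'+, `|1 - (tau S eps)%:~R| < 1 :> R.
  by move/cvgrPdist_lt : tau_lim; apply.
near=> eps; have : `|1 - (tau S eps)%:~R| < 1 :> R by near: eps.
rewrite -(intrB R 1) -intr_norm -[X in _ < X]/(1%:~R) ltr_int; lia.
Unshelve. all: by end_near. Qed.

Lemma size_near e : 0 < e -> \forall eps \near (0 : R)^'+, forall l, 1 <= l ->
  (1 - e) * C l <= eps ^+ 2 * (ssize S eps l)%:R / Upsilon S l <= (1 + e) * C l.
Proof.
move=> /ssize_unif h; near=> eps => l l1.
have : `|eps ^+ 2 * (ssize S eps l)%:R / (C l * Upsilon S l) - 1| < e.
  by move: l l1; near: eps.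
move=> /ltW; rewrite ler_distl.
rewrite (_ : eps ^+ 2 * _ / _ = eps ^+ 2 * (ssize S eps l)%:R / Upsilon S l / C l); last first.
  by field; rewrite !gt_eqF ?Upsilon_gt0.
by rewrite ler_pdivlMr// ler_pdivrMr.
Unshelve. all: by end_near. Qed.

Lemma size_ge_near : \forall eps \near (0 : R)^'+, forall l, 1 <= l ->
  C 1 * Upsilon S 1 / (2 * eps ^+ 2) <= (ssize S eps l)%:R.
Proof.
near=> eps => l l1.
have eps0 : 0 < eps by near: eps; exact: nbhs_right_gt.
have : (1 - 2^-1) * C l <= eps ^+ 2 * (ssize S eps l)%:R / Upsilon S l <= (1 + 2^-1) * C l.
  by move: l l1; near: eps; apply: size_near; rewrite invr_gt0.
move=> /andP[h _]; rewrite ler_pdivlMr ?Upsilon_gt0// in h.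
rewrite ler_pdivrMr ?mulr_gt0 ?exprn_gt0//.
have : C 1 * Upsilon S 1 <= C l * Upsilon S l.
  by apply: ler_pM; [exact: ltW|exact/ltW/Upsilon_gt0|exact: C_le|exact: Upsilon_le].
by have := C_gt0 l; nra.
Unshelve. all: by end_near. Qed.

Lemma size_infty (M : R) : \forall eps \near (0 : R)^'+, forall l, 1 <= l ->
  M <= (ssize S eps l)%:R.
Proof.
have [M0|M0] := leP M 0; first by near=> eps => l _; rewrite (le_trans M0).
have c0 : 0 < C 1 * Upsilon S 1 by rewrite mulr_gt0 ?Upsilon_gt0.
near=> eps => l l1.
have eps0 : 0 < eps by near: eps; exact: nbhs_right_gt.
have eps1 : eps <= 1 by near: eps; apply: nbhs_right_le.
have epsM : eps <= C 1 * Upsilon S 1 / (2 * M).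
  by near: eps; apply: nbhs_right_le; rewrite divr_gt0// mulr_gt0.
apply: le_trans (_ : C 1 * Upsilon S 1 / (2 * eps ^+ 2) <= _); last first.
  by move: l l1; near: eps; exact: size_ge_near.
rewrite ler_pdivlMr ?mulr_gt0 ?exprn_gt0//; rewrite ler_pdivlMr ?mulr_gt0// in epsM.
have : eps ^+ 2 * M <= eps * M by rewrite ler_pM2r// expr2 ler_piMl// ltW.
by nra.
Unshelve. all: by end_near. Qed.

(** The powers of [eps] cancel: [n_l / Upsilon_l] is about [C_l / eps^2] and the squared margins are
    about [k^2 eps^2]. Neither approximation deteriorates with [l], so [eps] can be chosen for all
    stages at once. *)
Lemma decision_bounds (c1 c2 : R) : c1 < k ^+ 2 < c2 -> exists2 r, 0 < r &
  \forall eps \near (0 : R)^'+, forall (l : int) (z : R), 1 <= l -> `|z - mu| < r ->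
  c1 * C l <= (ssize S eps l)%:R / Upsilon S l *
    Num.min ((scrU S z eps - z) ^+ 2) ((scrL S z eps - z) ^+ 2) <= c2 * C l.
Proof.
move=> c12; have [t [t0 tk t1 tc1 tc2]] := perturbed_square k_gt0 c12.
have [r1 r10 h1] := joint_limit_near scrL_lim t0.
have [r2 r20 h2] := joint_limit_near scrU_lim t0.
exists (Num.min r1 r2); first by rewrite lt_min r10.
near=> eps => l z l1; rewrite lt_min => /andP[z1 z2].
have eps0 : 0 < eps by near: eps; exact: nbhs_right_gt.
have e1 : eps < r1 by near: eps; exact: nbhs_right_lt.
have e2 : eps < r2 by near: eps; exact: nbhs_right_lt.
have : (1 - t) * C l <= eps ^+ 2 * (ssize S eps l)%:R / Upsilon S l <= (1 + t) * C l.
  by move: l l1; near: eps; exact: size_near.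
have sq_bounds (x : R) : `|x / eps - k| < t ->
    (k - t) ^+ 2 * eps ^+ 2 <= x ^+ 2 <= (k + t) ^+ 2 * eps ^+ 2.
  move=> /ltW; rewrite ler_distl ler_pdivlMr// ler_pdivrMr// => /andP[xl xu].
  have xl0 : 0 <= (k - t) * eps by rewrite mulr_ge0 ?subr_ge0 ?ltW.
  by rewrite -!exprMn !ler_pXn2r// ?nnegrE ?xl ?xu//;
    rewrite ?mulr_ge0 ?addr_ge0 ?ltW//; nra.
have /= /andP[Ll Lu] := sq_bounds _ (h1 z eps z1 eps0 e1).
have /= /andP[Ul Uu] := sq_bounds _ (h2 z eps z2 eps0 e2).
set A := Num.min _ _.
have Al : (k - t) ^+ 2 * eps ^+ 2 <= A by rewrite le_min Ul -[leRHS]sqrrN opprB Ll.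
have Au : A <= (k + t) ^+ 2 * eps ^+ 2 by rewrite ge_min Uu.
have Ug := Upsilon_gt0 l.
set m := (ssize S eps l)%:R; have m0 : 0 <= m / Upsilon S l by rewrite divr_ge0 ?ler0n// ltW.
rewrite (_ : eps ^+ 2 * m / _ = m / Upsilon S l * eps ^+ 2); last by ring.
move=> /andP[sl su]; have Cl := C_gt0 l.
apply/andP; split.
  apply: le_trans (_ : (k - t) ^+ 2 * ((1 - t) * C l) <= _).
    by rewrite mulrA ler_pM2r// mulrC.
  apply: le_trans (_ : (k - t) ^+ 2 * (m / Upsilon S l * eps ^+ 2) <= _).
    by apply: ler_wpM2l; [exact: sqr_ge0|exact: sl].
  by rewrite mulrCA; apply: ler_wpM2l.
apply: le_trans (_ : (k + t) ^+ 2 * ((1 + t) * C l) <= _); last first.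
  by rewrite mulrA ler_pM2r// mulrC.
apply: le_trans (_ : (k + t) ^+ 2 * (m / Upsilon S l * eps ^+ 2) <= _); last first.
  by apply: ler_wpM2l; [exact: sqr_ge0|exact: su].
by rewrite mulrCA; apply: ler_wpM2l.
Unshelve. all: by end_near. Qed.

(** * Decision probabilities of a single stage *)

Context d (T : measurableType d) (P : probability T R).
Variables (X0 : {RV P >-> R}) (X : nat -> {RV P >-> R}).
Hypotheses
  (scrL_cont : forall z eps : R, 0 < eps ->
     {for (z, eps), continuous (fun p : R * R => scrL S p.1 p.2)})
  (scrU_cont : forall z eps : R, 0 < eps ->
     {for (z, eps), continuous (fun p : R * R => scrU S p.1 p.2)})
  (calL_meas : forall eps : R, 0 < eps -> measurable_fun setT (fun z => calL S z eps))
  (calU_meas : forall eps : R, 0 < eps -> measurable_fun setT (fun z => calU S z eps))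
  (X_iid : iid_samples_of X0 X)
  (X0_moment6 : ('E_P[(fun w => `|X0 w| ^+ 6)%R] < +oo)%E)
  (X0_mean : 'E_P[X0]%E = mu%:E)
  (X0_var : 'V_P[X0]%E = nu%:E).

Let continuous_partial (f : R -> R -> R) eps : 0 < eps ->
  (forall z eps : R, 0 < eps -> {for (z, eps), continuous (fun p : R * R => f p.1 p.2)}) ->
  measurable_fun setT (fun z => f z eps).
Proof.
move=> eps0 fc; apply: continuous_measurable_fun => z.
have h := fc z eps eps0.
apply: (@cvg_comp _ _ _ (fun z => (z, eps)) (fun p : R * R => f p.1 p.2) _ (nbhs (z, eps))) => //.
exact: (cvg_pair cvg_id (cvg_cst eps)).
Qed.

Lemma measurable_decided eps l : 0 < eps -> measurable (decided S X eps l).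
Proof.
move=> eps0; rewrite /decided /D; case: (tau S eps <= l) => /=; last first.
  by rewrite (_ : [set _ | _] = set0)//; apply/seteqP; split.
have mL := continuous_partial eps0 scrL_cont.
have mU := continuous_partial eps0 scrU_cont.
have mZ : measurable_fun setT (Z S X eps l) by exact: measurable_mean_of.
have mc (f : R -> R) : measurable_fun setT f ->
    measurable_fun setT (fun w => (f (Z S X eps l w) - Z S X eps l w) ^+ 2).
  move=> mf; apply: measurable_funX; apply: measurable_funB => //.
  exact: (measurableT_comp mf).
rewrite -[X in measurable X]setTI; apply: measurable_fun_le => //; first by apply: measurable_funD => //; exact: measurable_sample_var.
by apply: measurable_funM => //; apply: measurable_minr;
  [exact: (mc (fun z => scrU S z eps))|exact: (mc (fun z => scrL S z eps))].
Qed.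

Lemma stage_coveredE eps l : stage_covered S X eps mu l =
  [set w | calL S (Z S X eps l w) eps < mu] `&` [set w | mu < calU S (Z S X eps l w) eps].
Proof.
by apply/seteqP; split => w; rewrite /stage_covered /stage_interval/= in_itv/= => /andP//.
Qed.

Lemma measurable_stage_covered eps l : 0 < eps -> measurable (stage_covered S X eps mu l).
Proof.
move=> eps0; rewrite stage_coveredE.
have mZ : measurable_fun setT (Z S X eps l) by exact: measurable_mean_of.
apply: measurableI; apply: measurable_lt => //.
- by apply: (measurableT_comp (calL_meas eps0)).
- by apply: (measurableT_comp (calU_meas eps0)).
Qed.

Let far_mean n r := [set w | r <= `|mean_of X n w - mu|].
Let far_var n t := [set w | t <= `|partial_sum (sqdev X mu) n w / n%:R - nu|].

Let mfar_mean n r : measurable (far_mean n r).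
Proof.
apply: measurable_le => //; apply: measurableT_comp => //; apply: measurable_funB => //.
exact: measurable_mean_of.
Qed.

Let mfar_var n r : measurable (far_var n r).
Proof.
apply: measurable_le => //; apply: measurableT_comp => //; apply: measurable_funB => //.
apply: measurable_funM => //; apply: measurable_sum => i.
by apply: measurable_funX; apply: measurable_funB => //; exact: measurable_funPT.
Qed.

Let far_tails : exists2 K : R, 0 <= K & forall n r t, (0 < n)%N -> 0 < r -> 0 < t ->
  (P (far_mean n r `|` far_var n t) <=
   (K / n%:R * ((n%:R * r ^+ 4)^-1 + (t ^+ 2)^-1))%:E)%E.
Proof.
have [K1 K10 h1] := mean_tail X_iid X0_moment6 X0_mean X0_var.
have [K2 K20 h2] := square_tail X_iid X0_moment6 X0_mean X0_var.
exists (K1 + K2); first exact: addr_ge0.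
move=> n r t n0 r0 t0; have n1 : (0 : R) < n%:R by rewrite ltr0n.
apply: le_trans (measureU2 _ _ _) _ => //.
apply: le_trans (leeD (h1 n r n0 r0) (h2 n t n0 t0)) _.
rewrite -EFinD lee_fin -subr_ge0.
rewrite (_ : _ - _ = K2 / (n%:R ^+ 2 * r ^+ 4) + K1 / (n%:R * t ^+ 2)); last first.
  by field; rewrite !gt_eqF.
by rewrite addr_ge0// divr_ge0// ltW// mulr_gt0// exprn_gt0.
Qed.

Let size_infty_at l (M : R) : 1 <= l -> \forall eps \near (0 : R)^'+,
  M <= (ssize S eps l)%:R.
Proof. by move=> l1; apply: filterS (size_infty M) => eps; apply. Qed.

Let size_pos : \forall eps \near (0 : R)^'+, forall l, 1 <= l -> (0 < ssize S eps l)%N.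
Proof. by apply: filterS (size_infty 1) => eps h l l1; have := h l l1; rewrite ler1n. Qed.

Let size_pos_at l : 1 <= l -> \forall eps \near (0 : R)^'+, (0 < ssize S eps l)%N.
Proof. by move=> l1; apply: filterS size_pos => eps; apply. Qed.

(** The threshold grows like [C l] while [nu] is fixed, so the tolerated excess of the variance is
    [C l * g] rather than a constant. *)
Lemma decided_when_close (j : int) : 1 <= j -> nu < k ^+ 2 * C j ->
  exists2 g : R, 0 < g & \forall eps \near (0 : R)^'+, forall l w, j <= l ->
  `|Z S X eps l w - mu| < g -> W S X eps l w <= nu + C l * g -> D S X eps l w.
Proof.
move=> j1 hj; have Cj := C_gt0 j.
have hj' : nu / C j < k ^+ 2 by rewrite ltr_pdivrMr.
(* [c1 = nu / C j + 2 th]: one [th] is spent on the excess of the variance, the other on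
   [rho / n_l]. *)
pose c1 := (nu / C j + k ^+ 2) / 2; pose th := (c1 - nu / C j) / 2.
have th0 : 0 < th by rewrite /th /c1; lra.
have [|r r0 hr] := @decision_bounds c1 (k ^+ 2 + 1); first by rewrite /c1; lra.
exists (Num.min r th); first by rewrite lt_min r0.
near=> eps => l w jl; have l1 := le_trans j1 jl; have Cl := C_gt0 l.
rewrite lt_min => /andP[zr _] Wup.
have t1 : tau S eps = 1 by near: eps; exact: tau_eq1.
have dec : forall (l : int) (z : R), 1 <= l -> `|z - mu| < r ->
    c1 * C l <= (ssize S eps l)%:R / Upsilon S l *
    Num.min ((scrU S z eps - z) ^+ 2) ((scrL S z eps - z) ^+ 2) <= (k ^+ 2 + 1) * C l.
  by near: eps; exact: hr.
have n1 : forall l : int, 1 <= l -> rho S / (C 1 * th) <= (ssize S eps l)%:R.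
  by near: eps; exact: size_infty.
have n0 : forall l : int, 1 <= l -> (0 < ssize S eps l)%N by near: eps; exact: size_pos.
rewrite /D t1 l1 /=; have /andP[lo _] := dec l _ l1 zr; apply: le_trans lo.
have rn : rho S / (ssize S eps l)%:R <= C l * th.
  apply: (@le_trans _ _ (C 1 * th)); last by rewrite ler_pM2r// C_le.
  by rewrite ler_pdivrMr ?ltr0n ?n0// mulrC -ler_pdivrMr ?(mulr_gt0 (C_gt0 1) th0)// n1.
have nuC : nu <= nu / C j * C l.
  by rewrite mulrAC -mulrA ler_peMr ?(ltW nu_gt0)// ler_pdivlMr// mul1r C_le.
have gth : C l * Num.min r th <= C l * th by rewrite ler_pM2l// ge_min lexx orbT.
apply: le_trans (lerD Wup rn) _; rewrite (_ : c1 = nu / C j + 2 * th); last by rewrite /th; field; rewrite gt_eqF.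
by rewrite mulrDl; lra.
Unshelve. all: by end_near. Qed.

Lemma undecided_when_close (l : int) : 1 <= l -> k ^+ 2 * C l < nu ->
  exists2 g : R, 0 < g & \forall eps \near (0 : R)^'+, forall w,
  `|Z S X eps l w - mu| < g -> nu - g < W S X eps l w -> ~~ D S X eps l w.
Proof.
move=> l1 hl; have Cl := C_gt0 l.
have hl' : k ^+ 2 < nu / C l by rewrite ltr_pdivlMr.
pose c2 := (nu / C l + k ^+ 2) / 2; pose g := nu - c2 * C l.
have g0 : 0 < g by rewrite /g subr_gt0 -ltr_pdivlMr// /c2; lra.
have [|r r0 hr] := @decision_bounds (k ^+ 2 - 1) c2; first by rewrite /c2; lra.
exists (Num.min r g); first by rewrite lt_min r0.
near=> eps => w; rewrite lt_min => /andP[zr _] Wlo.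
have t1 : tau S eps = 1 by near: eps; exact: tau_eq1.
have dec : forall (l : int) (z : R), 1 <= l -> `|z - mu| < r ->
    (k ^+ 2 - 1) * C l <= (ssize S eps l)%:R / Upsilon S l *
    Num.min ((scrU S z eps - z) ^+ 2) ((scrL S z eps - z) ^+ 2) <= c2 * C l.
  by near: eps; exact: hr.
rewrite /D t1 l1 /= -ltNge; have /andP[_ up] := dec l _ l1 zr; apply: le_lt_trans up _.
have rn : 0 <= rho S / (ssize S eps l)%:R by rewrite divr_ge0.
have : Num.min r g <= g by rewrite ge_min lexx orbT.
rewrite {2}/g; lra.
Unshelve. all: by end_near. Qed.

Let WE eps l w : (0 < ssize S eps l)%N -> W S X eps l w =
  partial_sum (sqdev X mu) (ssize S eps l) w / (ssize S eps l)%:R - (Z S X eps l w - mu) ^+ 2.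
Proof. exact: sample_varE. Qed.

Let mundecided eps l : 0 < eps -> measurable (undecided S X eps l).
Proof.
move=> eps0; rewrite (_ : undecided _ _ _ _ = ~` decided S X eps l).
  by apply: measurableC; exact: measurable_decided.
by apply/seteqP; split => w /= /negP.
Qed.

(** Failing to decide forces the mean to be off by [g], at order four [O(n^-2)], or the mean square
    to exceed [nu] by [C l * g], at order two [O(n^-1 (C l)^-2)]. *)
Lemma undecided_le (j : int) : 1 <= j -> nu < k ^+ 2 * C j ->
  exists2 A : R, 0 <= A & \forall eps \near (0 : R)^'+, forall l, j <= l ->
  (P (undecided S X eps l) <= (A / (ssize S eps l)%:R *
     ((ssize S eps l)%:R^-1 + (C l ^+ 2)^-1))%:E)%E.
Proof.
move=> j1 hj; have [K K0 hK] := far_tails; have [g g0 hg] := decided_when_close j1 hj.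
exists (K * ((g ^+ 4)^-1 + (g ^+ 2)^-1)).
  by rewrite mulr_ge0// addr_ge0// invr_ge0 exprn_ge0// ltW.
near=> eps => l jl; have l1 := le_trans j1 jl; have Cl := C_gt0 l.
have eps0 : 0 < eps by near: eps; exact: nbhs_right_gt.
have n0 : forall l : int, 1 <= l -> (0 < ssize S eps l)%N by near: eps; exact: size_pos.
have dec : forall l w, j <= l -> `|Z S X eps l w - mu| < g ->
    W S X eps l w <= nu + C l * g -> D S X eps l w by near: eps; exact: hg.
have n1 : (0 : R) < (ssize S eps l)%:R by rewrite ltr0n n0.
pose F := far_mean (ssize S eps l) g `|` far_var (ssize S eps l) (C l * g).
apply: le_trans (_ : P F <= _)%E.
  apply: le_measure; rewrite ?inE; [exact: mundecided|exact: measurableU|].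
  move=> w und; have [|zr] := leP g `|Z S X eps l w - mu|; [by left|right].
  have := contraNN (dec l w jl zr) und; rewrite -ltNge WE ?n0// => h.
  have := sqr_ge0 (Z S X eps l w - mu).
  by rewrite /far_var /= ler_normr; set x := _ / _ in h * => h0; apply/orP; left; lra.
have Clg : 0 < C l * g by rewrite mulr_gt0.
apply: le_trans (hK _ _ _ (n0 l l1) g0 Clg) _; rewrite lee_fin -subr_ge0.
set n := (ssize S eps l)%:R in n1 *.
rewrite (_ : _ - _ = K / n * ((g ^+ 2)^-1 / n + (g ^+ 4)^-1 * (C l ^+ 2)^-1)); last first.
  by field; rewrite !gt_eqF.
by rewrite !(mulr_ge0, addr_ge0)// ?invr_ge0 ?exprn_ge0// ltW.
Unshelve. all: by end_near. Qed.

Let far_to0 l r t e : 1 <= l -> 0 < r -> 0 < t -> 0 < e -> \forall eps \near (0 : R)^'+,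
  (P (far_mean (ssize S eps l) r `|` far_var (ssize S eps l) t) <= e%:E)%E.
Proof.
move=> l1 r0 t0 e0; have [K K0 hK] := far_tails.
pose B := K * ((r ^+ 4)^-1 + (t ^+ 2)^-1).
near=> eps.
have n0 : (0 < ssize S eps l)%N by near: eps; exact: size_pos_at.
have np : (0 : R) < (ssize S eps l)%:R by rewrite ltr0n.
apply: le_trans (hK _ _ _ n0 r0 t0) _; rewrite lee_fin.
apply: (@le_trans _ _ (B / (ssize S eps l)%:R)).
  rewrite /B -mulrA -[leRHS]mulrA ler_wpM2l// mulrC ler_pM2r ?invr_gt0//.
  rewrite lerD2r lef_pV2 ?posrE ?mulr_gt0 ?exprn_gt0//.
  by rewrite ler_peMl ?ler1n// exprn_ge0// ltW.
by rewrite ler_pdivrMr// mulrC -ler_pdivrMr//; near: eps; exact: size_infty_at.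
Unshelve. all: by end_near. Qed.

Lemma decided_to0 (l : int) : 1 <= l -> k ^+ 2 * C l < nu -> forall e : R, 0 < e ->
  \forall eps \near (0 : R)^'+, (P (decided S X eps l) <= e%:E)%E.
Proof.
move=> l1 hl e e0; have [g g0 hg] := undecided_when_close l1 hl.
have g20 : 0 < g / 2 by rewrite divr_gt0.
(* A mean within [r] has squared error at most [g / 2], which leaves [g / 2] for the deviation of
   the mean square. *)
pose r := Num.min g (Num.min 1 (g / 2)).
have r0 : 0 < r by rewrite !lt_min g0 ltr01 g20.
near=> eps.
have eps0 : 0 < eps by near: eps; exact: nbhs_right_gt.
have n0 : (0 < ssize S eps l)%N by near: eps; exact: size_pos_at.
have und : forall w, `|Z S X eps l w - mu| < g -> nu - g < W S X eps l w ->
  ~~ D S X eps l w by near: eps; exact: hg.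
have PF : (P (far_mean (ssize S eps l) r `|` far_var (ssize S eps l) (g / 2)%R) <= e%:E)%E.
  by near: eps; exact: far_to0.
apply: le_trans PF; apply: le_measure; rewrite ?inE; [exact: measurable_decided|exact: measurableU|].
move=> w dec; have [|] := leP r `|Z S X eps l w - mu|; [by left|].
rewrite !lt_min => /andP[zg /andP[z1 z2]]; right.
have := contraTN (und w zg) dec; rewrite -leNgt WE//; set x := _ / _ => h.
have : (Z S X eps l w - mu) ^+ 2 <= g / 2.
  rewrite -real_normK ?num_real// expr2 (le_trans _ (ltW z2))//.
  by rewrite ler_piMl// ltW.
by rewrite /far_var /= ler_normr -/x => h1; apply/orP; right; lra.
Unshelve. all: by end_near. Qed.

(** * Summability over the late stages *)

Hypotheses (C_ratio_inf : (1 < ratio_inf C)%E) (C_ratio_sup : (ratio_sup C < +oo)%E)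
  (Upsilon_ratio_sup : (ratio_sup (Upsilon S) < +oo)%E).

Let size_next : exists2 G : R, 0 < G & \forall eps \near (0 : R)^'+, forall l, 1 <= l ->
  (ssize S eps (l + 1))%:R <= G * (ssize S eps l)%:R.
Proof.
have [g1 g10 h1] := ratio_supP C_gt0 C_ratio_sup.
have [g2 g20 h2] := ratio_supP Upsilon_gt0 Upsilon_ratio_sup.
(* The factor 3 is [(1 + 1/2) / (1 - 1/2)], from a relative error of one half in both sizes. *)
exists (3 * (g1 * g2)); first by rewrite !mulr_gt0.
near=> eps => l l1.
have eps0 : 0 < eps ^+ 2 by rewrite exprn_gt0//; near: eps; exact: nbhs_right_gt.
have sz : forall l, 1 <= l -> (1 - 2^-1) * C l <=
    eps ^+ 2 * (ssize S eps l)%:R / Upsilon S l <= (1 + 2^-1) * C l.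
  by near: eps; apply: size_near; rewrite invr_gt0.
have /andP[lo _] := sz l l1.
have /andP[_ up] := sz (l + 1) (le_trans l1 (lerDl l 1 : l <= l + 1)).
rewrite ler_pdivlMr ?Upsilon_gt0// in lo; rewrite ler_pdivrMr ?Upsilon_gt0// in up.
rewrite -(ler_pM2l eps0); apply: le_trans up _.
rewrite mulrCA; apply: le_trans (_ : (3 * (g1 * g2)) * ((1 - 2^-1) * C l * Upsilon S l) <= _).
  have := ler_pM (ltW (C_gt0 (l + 1))) (ltW (Upsilon_gt0 (l + 1))) (h1 l l1) (h2 l l1); lra.
by rewrite ler_pM2l ?mulr_gt0.
Unshelve. all: by end_near. Qed.

Lemma C_geometric (j : int) : 1 <= j -> exists2 q : R, 0 <= q < 1 & forall m : nat,
  (C (j + m%:Z))^-1 <= q ^+ m / C j.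
Proof.
move=> j1; have [q q1 hq] := ratio_infP C_gt0 C_ratio_inf.
have q0 : 0 < q by rewrite (lt_trans ltr01).
exists q^-1; first by rewrite invr_ge0 ltW// invf_lt1.
elim=> [|m IH]; first by rewrite addr0 expr0 mul1r.
have h : q * C (j + m%:Z) <= C (j + m.+1%:Z).
  by rewrite -addn1 PoszD addrA hq// ler_wpDr.
apply: (@le_trans _ _ (q * C (j + m%:Z))^-1); first by rewrite lef_pV2 ?posrE ?mulr_gt0.
by rewrite invfM exprS -mulrA ler_pM2l ?invr_gt0.
Qed.

Lemma size_tail (j : int) : 1 <= j -> nu < k ^+ 2 * C j ->
  exists2 K : R, 0 <= K & \forall eps \near (0 : R)^'+,
  (sum_from j (fun l => (ssize S eps (l + 1)%R)%:R%:E * P (undecided S X eps l)) <= K%:E)%E.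
Proof.
move=> j1 hj; have [A A0 hA] := undecided_le j1 hj.
have [G G0 hG] := size_next.
have [q /andP[q0 q1] hq] := C_geometric j1.
have U1 := Upsilon_gt0 1; have C1 := C_gt0 1.
(* The weighted term is at most [G A (1 / n_l + 1 / C_l^2)]. Here [n_l >= C_l Upsilon_1 / 2] as soon
   as [eps <= 1], and [C_l >= C_1], so [B / C_l] bounds it and a geometric series remains. *)
pose B := G * A * (2 / Upsilon S 1 + (C 1)^-1).
have B0 : 0 <= B.
  by rewrite !mulr_ge0 ?(ltW G0)// addr_ge0 ?divr_ge0 ?invr_ge0 ?ltW.
exists (B / C j * (1 - q)^-1).
  apply: mulr_ge0; first by rewrite divr_ge0// ltW.
  by rewrite invr_ge0 subr_ge0 ltW.
near=> eps.
have term l : j <= l ->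
    ((ssize S eps (l + 1)%R)%:R%:E * P (undecided S X eps l) <= (B / C l)%:E)%E.
  move=> jl; have l1 := le_trans j1 jl.
  have Cl := C_gt0 l.
  have n0 : (0 < ssize S eps l)%N.
    have : forall l : int, 1 <= l -> (0 < ssize S eps l)%N by near: eps; exact: size_pos.
    exact.
  have n1 : (0 : R) < (ssize S eps l)%:R by rewrite ltr0n.
  have nC : C l * Upsilon S 1 / 2 <= (ssize S eps l)%:R.
    have sz : forall l, 1 <= l -> (1 - 2^-1) * C l <=
      eps ^+ 2 * (ssize S eps l)%:R / Upsilon S l <= (1 + 2^-1) * C l.
      by near: eps; apply: size_near; rewrite invr_gt0.
    have /andP[lo _] := sz l l1; rewrite ler_pdivlMr ?Upsilon_gt0// in lo.
    have eps0 : 0 < eps by near: eps; exact: nbhs_right_gt.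
    have eps1 : eps <= 1 by near: eps; exact: nbhs_right_le.
    have : eps ^+ 2 * (ssize S eps l)%:R <= (ssize S eps l)%:R.
      by rewrite ler_piMl ?ler0n// exprn_ile1// ltW.
    have : C l * Upsilon S 1 <= C l * Upsilon S l by rewrite ler_pM2l// Upsilon_le.
    lra.
  have hP : (P (undecided S X eps l) <= (A / (ssize S eps l)%:R *
     ((ssize S eps l)%:R^-1 + (C l ^+ 2)^-1))%:E)%E.
    by move: l jl {l1 Cl n0 n1 nC}; near: eps; exact: hA.
  have hn : (ssize S eps (l + 1))%:R <= G * (ssize S eps l)%:R.
    by move: l l1 {jl Cl n0 n1 nC hP}; near: eps; exact: hG.
  have hn' : ((ssize S eps (l + 1)%R)%:R%:E <= (G * (ssize S eps l)%:R)%:E)%E by rewrite lee_fin.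
  apply: le_trans (lee_pmul _ _ hn' hP) _ => //.
  rewrite -EFinM lee_fin.
  set n := (ssize S eps l)%:R in n1 nC *.
  rewrite (_ : G * n * _ = G * A * (n^-1 + (C l)^-2)); last by field; rewrite !gt_eqF.
  rewrite /B -[leRHS]mulrA ler_wpM2l ?mulr_ge0 ?(ltW G0)//.
  rewrite mulrDl lerD//.
    rewrite (_ : 2 / _ / _ = (C l * Upsilon S 1 / 2)^-1); last by field; rewrite !gt_eqF.
    by rewrite lef_pV2 ?posrE ?divr_gt0 ?mulr_gt0.
  by rewrite expr2 invfM ler_pM2r ?invr_gt0// lef_pV2 ?posrE// C_le.
apply: le_trans (le_sum_from _ term) _.
  by move=> l _; rewrite mule_ge0.
rewrite /sum_from.
apply: (@le_trans _ _ (\sum_(0 <= m <oo) (B / C j * q ^+ m)%:E)%E).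
  apply: lee_nneseries => m _; rewrite lee_fin.
  - by rewrite divr_ge0// ltW.
  - by rewrite -mulrA ler_wpM2l// mulrC.
rewrite (@cvg_lim _ _ _ _ _ _ (B / C j * (1 - q)^-1)%:E)//.
under eq_fun do rewrite sumEFin.
apply: cvg_EFin; first exact: nearW.
rewrite /comp/= [X in X @ _ --> _](_ : _ = series (geometric (B / C j) q)); last first.
  by apply/funext => m; rewrite /series/=.
by apply: cvg_geometric_series; rewrite ger0_norm.
Unshelve. all: by end_near. Qed.

Lemma size_cvg l : 1 <= l -> ssize S eps l @[eps --> (0 : R)^'+] --> \oo.
Proof.
move=> l1 A [N _ NA]; suff : \forall eps \near (0 : R)^'+, A (ssize S eps l) by [].
near=> eps; apply: NA => /=; rewrite -(ler_nat R).
by near: eps; exact: size_infty_at.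
Unshelve. all: by end_near. Qed.

(** * Decisions along a fixed sample path *)

Section almost_sure_decision.
Variable w : T.
Hypotheses (mean_cvg : mean_of X n w @[n --> \oo] --> mu)
  (var_cvg : sample_var X n w @[n --> \oo] --> nu).

Let mean_near l r : 1 <= l -> 0 < r -> \forall eps \near (0 : R)^'+,
  `|mean_of X (ssize S eps l) w - mu| < r.
Proof.
move=> l1 r0; have : mean_of X (ssize S eps l) w @[eps --> (0 : R)^'+] --> mu.
  exact: cvg_comp (size_cvg l1) mean_cvg.
by move/cvgrPdist_lt => /(_ r r0); apply: filterS => eps; rewrite distrC.
Qed.

Let var_near l r : 1 <= l -> 0 < r -> \forall eps \near (0 : R)^'+,
  `|sample_var X (ssize S eps l) w - nu| < r.
Proof.
move=> l1 r0; have : sample_var X (ssize S eps l) w @[eps --> (0 : R)^'+] --> nu.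
  exact: cvg_comp (size_cvg l1) var_cvg.
by move/cvgrPdist_lt => /(_ r r0); apply: filterS => eps; rewrite distrC.
Qed.

Lemma decided_eventually l : 1 <= l -> nu < k ^+ 2 * C l ->
  \forall eps \near (0 : R)^'+, D S X eps l w.
Proof.
move=> l1 hl; have [g g0 hg] := decided_when_close l1 hl.
have Cg : 0 < C l * g by rewrite mulr_gt0.
apply: filterS3 hg (mean_near l1 g0) (var_near l1 Cg) => eps dec zg vg.
apply: dec => //; rewrite -lerBlDl; exact: le_trans (ler_norm _) (ltW vg).
Qed.

Lemma undecided_eventually l : 1 <= l -> k ^+ 2 * C l < nu ->
  \forall eps \near (0 : R)^'+, ~~ D S X eps l w.
Proof.
move=> l1 hl; have [g g0 hg] := undecided_when_close l1 hl.
apply: filterS3 hg (mean_near l1 g0) (var_near l1 g0) => eps und zg.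
by rewrite ltr_distl => /andP[vg _]; exact: und.
Qed.

End almost_sure_decision.

(** * Coverage of a fixed stage *)

Let P_diff_le (A B E F : set T) (a b f : R) : measurable A -> measurable B ->
  measurable E -> measurable F -> B `<=` A -> E `<=` (A `\` B) `|` F ->
  (P A <= a%:E)%E -> (b%:E <= P B)%E -> (P F <= f%:E)%E -> (P E <= (a - b + f)%:E)%E.
Proof.
move=> mA mB mE mF BA EABF hA hB hF.
have mAB : measurable (A `\` B) by exact: measurableD.
suff h : (P (A `\` B) <= (a - b)%R%:E)%E.
  by rewrite EFinD; apply: le_trans (leeD h hF); exact: le_measureU.
have : (P B + P (A `\` B) = P A)%E.
  rewrite -measureU// ?setDIK//.
    by rewrite setDUK.
move: hA hB; rewrite -(fineK (fin_num_measure P _ mA)) -(fineK (fin_num_measure P _ mB)).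
rewrite -(fineK (fin_num_measure P _ mAB)); set pa := fine _; set pb := fine _; set c := fine _.
move=> h1 h2 h3; have h4 : pb + c = pa := EFin_inj h3.
by rewrite lee_fin in h1; rewrite lee_fin in h2; rewrite lee_fin; lra.
Qed.

Let P_diff_ge (A B E F : set T) (a b f : R) : measurable A -> measurable B ->
  measurable E -> measurable F -> A `<=` E `|` (B `|` F) ->
  (a%:E <= P A)%E -> (P B <= b%:E)%E -> (P F <= f%:E)%E -> ((a - b - f)%:E <= P E)%E.
Proof.
move=> mA mB mE mF AEBF hA hB hF.
have : (P A <= P E + (P B + P F))%E.
  apply: le_trans (leeD2l _ (measureU2 _ mB mF)).
  by apply: le_measureU => //; exact: measurableU.
move: hA hB hF; case: (P A) => [pa||]//; case: (P B) => [pb||]//; case: (P F) => [pf||]//;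
  case: (P E) (measure_ge0 P E) => [pe||]// _; rewrite -?EFinD ?leey//.
by rewrite !lee_fin; lra.
Qed.

(** Outside a rare event where the mean is far off, covering means that the normalised mean lies
    between two bounds close to [- xi] and [xi]; the event is therefore squeezed between the
    intervals of half-widths [xi - t] and [xi + t]. *)
Lemma stage_covered_near l e : 1 <= l -> 0 < e ->
  let v := 2 * Phi (k * Num.sqrt (C l * Upsilon S l / nu)) - 1 in
  \forall eps \near (0 : R)^'+,
  ((v - e)%:E <= P (stage_covered S X eps mu l) <= (v + e)%:E)%E.
Proof.
move=> l1 e0 v.
have Cl := C_gt0 l; have Ul := Upsilon_gt0 l.
pose x0 := Num.sqrt (C l * Upsilon S l / nu).
have x00 : 0 < x0 by rewrite sqrtr_gt0 divr_gt0 ?mulr_gt0.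
have x0E : x0 ^+ 2 = C l * Upsilon S l / nu.
  by rewrite sqr_sqrtr// divr_ge0 ?mulr_ge0 ?ltW.
pose pk : R := normal_peak 1.
have pk0 : 0 <= pk by exact: normal_peak_ge0.
(* Moving an endpoint by [t] changes [Phi] by at most [e / 8], and [t <= xi] keeps the inner
   interval meaningful. *)
pose t := Num.min (e / (8 * (pk + 1))) (k * x0).
have pk1 : 0 < 8 * (pk + 1) by lra.
have t0 : 0 < t by rewrite lt_min divr_gt0//= mulr_gt0.
have tpk : t * pk <= e / 8.
  have : t <= e / (8 * (pk + 1)) by rewrite ge_min lexx.
  by rewrite ler_pdivlMr// => h; nra.
have tx : t / x0 <= k by rewrite ler_pdivrMr// ge_min lexx orbT.
have tx0 : 0 < t / x0 by rewrite divr_gt0.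
(* Multiplied by [x0], the tolerance [t / x0] on [k] becomes the tolerance [t] on [xi = k * x0]. *)
have [|u [u0 uk u1 uc1 uc2]] := @perturbed_square R k ((k - t / x0) ^+ 2) ((k + t / x0) ^+ 2) k_gt0.
  by apply/andP; split; nra.
have [r1 r10 h1] := joint_limit_near calL_lim u0.
have [r2 r20 h2] := joint_limit_near calU_lim u0.
pose r := Num.min r1 r2; have r0 : 0 < r by rewrite lt_min r10.
have e8 : 0 < e / 8 by rewrite divr_gt0.
pose Y n w : R := (mean_of X n w - mu) * Num.sqrt (n%:R / nu).
have mY n : measurable_fun setT (Y n).
  by apply: measurable_funM => //; apply: measurable_funB => //; exact: measurable_mean_of.
have mle n a : measurable [set w | Y n w <= a] by exact: measurable_le.
have mltY n a : measurable [set w | Y n w < a] by exact: measurable_lt.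
have clt a : \forall eps \near (0 : R)^'+,
    (P [set w | (Y (ssize S eps l) w <= a)%R] <= (Phi a + e / 8)%:E)%E /\
    ((Phi a - e / 8)%:E <= P [set w | (Y (ssize S eps l) w < a)%R])%E.
  exact: (size_cvg l1 (clt_mean X_iid X0_moment6 X0_mean X0_var nu_gt0 a e8)).
pose xi := k * x0; pose a1 := xi + t; pose a2 := xi - t.
have a10 : 0 < a1 by rewrite addr_gt0 ?mulr_gt0.
near=> eps.
have eps0 : 0 < eps by near: eps; exact: nbhs_right_gt.
have er1 : eps < r1 by near: eps; exact: nbhs_right_lt.
have er2 : eps < r2 by near: eps; exact: nbhs_right_lt.
have n0 : (0 < ssize S eps l)%N by near: eps; exact: size_pos_at.
have hF : (P (far_mean (ssize S eps l) r) <= (e / 8)%:E)%E.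
  have : (P (far_mean (ssize S eps l) r `|` far_var (ssize S eps l) 1%R) <= (e / 8)%:E)%E.
    by near: eps; exact: far_to0.
  apply: le_trans; apply: le_measure; rewrite ?inE; [exact: mfar_mean| |by move=> w; left].
  by apply: measurableU; [exact: mfar_mean|exact: mfar_var].
have c1a : (P [set w | (Y (ssize S eps l) w <= a1)%R] <= (Phi a1 + e / 8)%:E)%E.
  by near: eps; apply: filterS (clt a1) => x [].
have c2b : ((Phi (- a1) - e / 8)%:E <= P [set w | (Y (ssize S eps l) w < - a1)%R])%E.
  by near: eps; apply: filterS (clt (- a1)) => x [].
have c3b : ((Phi a2 - e / 8)%:E <= P [set w | (Y (ssize S eps l) w < a2)%R])%E.
  by near: eps; apply: filterS (clt a2) => x [].
have c4a : (P [set w | (Y (ssize S eps l) w <= - a2)%R] <= (Phi (- a2) + e / 8)%:E)%E.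
  by near: eps; apply: filterS (clt (- a2)) => x [].
have sizes : forall l, 1 <= l -> (1 - u) * C l <=
    eps ^+ 2 * (ssize S eps l)%:R / Upsilon S l <= (1 + u) * C l.
  by near: eps; exact: size_near.
set n := ssize S eps l in n0 hF c1a c2b c3b c4a *.
have np : (0 : R) < n%:R by rewrite ltr0n.
have mE := measurable_stage_covered l eps0.
pose s := Num.sqrt (n%:R / nu).
have s0 : 0 < s by rewrite sqrtr_gt0 divr_gt0.
have sE : s ^+ 2 = n%:R / nu by rewrite sqr_sqrtr// divr_ge0 ?ltW.
have /andP[slo sup] : (1 - u) * x0 ^+ 2 <= (eps * s) ^+ 2 <= (1 + u) * x0 ^+ 2.
  have := sizes l l1; rewrite ler_pdivlMr// ler_pdivrMr// -/n exprMn sE x0E => /andP[ha hb].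
  by rewrite !mulrA ler_pM2r ?invr_gt0// ler_pM2r ?invr_gt0// ha hb.
have es0 : 0 < eps * s by rewrite mulr_gt0.
have up : (k + u) * (eps * s) <= a1.
  rewrite -(@ler_pXn2r _ 2) ?nnegrE//; last 2 first.
  - by apply: mulr_ge0; [apply: addr_ge0; exact: ltW|exact: ltW].
  - exact: ltW.
  rewrite (_ : a1 = (k + t / x0) * x0); last by rewrite /a1 /xi; field; rewrite gt_eqF.
  rewrite [leLHS]exprMn [leRHS]exprMn; apply: le_trans (_ : (k + u) ^+ 2 * ((1 + u) * x0 ^+ 2) <= _).
    by rewrite ler_wpM2l// sqr_ge0.
  by rewrite mulrA ler_pM2r ?exprn_gt0// mulrC.
have lo : a2 <= (k - u) * (eps * s).
  rewrite -(@ler_pXn2r _ 2) ?nnegrE//; last 2 first.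
  - by rewrite /a2 subr_ge0 /t ge_min lexx orbT.
  - by apply: mulr_ge0; [rewrite subr_ge0; exact: ltW|exact: ltW].
  rewrite (_ : a2 = (k - t / x0) * x0); last by rewrite /a2 /xi; field; rewrite gt_eqF.
  rewrite [leLHS]exprMn [leRHS]exprMn.
  apply: le_trans (_ : _ <= (k - u) ^+ 2 * ((1 - u) * x0 ^+ 2)) _.
    by rewrite [leRHS]mulrA ler_pM2r ?exprn_gt0// [leRHS]mulrC.
  by rewrite ler_wpM2l// sqr_ge0.
have marg w : ~ far_mean n r w ->
    [/\ Z S X eps l w - calL S (Z S X eps l w) eps < (k + u) * eps,
        (k - u) * eps < Z S X eps l w - calL S (Z S X eps l w) eps,
        calU S (Z S X eps l w) eps - Z S X eps l w < (k + u) * eps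
      & (k - u) * eps < calU S (Z S X eps l w) eps - Z S X eps l w].
  rewrite /far_mean/= => /negP; rewrite -ltNge lt_min => /andP[z1 z2].
  have := h1 _ _ z1 eps0 er1; have := h2 _ _ z2 eps0 er2.
  by rewrite /= !ltr_distl !ltr_pdivlMr// !ltr_pdivrMr// => /andP[q1 q2] /andP[q3 q4]; split.
have [ph1 ph2] : Phi xi <= Phi a2 + t * pk /\ Phi a1 <= Phi xi + t * pk.
  have /andP[_ g1] := Phi_lipschitz a2 (ltW t0); rewrite subrK in g1.
  by have /andP[_ g2] := Phi_lipschitz xi (ltW t0).
have YE w : Y n w = (Z S X eps l w - mu) * s by [].
apply/andP; split.
- apply: le_trans (P_diff_ge (mltY n a2) (mle n (- a2)) mE (mfar_mean n r) _ c3b c4a hF).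
    by rewrite lee_fin Phi_sym /v -/x0 -/xi; lra.
  move=> w /= Yw; have [far|nf] := pselect (far_mean n r w); first by right; right.
  have [|Ya] := leP (Y n w) (- a2); first by right; left.
  left; rewrite stage_coveredE/=; have [m1 m2 m3 m4] := marg w nf.
  have b1 : Z S X eps l w - mu < (k - u) * eps.
    by rewrite -(ltr_pM2r s0) -YE; apply: lt_le_trans Yw _; rewrite -mulrA.
  have b2 : - ((k - u) * eps) < Z S X eps l w - mu.
    by rewrite -(ltr_pM2r s0) -YE; apply: le_lt_trans Ya; rewrite mulNr lerN2 -mulrA.
  split; first by have := lt_trans b1 m2; rewrite ltrD2l ltrN2.
  have : mu - Z S X eps l w < calU S (Z S X eps l w) eps - Z S X eps l w.
    by apply: lt_trans m4; rewrite -ltrN2 opprB.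
  by rewrite ltrD2r.
- apply: le_trans (P_diff_le (mle n a1) (mltY n (- a1)) mE (mfar_mean n r) _ _ c1a c2b hF) _.
  + by move=> w /= /ltW h; apply: le_trans h _; apply: le_trans (_ : 0 <= _); [rewrite oppr_le0 ltW|exact: ltW].
  + move=> w Ew; have [far|nf] := pselect (far_mean n r w); [by right|left].
    move: Ew; rewrite stage_coveredE/= => -[E1 E2]; have [m1 m2 m3 m4] := marg w nf.
    have b1 : Z S X eps l w - mu < (k + u) * eps by apply: lt_trans m1; rewrite ltrD2l ltrN2.
    have b2 : - ((k + u) * eps) < Z S X eps l w - mu.
      by rewrite -ltrN2 opprB opprK; apply: lt_trans m3; rewrite ltrD2r.
    rewrite -(ltr_pM2r s0) -YE in b1; rewrite -(ltr_pM2r s0) -YE mulNr in b2.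
    split => /=; first by apply: ltW; apply: lt_le_trans b1 _; rewrite -mulrA.
    apply/negP; rewrite -leNgt ltW//; apply: le_lt_trans b2.
    by rewrite lerN2 -mulrA.
  + by rewrite lee_fin Phi_sym /v -/x0 -/xi; lra.
Unshelve. all: by end_near. Qed.

(** * The stopped scheme for small [eps] *)

Hypothesis ssize_incr : forall (eps : R) (a b : int), 0 < eps -> tau S eps <= a -> a < b ->
  (ssize S eps a < ssize S eps b)%N.
Variables (m : nat).
Hypotheses (stage_last : nu < k ^+ 2 * C (1 + m%:Z))
  (stage_before : forall i : nat, (i < m)%N -> k ^+ 2 * C (1 + i%:Z) <= nu).

Let p eps l w := D S X eps l w.
Let j : int := 1 + m%:Z.

Let j1 : 1 <= j. Proof. by rewrite /j lerDl. Qed.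

Let mp eps l : 0 < eps -> measurable [set w | p eps l w].
Proof. exact: measurable_decided. Qed.

Let p_ge eps l w : p eps l w -> tau S eps <= l.
Proof. by rewrite /p /D => /andP[]. Qed.

(** Strictness is free below stage [j - 1], because [C] is strictly increasing and
    [k ^ 2 * C (j - 1) <= nu] already. *)
Lemma stage_before_lt i : (i < m.-1)%N -> k ^+ 2 * C (1 + i%:Z) < nu.
Proof.
move=> im; have im1 : (i.+1 < m)%N by case: m im.
apply: lt_le_trans (stage_before im1); rewrite ltr_pM2l ?exprn_gt0//.
by apply: C_incr; rewrite ltrD2l ltz_nat.
Qed.

Section early_stages.
Variable h : nat.
Hypothesis stages : forall i : nat, (i < h)%N -> k ^+ 2 * C (1 + i%:Z) < nu.

(** Stated for any [h], as it is applied with [h = m.-1] unconditionally and with [h = m] under the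
    condition star. *)
Lemma early_to0 e : 0 < e -> \forall eps \near (0 : R)^'+, early P (p eps) h <= e.
Proof.
rewrite /early; elim: h stages e => [_ e e0|n IH st e e0].
  by near=> eps; rewrite big_nil ltW.
have e2 : 0 < e / 2 by rewrite divr_gt0.
have H1 := IH (fun i im => st i (ltnW im)) _ e2.
have H2 := @decided_to0 (1 + n%:Z) (ler_wpDr _ (lexx _)) (st n (ltnSn n)) _ e2.
near=> eps; rewrite big_nat_recr//= (splitr e) lerD//; first by near: eps; exact: H1.
have h2 : (P (decided S X eps (1 + n%:Z)%R) <= (e / 2)%:E)%E by near: eps; exact: H2.
rewrite -lee_fin fineK// fin_num_measure//; apply: measurable_decided.
by near: eps; exact: nbhs_right_gt.
Unshelve. all: by end_near. Qed.

Lemma undecided_early w : mean_of X n w @[n --> \oo] --> mu ->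
  sample_var X n w @[n --> \oo] --> nu ->
  \forall eps \near (0 : R)^'+, forall i : nat, (i < h)%N -> ~~ p eps (1 + i%:Z) w.
Proof.
move=> cm cv; elim: h stages => [_|n IH st]; first by near=> eps.
have H1 := IH (fun i im => st i (ltnW im)).
have H2 := undecided_eventually cm cv (ler_wpDr _ (lexx _)) (st n (ltnSn n)).
near=> eps => i; rewrite ltnS leq_eqVlt => /orP[/eqP ->|]; first by near: eps; exact: H2.
by move: i; near: eps; exact: H1.
Unshelve. all: by end_near. Qed.

End early_stages.

Let sz_incr eps : 0 < eps -> forall a b, tau S eps <= a -> a < b ->
  (ssize S eps a < ssize S eps b)%N.
Proof. by move=> eps0 a b; exact: ssize_incr. Qed.

Lemma mean_stop_sizeE eps : 0 < eps -> mean_stop_size S X eps =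
  ((ssize S eps (tau S eps))%:R%:E + sum_from (tau S eps) (fun l =>
    ((ssize S eps (l + 1)%R)%:R - (ssize S eps l)%:R)%R%:E * P (run (tau S eps) (p eps) l)))%E.
Proof.
move=> eps0; rewrite /mean_stop_size -(integral_at_index_size P _ (sz_incr eps0))//.
by move=> l; exact: mp.
Qed.

Lemma coveredE eps : covered S X eps mu = [set w |
  if first_index (tau S eps) ((p eps) ^~ w) is Some l then stage_covered S X eps mu l w else False].
Proof.
apply/seteqP; split => w; rewrite /covered /final_interval /stop /=;
  by case: (first_index _ _).
Qed.

Let E eps l := stage_covered S X eps mu l.

Let mE eps l : 0 < eps -> measurable (E eps l).
Proof. exact: measurable_stage_covered. Qed.

Lemma missedE eps : missed S X eps mu = ~` covered S X eps mu.
Proof. by apply/seteqP; split. Qed.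

(** What the bounds for a stopped scheme require at one [eps]. It holds for all small [eps] with the
    same [K], which makes those bounds uniform. *)
Definition regime K eps := [/\ 0 < eps, tau S eps = 1, (0 < ssize S eps 1)%N &
  (sum_from j (fun l => (ssize S eps (l + 1)%R)%:R%:E * P (undecided S X eps l)) <= K%:E)%E].

Lemma regime_near : exists2 K, 0 <= K & \forall eps \near (0 : R)^'+, regime K eps.
Proof.
have [K K0 tail] := size_tail j1 stage_last; exists K => //.
near=> eps; split; first by near: eps; exact: nbhs_right_gt.
- by near: eps; exact: tau_eq1.
- by near: eps; exact: size_pos_at.
- by near: eps; exact: tail.
Unshelve. all: by end_near. Qed.

Lemma rate_to0 (K e : R) : 0 < e -> \forall eps \near (0 : R)^'+, K / (ssize S eps 1)%:R <= e.
Proof.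
move=> e0; near=> eps.
have n0 : (0 < ssize S eps 1)%N by near: eps; exact: size_pos_at.
by rewrite ler_pdivrMr ?ltr0n// mulrC -ler_pdivrMr//; near: eps; exact: size_infty_at.
Unshelve. all: by end_near. Qed.

Section bounds.
Variables (K eps : R).
Hypothesis K_regime : regime K eps.
Let rate := K / (ssize S eps 1)%:R.
Let ear h := early P (p eps) h.

Let eps0 : 0 < eps. Proof. by case: K_regime. Qed.
Let t1 : tau S eps = 1. Proof. by case: K_regime. Qed.
Let n1 : (0 < ssize S eps 1)%N. Proof. by case: K_regime. Qed.
Let tail := let: And4 _ _ _ h := K_regime in h.
Let incr a b : 1 <= a -> a < b -> (ssize S eps a < ssize S eps b)%N.
Proof. by move=> a1; apply: sz_incr; rewrite ?t1. Qed.
Let mp' l : measurable [set w | p eps l w]. Proof. exact: mp. Qed.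
Let p_ge1 l w : p eps l w -> 1 <= l. Proof. by move=> /p_ge; rewrite t1. Qed.

Lemma regime_mean : [/\ (mean_stop_size S X eps <= ((ssize S eps j)%:R + K)%:E)%E,
  forall h : nat, (((ssize S eps (1 + h%:Z))%:R * (1 - ear h))%:E <= mean_stop_size S X eps)%E &
  (size_bound S X eps <= mean_stop_size S X eps + ((ssize S eps j)%:R * (ear m.-1 + rate) + K)%:E)%E].
Proof.
rewrite mean_stop_sizeE// /size_bound t1; split.
- exact: (mean_le_size mp' p_ge1 incr tail).
- exact: (size_le_mean mp' n1 incr tail).
- exact: (size_bound_le_mean mp' n1 incr tail).
Qed.

Let covE : covered S X eps mu = covered_at_stop (p eps) (E eps).
Proof. by rewrite coveredE t1. Qed.

Let mEe l : 1 <= l -> measurable (E eps l). Proof. by move=> _; exact: mE. Qed.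

Lemma regime_covered : [/\ (P (E eps j) <= P (covered S X eps mu) + (ear m + rate)%:E)%E,
  (P (covered S X eps mu) <= P (E eps j) + (ear m + rate)%:E)%E &
  (0 < m)%N -> (P (E eps (j - 1)%R) + P (E eps j) <=
    P (covered S X eps mu) + (1 + ear m.-1 + rate)%:E)%E].
Proof.
rewrite covE; split.
- exact: (last_stage_le_covered mp' n1 incr tail mEe).
- exact: (covered_le_last_stage mp' n1 incr tail mEe).
- exact: (covered_ge mp' n1 incr tail mEe).
Qed.

Lemma regime_Q : (Q S X eps mu <= P (missed S X eps mu) + (2 * (ear m + rate))%:E)%E.
Proof.
rewrite missedE covE /Q t1.
exact: (Q_le mp' n1 incr tail mEe).
Qed.

Lemma regime_stopped_sum (F : int -> set T) : (forall l, 1 <= l -> measurable (F l)) ->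
  (sum_from (tau S eps) (fun l => P (F l `&` undecided S X eps (l - 1)%R `&` decided S X eps l)) <=
   sum_from (tau S eps) (fun l => P (stopat (tau S eps) (p eps) l `&` F l)) +
   (m.+1%:R * ear m.-1 + rate)%:E)%E.
Proof. by rewrite t1; exact: (stopped_sum_le mp' n1 incr tail). Qed.

Lemma regime_undecided l : 1 <= l ->
  (P (undecided S X eps l) <= P (run (tau S eps) (p eps) l) + (ear m.-1 + rate)%:E)%E.
Proof. by rewrite t1; exact: (undecided_le_run mp' n1 incr tail). Qed.

End bounds.

Lemma measurable_stop_size eps : 0 < eps -> measurable_fun setT (stop_size S X eps).
Proof.
move=> eps0; apply: measurable_at_index_size (sz_incr eps0) => l; exact: mp.
Qed.

Lemma measurable_covered eps : 0 < eps -> measurable (covered S X eps mu).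
Proof.
move=> eps0; rewrite coveredE.
rewrite (_ : [set w | _] = \bigcup_(i : nat) (stopat (tau S eps) (p eps) (tau S eps + i%:Z) `&`
    E eps (tau S eps + i%:Z))).
  apply: bigcupT_measurable => i; apply: measurableI; last exact: mE.
  by apply: measurable_stopat => l; exact: mp.
apply/seteqP; split => w /=.
  case h : (first_index _ _) => [l|//] El; have /first_index_Some[al _ _] := h.
  exists (`|l - tau S eps|%N) => //; rewrite gez0_abs ?subr_ge0// subrKC.
  by split.
by move=> [i _ [/= -> Ei]].
Qed.

Lemma stops_almost_surely eps : 0 < eps -> (mean_stop_size S X eps < +oo)%E ->
  P [set w | (stop_size S X eps w < +oo)%E] = 1%E.
Proof.
move=> eps0 fin; have mf := measurable_stop_size eps0.
have f0 w : (0 <= stop_size S X eps w)%E.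
  by rewrite /stop_size; case: (stop _ _ _ _) => [l|]//=; rewrite lee_fin.
have int : P.-integrable setT (stop_size S X eps).
  apply/integrableP; split => //.
  by under eq_integral do rewrite gee0_abs//.
have mS : measurable [set w | (stop_size S X eps w < +oo)%E].
  rewrite -[X in measurable X]setTI; apply: emeasurable_fun_infty_o => //.
have [N [mN PN sub]] := integrable_ae measurableT int.
apply/eqP; rewrite eq_le probability_le1//=.
have : (P (~` N) <= P [set w | (stop_size S X eps w < +oo)%E])%E.
  apply: le_measure; rewrite ?inE//; first exact: measurableC.
  move=> w /= Nw; apply: contrapT => h; apply: Nw; apply: sub => /= /(_ I).
  by rewrite ge0_fin_numE.
by rewrite probability_setC// PN sube0.
Qed.

Lemma mean_finite : \forall eps \near (0 : R)^'+, (mean_stop_size S X eps < +oo)%E.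
Proof.
have [K K0 H] := regime_near; apply: filterS H => eps /regime_mean[h _ _].
by apply: le_lt_trans h _; rewrite ltry.
Qed.

Lemma stop_index_near h w : (h <= m)%N ->
  (forall i : nat, (i < h)%N -> k ^+ 2 * C (1 + i%:Z) < nu) ->
  mean_of X n w @[n --> \oo] --> mu -> sample_var X n w @[n --> \oo] --> nu ->
  \forall eps \near (0 : R)^'+,
    ((1 + h%:Z)%:~R%:E <= stop_index S X eps w <= j%:~R%:E)%E.
Proof.
move=> hm st cm cv; have H1 := undecided_early st cm cv.
have H2 := decided_eventually cm cv j1 stage_last.
near=> eps.
have e1 : forall i : nat, (i < h)%N -> ~~ p eps (1 + i%:Z) w by near: eps; exact: H1.
have e2 : p eps j w by near: eps; exact: H2.
have t1 : tau S eps = 1 by near: eps; exact: tau_eq1.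
rewrite /stop_index /stop t1; case hl : (first_index _ _) => [l|]; last first.
  by have := (first_index_None 1 (p eps ^~ w)).1 hl j j1; rewrite e2.
have [l1 pl before] := (first_index_Some 1 l (p eps ^~ w)).1 hl.
rewrite /= !lee_fin !ler_int; apply/andP; split; rewrite leNgt; apply/negP => lt.
  have := e1 `|l - 1|%N; rewrite gez0_abs ?subr_ge0// subrKC pl.
  rewrite -ltz_nat gez0_abs ?subr_ge0// ltrBlDl => /(_ lt).
  exact.
by have := before j j1 lt; rewrite e2.
Unshelve. all: by end_near. Qed.

(** An equality if [m > 0]; if [m = 0], the index on the left is 0, before the first stage, while
    the one on the right is 1. *)
Let pred_ge : j - 1 <= 1 + m.-1%:Z.
Proof.
rewrite /j [leLHS]addrC addKr; case: m => [|n] /=; first by rewrite addr0.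
by rewrite -addn1 PoszD addrC.
Qed.

Let star := forall i : nat, (i < m)%N -> k ^+ 2 * C (1 + i%:Z) < nu.

Lemma stop_index_limits w : mean_of X n w @[n --> \oo] --> mu ->
  sample_var X n w @[n --> \oo] --> nu ->
  [/\ ((j - 1)%:~R%:E <= limf_einf (fun eps => stop_index S X eps w) 0^'+)%E,
      (limf_einf (fun eps => stop_index S X eps w) 0^'+
         <= limf_esup (fun eps => stop_index S X eps w) 0^'+)%E
    & (limf_esup (fun eps => stop_index S X eps w) 0^'+ <= j%:~R%:E)%E] /\
  (star -> stop_index S X eps w @[eps --> 0^'+] --> (j%:~R%:E : \bar R)).
Proof.
move=> cm cv; have H := stop_index_near (leq_pred m) stage_before_lt cm cv.
split; first split.
- apply: limf_einf_ge => e e0; apply: filterS H => eps /andP[h _].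
  apply: le_trans h; rewrite lee_fin lerBlDr; apply: ler_wpDr; first exact: ltW.
  by rewrite ler_int; exact: pred_ge.
- exact: limf_einf_le_esup.
- apply: limf_esup_le => e e0; apply: filterS H => eps /andP[_ h].
  by apply: le_trans h _; rewrite lee_fin lerDl ltW.
- move=> st; apply: cvge_from_bounds => e e0.
  apply: filterS (stop_index_near (leqnn m) st cm cv) => eps /andP[h1 h2].
  apply/andP; split; first by apply: le_trans h1; rewrite lee_fin gerBl ltW.
  by apply: le_trans h2 _; rewrite lee_fin lerDl ltW.
Qed.

Let coverage l := 2 * Phi (k * Num.sqrt (C l * Upsilon S l / nu)) - 1.

Let star_errors : star -> forall e : R, 0 < e -> exists K, \forall eps \near (0 : R)^'+,
  regime K eps /\ early P (p eps) m + K / (ssize S eps 1)%:R <= e.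
Proof.
move=> st e e0; have [K K0 HK] := regime_near; exists K.
have e2 : 0 < e / 2 by rewrite divr_gt0.
have H1 := early_to0 st e2; have H2 := rate_to0 K e2.
near=> eps; split; first by near: eps; exact: HK.
by rewrite (splitr e) lerD//; near: eps.
Unshelve. all: by end_near. Qed.

(** The factor [c] is [m.+1] for the stagewise sums of (VI) and 1 elsewhere; dividing by [|c| + 1]
    avoids a case on its sign. *)
Let errors (c e : R) : 0 < e -> exists K, \forall eps \near (0 : R)^'+,
  regime K eps /\ c * early P (p eps) m.-1 + K / (ssize S eps 1)%:R <= e.
Proof.
move=> e0; have [K K0 HK] := regime_near; exists K.
have e2 : 0 < e / 2 by rewrite divr_gt0.
have c1 : 0 < `|c| + 1 by rewrite ltr_wpDl.
have H1 := early_to0 stage_before_lt (divr_gt0 e2 c1); have H2 := rate_to0 K e2.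
near=> eps; split; first by near: eps; exact: HK.
rewrite (splitr e) lerD//; last by near: eps.
apply: (@le_trans _ _ ((`|c| + 1) * early P (p eps) m.-1)).
  by rewrite ler_wpM2r ?early_ge0// (le_trans (ler_norm c))// lerDl.
by rewrite mulrC -ler_pdivlMr//; near: eps.
Unshelve. all: by end_near. Qed.

Let stage_near l e : 1 <= l -> 0 < e -> \forall eps \near (0 : R)^'+,
  ((coverage l - e)%:E <= P (E eps l) <= (coverage l + e)%:E)%E.
Proof. exact: stage_covered_near. Qed.

Lemma coverage_cvg : star -> P (covered S X eps mu) @[eps --> 0^'+] --> (coverage j)%:E.
Proof.
move=> st; apply: cvge_from_bounds => e e0; have e2 : 0 < e / 2 by rewrite divr_gt0.
have [K H1] := star_errors st e2; have H2 := stage_near j1 e2.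
near=> eps.
have [/regime_covered[lo up _] small] : regime K eps /\
  early P (p eps) m + K / (ssize S eps 1)%:R <= e / 2 by near: eps; exact: H1.
have /andP[l1 u1] : ((coverage j - e / 2)%:E <= P (E eps j) <= (coverage j + e / 2)%:E)%E.
  by near: eps; exact: H2.
apply/andP; split.
  have := le_trans l1 lo; rewrite -leeBlDr//; apply: le_trans.
  by rewrite -EFinB lee_fin; lra.
apply: le_trans up _; apply: le_trans (leeD2r _ u1) _.
by rewrite -EFinD lee_fin; lra.
Unshelve. all: by end_near. Qed.

Let Phi_le1 x : Phi x <= 1 :> R.
Proof.
rewrite /Phi -lee_fin fineK; first exact: probability_le1.
exact: fin_num_measure.
Qed.

Lemma coverage_liminf :
  ((2 * (Phi (k * Num.sqrt (C (j - 1) * Upsilon S (j - 1) / nu)) +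
         Phi (k * Num.sqrt (C j * Upsilon S j / nu))) - 3)%:E
      <= limf_einf (fun eps => P (covered S X eps mu)) 0^'+)%E.
Proof.
(* If [m = 0], index [j - 1] is not a stage; the condition star holds trivially, and its limit
   dominates the claimed bound because [Phi] is at most 1. *)
have [m0|m0] := posnP m.
  have st : star by rewrite /star m0.
  apply: limf_einf_ge => e e0.
  have := cvge_lower (coverage_cvg st) e0.
  apply: filterS => eps; apply: le_trans; rewrite lee_fin /coverage.
  by have := Phi_le1 (k * Num.sqrt (C (j - 1) * Upsilon S (j - 1) / nu)); lra.
have j2 : 1 <= j - 1 by rewrite /j [leRHS]addrC addKr; case: m m0.
have [l jl] : exists l, j - 1 = l by exists (j - 1).
rewrite jl in j2 *.
apply: limf_einf_ge => e e0; have e3 : 0 < e / 3 by rewrite divr_gt0.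
have [K H1] := errors 1 e3; have H2 := stage_near j1 e3; have H3 := stage_near j2 e3.
apply: filterS3 H1 H2 H3 => eps [/regime_covered[_ _ /(_ m0) lo] small] /andP[l1 _] /andP[l2 _].
rewrite jl in lo; have := le_trans (leeD l2 l1) lo; rewrite -leeBlDr//; apply: le_trans.
by rewrite -EFinD lee_fin /coverage; lra.
Qed.

Lemma size_limit l a : 1 <= l -> 0 < a -> \forall eps \near (0 : R)^'+,
  `|eps ^+ 2 * (ssize S eps l)%:R - C l * Upsilon S l| <= a.
Proof.
move=> l1 a0; have V0 : 0 < C l * Upsilon S l by rewrite mulr_gt0// Upsilon_gt0.
near=> eps.
have sz : forall l' : int, 1 <= l' ->
    `|eps ^+ 2 * (ssize S eps l')%:R / (C l' * Upsilon S l') - 1| < a / (C l * Upsilon S l).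
  by near: eps; apply: ssize_unif; rewrite divr_gt0.
have := sz l l1; rewrite ltr_pdivlMr// => /ltW; apply: le_trans.
set x := _ * _; have -> : x - C l * Upsilon S l = (x / (C l * Upsilon S l) - 1) * (C l * Upsilon S l).
  by rewrite mulrBl mul1r divfK// gt_eqF.
by rewrite normrM (gtr0_norm V0).
Unshelve. all: by end_near. Qed.

(** * Comparison of stagewise quantities with the stopping index *)

Let stop_setE l eps : [set w | (l%:~R%:E < stop_index S X eps w)%E] = run (tau S eps) (p eps) l.
Proof. by rewrite (runE R). Qed.

Lemma stop_index_le_undecided l eps : 0 < eps ->
  (P [set w | (l%:~R%:E < stop_index S X eps w)%E] <= P (undecided S X eps l))%E.
Proof.
by move=> eps0; rewrite stop_setE; apply: (run_le_undecided P _ (@p_ge eps)) => l'; exact: mp.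
Qed.

Let P_EFin (A : set T) : measurable A -> P A = (fine (P A))%:E.
Proof. by move=> mA; rewrite fineK// fin_num_measure. Qed.

Let measurable_run' eps l : 0 < eps -> measurable (run (tau S eps) (p eps) l).
Proof. by move=> eps0; apply: measurable_run => l'; exact: mp. Qed.

Lemma undecided_sub_stop_index l :
  (P (undecided S X eps l) - P [set w | (l%:~R%:E < stop_index S X eps w)%E])%E
    @[eps --> 0^'+] --> 0%E.
Proof.
apply: cvge_from_bounds => e e0.
have [l1|l1] := leP 1 l.
  have [K H] := errors 1 e0; have H0 := nbhs_right_gt (0 : R).
  apply: filterS2 H H0 => eps [reg small] eps0.
  have := stop_index_le_undecided l eps0; have := regime_undecided reg l1.
  rewrite stop_setE (P_EFin (measurable_run' l eps0)).
  set r := fine _; rewrite -leeBlDl// => up lo.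
  apply/andP; split.
    by rewrite leeBrDr// -EFinD (le_trans _ lo)// lee_fin; lra.
  by apply: le_trans up _; rewrite lee_fin; lra.
(* Once the starting index is 1, a stage [l < 1] is undecided and not yet stopped with probability
   1, so the difference vanishes. *)
apply: filterS2 tau_eq1 (nbhs_right_gt (0 : R)) => eps t1 eps0.
rewrite stop_setE run_lt ?t1// (_ : undecided _ _ _ _ = setT); last first.
  by apply/seteqP; split => w //= _; rewrite /undecided /D/= t1 leNgt l1.
by rewrite probability_setT subee// !lee_fin; apply/andP; split; lra.
Qed.

Let mmissed eps : 0 < eps -> measurable (missed S X eps mu).
Proof. by move=> eps0; rewrite missedE; apply: measurableC; exact: measurable_covered. Qed.

Let mstage_missed eps l : 0 < eps -> measurable (stage_missed S X eps mu l).
Proof.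
move=> eps0; rewrite (_ : stage_missed _ _ _ _ _ = ~` E eps l); last by apply/seteqP; split.
by apply: measurableC; exact: mE.
Qed.

Let mstopped eps : 0 < eps -> measurable [set w | (stop_size S X eps w < +oo)%E].
Proof.
move=> eps0; rewrite -[X in measurable X]setTI.
by apply: emeasurable_fun_infty_o => //; exact: measurable_stop_size.
Qed.

Let covered_sum eps : 0 < eps -> P (covered S X eps mu) =
  sum_from (tau S eps) (fun l => P (stopat (tau S eps) (p eps) l `&` E eps l)).
Proof.
move=> eps0; rewrite coveredE -(probability_stopped P (a := tau S eps) (p := p eps))//.
- by move=> l; exact: mp.
- by move=> l _; exact: mE.
Qed.

Let missed_sum eps : 0 < eps ->
  P (missed S X eps mu `&` [set w | (stop_size S X eps w < +oo)%E]) =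
  sum_from (tau S eps) (fun l => P (stopat (tau S eps) (p eps) l `&` stage_missed S X eps mu l)).
Proof.
move=> eps0; rewrite -(probability_stopped P (a := tau S eps) (p := p eps)).
- congr (P _); apply/seteqP; split => w; rewrite /missed /final_interval /stop_size /stop/=.
    by case: (first_index _ _) => [l|] /= [].
  by case: (first_index _ _) => [l|] //= h; split => //; rewrite ltry.
- by move=> l; exact: mp.
- by move=> l _; exact: mstage_missed.
Qed.

Let sum_E eps (F : int -> set T) := sum_from (tau S eps) (fun l =>
  P (F l `&` undecided S X eps (l - 1)%R `&` decided S X eps l)).

Let sum_E_ge eps (F : int -> set T) : 0 < eps -> (forall l, measurable (F l)) ->
  (sum_from (tau S eps) (fun l => P (stopat (tau S eps) (p eps) l `&` F l)) <= sum_E eps F)%E.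
Proof.
move=> eps0 mF; apply: (@le_stopped_sum _ _ _ P (tau S eps) (p eps) _ _ F) => [l|l w|l _].
- exact: mp.
- exact: p_ge.
- exact: mF.
Qed.

Let P_missed eps : 0 < eps -> P (missed S X eps mu) = (1 - P (covered S X eps mu))%E.
Proof. by move=> eps0; rewrite missedE probability_setC//; exact: measurable_covered. Qed.

Lemma P_lower_le eps : 0 < eps -> (P_lower S X eps mu <= P (missed S X eps mu))%E.
Proof.
move=> eps0; rewrite P_missed// /P_lower leeB//.
by rewrite covered_sum//; apply: sum_E_ge => // l; exact: mE.
Qed.

(** A run that never stops has an empty final interval, so it counts as missed although no stage
    accounts for it; hence the assumption that sampling stops almost surely. *)
Lemma le_P_upper eps : 0 < eps -> P [set w | (stop_size S X eps w < +oo)%E] = 1%E ->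
  (P (missed S X eps mu) <= P_upper S X eps mu)%E.
Proof.
move=> eps0 PS; have mS := mstopped eps0; have mM := mmissed eps0.
apply: (@le_trans _ _ (P (missed S X eps mu `&` [set w | (stop_size S X eps w < +oo)%E]))).
  rewrite -[leRHS]adde0; set A := [set w | _].
  have <- : P (~` A) = 0%E by rewrite probability_setC// PS subee.
  apply: le_measureU => //; [exact: measurableI|exact: measurableC|].
  by move=> w Mw; have [Aw|Aw] := pselect (A w); [left|right].
by rewrite missed_sum//; apply: sum_E_ge => // l; exact: mstage_missed.
Qed.

Lemma P_upper_le_Q eps : 0 < eps -> (P_upper S X eps mu <= Q S X eps mu)%E.
Proof.
move=> eps0; apply: le_sum_from => l _ //.
have mM := mstage_missed l eps0; have mU := mundecided (l - 1) eps0.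
have mD := measurable_decided l eps0.
have mI : measurable (stage_missed S X eps mu l `&` undecided S X eps (l - 1)).
  exact: measurableI.
rewrite !le_min; apply/and3P; split; apply: le_measure; rewrite ?inE//;
  try (by apply: measurableI); by move=> w [[]].
Qed.

Let sub_near_0 (f g : R -> \bar R) : (forall e : R, 0 < e -> \forall eps \near (0 : R)^'+,
    [/\ f eps \is a fin_num, (f eps <= g eps)%E & (g eps <= f eps + e%:E)%E]) ->
  [/\ (`|f eps - g eps|)%E @[eps --> 0^'+] --> 0%E,
      (`|g eps - f eps|)%E @[eps --> 0^'+] --> 0%E
    & (g eps - f eps)%E @[eps --> 0^'+] --> 0%E].
Proof.
move=> fg.
have gf0 : (g eps - f eps)%E @[eps --> 0^'+] --> 0%E.
  apply: cvge_from_bounds => e e0; apply: filterS (fg e e0) => eps [ff lo up].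
  apply/andP; split; last by rewrite leeBlDr// add0r addeC.
  by apply: (@le_trans _ _ 0%E); [rewrite lee_fin; lra|rewrite sube_ge0// ff].
have abs0 : (`|g eps - f eps|)%E @[eps --> 0^'+] --> 0%E.
  by rewrite -abse0; apply: cvg_abse.
split => //.
apply: cvg_trans abs0; apply: near_eq_cvg; apply: filterS (fg 1 ltr01) => eps [ff _ _].
by rewrite -abseN fin_num_oppeB// addeC.
Qed.

Let P_missed_fin eps : 0 < eps -> P (missed S X eps mu) \is a fin_num.
Proof. by move=> eps0; apply: fin_num_measure; exact: mmissed. Qed.

Let P_upper_near e : 0 < e -> \forall eps \near (0 : R)^'+,
  [/\ P (missed S X eps mu) \is a fin_num,
   (P (missed S X eps mu) <= P_upper S X eps mu)%E &
   (P_upper S X eps mu <= P (missed S X eps mu) + e%:E)%E].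
Proof.
move=> e0; have [K H] := errors m.+1%:R e0.
apply: filterS3 H mean_finite (nbhs_right_gt (0 : R)) => eps [reg small] fin eps0.
split; first exact: P_missed_fin.
- by apply: le_P_upper => //; exact: stops_almost_surely.
- apply: le_trans (regime_stopped_sum reg (fun l _ => mstage_missed l eps0)) _.
  apply: leeD; last by rewrite lee_fin.
  rewrite -missed_sum//; apply: le_measure; rewrite ?inE.
  + by apply: measurableI; [exact: mmissed|exact: mstopped].
  + exact: mmissed.
  + by move=> w [].
Qed.

Let P_lower_near e : 0 < e -> \forall eps \near (0 : R)^'+,
  [/\ P_lower S X eps mu \is a fin_num,
   (P_lower S X eps mu <= P (missed S X eps mu))%E &
   (P (missed S X eps mu) <= P_lower S X eps mu + e%:E)%E].
Proof.
move=> e0; have [K H] := errors m.+1%:R e0.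
apply: filterS2 H (nbhs_right_gt (0 : R)) => eps [reg small] eps0.
have lo : (P (covered S X eps mu) <= sum_E eps (E eps))%E.
  by rewrite covered_sum//; apply: sum_E_ge => // l; exact: mE.
have up : (sum_E eps (E eps) <= P (covered S X eps mu) + e%:E)%E.
  rewrite covered_sum//; apply: le_trans (regime_stopped_sum reg (fun l _ => mE l eps0)) _.
  by apply: leeD; rewrite ?lee_fin.
have cE := P_EFin (measurable_covered eps0).
have [s sE] : exists s, sum_E eps (E eps) = s%:E.
  move: lo up; rewrite cE -EFinD; case: (sum_E eps (E eps)) => [s||]//.
  by exists s.
rewrite P_missed// /P_lower -[sum_from _ _]/(sum_E eps (E eps)) sE.
rewrite sE cE in lo up; rewrite cE; split => //.
- by rewrite -!EFinB lee_fin lerB.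
- by rewrite -!EFinB -EFinD lee_fin; rewrite -EFinD lee_fin in up; lra.
Qed.

Lemma P_upper_cvg : (`|P (missed S X eps mu) - P_upper S X eps mu|)%E @[eps --> 0^'+] --> 0%E.
Proof. by have [] := sub_near_0 P_upper_near. Qed.

Lemma P_lower_cvg : (`|P (missed S X eps mu) - P_lower S X eps mu|)%E @[eps --> 0^'+] --> 0%E.
Proof. by have [] := sub_near_0 P_lower_near. Qed.

Lemma Q_cvg : star -> (Q S X eps mu - P (missed S X eps mu))%E @[eps --> 0^'+] --> 0%E.
Proof.
move=> st; have [|//] := @sub_near_0 (fun eps => P (missed S X eps mu)) (fun eps => Q S X eps mu).
move=> e e0; have e2 : 0 < e / 2 by rewrite divr_gt0.
have [K H] := star_errors st e2.
apply: filterS3 H (P_upper_near e0) (nbhs_right_gt (0 : R)) => eps [reg small] [fin lo _] eps0.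
split => //; first by apply: le_trans lo _; exact: P_upper_le_Q.
by apply: le_trans (regime_Q reg) _; apply: leeD => //; rewrite lee_fin; lra.
Qed.

Lemma mean_le_size_bound eps : 0 < eps -> (mean_stop_size S X eps <= size_bound S X eps)%E.
Proof.
move=> eps0; rewrite mean_stop_sizeE// /size_bound leeD2l//.
have jump0 l : tau S eps <= l -> (0 <= ((ssize S eps (l + 1)%R)%:R - (ssize S eps l)%:R)%R%:E :> \bar R)%E.
  move=> tl; rewrite lee_fin subr_ge0 ler_nat ltnW// ssize_incr//.
  by rewrite ltrDl.
apply: le_sum_from => l tl; first by apply: mule_ge0 => //; exact: jump0.
apply: lee_wpmul2l; first exact: jump0.
by apply: (run_le_undecided P _ (@p_ge eps)) => l'; exact: mp.
Qed.

(** * Mean sample size relative to the fixed-precision size *)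

Section mean_sample_size.
Variables (zc : R) (zc_neq0 : zc != 0).

Let N eps := nu * zc ^+ 2 / (k * eps) ^+ 2.
(** The constant with [1 / N eps = c * eps ^ 2], so that the ratio compares [eps ^ 2 * n_l] with its
    limit [V l], and the target is [c * V l]. *)
Let c := k ^+ 2 / (nu * zc ^+ 2).
Let V l := C l * Upsilon S l.
Let target l := (k * Num.sqrt (C l * Upsilon S l / nu) / zc) ^+ 2.

Let z20 : 0 < zc ^+ 2. Proof. by rewrite exprn_even_gt0. Qed.
Let c0 : 0 < c.
Proof. by apply: divr_gt0; [exact: exprn_gt0|exact: mulr_gt0 nu_gt0 z20]. Qed.
Let V0 l : 0 < V l. Proof. by rewrite mulr_gt0// Upsilon_gt0. Qed.

Let targetE l : target l = c * V l.
Proof.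
rewrite /target expr_div_n exprMn sqr_sqrtr; last by rewrite divr_ge0 ?ltW ?V0.
by rewrite /c /V; field; rewrite zc_neq0 gt_eqF.
Qed.

Let NV eps : 0 < eps -> ((N eps)%:E^-1 = (c * eps ^+ 2)%:E)%E.
Proof.
move=> eps0; have N0 : 0 < N eps.
  by apply: divr_gt0; [exact: mulr_gt0 nu_gt0 z20|exact/exprn_gt0/mulr_gt0].
rewrite inver gt_eqF//; congr (_%:E); rewrite /N /c.
by field; rewrite zc_neq0 !gt_eqF.
Qed.

Let mean_ratio_le e : 0 < e -> \forall eps \near (0 : R)^'+,
  (mean_stop_size S X eps / (N eps)%:E <= (target j + e)%:E)%E.
Proof.
move=> e0; have [K K0 H] := regime_near.
(* Half of [e / c] is for the error of [eps ^ 2 * n_j], the other half for the late stages, which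
   contribute at most [eps ^ 2 * K]. *)
have a0 : 0 < e / (2 * c) by rewrite divr_gt0// mulr_gt0 ?c0.
have H1 := size_limit j1 a0.
have K1 : 0 < K + 1 by rewrite ltr_wpDl.
have H2 := nbhs_right_le (divr_gt0 a0 K1); have H3 := nbhs_right_le (ltr01 : (0 : R) < 1).
near=> eps.
have reg : regime K eps by near: eps.
have eps0 : 0 < eps by near: eps; exact: nbhs_right_gt.
have [up _ _] := regime_mean reg; rewrite NV//.
apply: le_trans (lee_wpmul2r _ up) _; first by rewrite lee_fin mulr_ge0 ?exprn_ge0 ?ltW.
have s : `|eps ^+ 2 * (ssize S eps j)%:R - C j * Upsilon S j| <= e / (2 * c) by near: eps.
have ek : eps <= e / (2 * c) / (K + 1) by near: eps.
have e1 : eps <= 1 by near: eps.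
rewrite -EFinM lee_fin targetE -[V j]/(C j * Upsilon S j).
move: s; rewrite ler_distl => /andP[_ s].
rewrite ler_pdivlMr// in ek.
have s2 : eps ^+ 2 * K <= e / (2 * c).
  apply: le_trans ek; apply: (@le_trans _ _ (eps * K)).
    by rewrite ler_wpM2r// expr2 ler_piMl// ltW.
  by rewrite ler_pM2l// lerDl.
rewrite (_ : _ + e = c * (C j * Upsilon S j + e / (2 * c) + e / (2 * c))); last first.
  by field; rewrite gt_eqF.
rewrite mulrCA ler_pM2l// mulrDl -!(mulrC (eps ^+ 2)).
by apply: lerD s s2.
Unshelve. all: by end_near. Qed.

Let mean_ratio_ge h e : (forall i : nat, (i < h)%N -> k ^+ 2 * C (1 + i%:Z) < nu) -> 0 < e ->
  \forall eps \near (0 : R)^'+,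
  ((target (1 + h%:Z) - e)%:E <= mean_stop_size S X eps / (N eps)%:E)%E.
Proof.
move=> st e0; have [K K0 H] := regime_near.
set l : int := 1 + h%:Z; have l1 : 1 <= l by rewrite /l lerDl.
pose a := Num.min (e / (2 * c)) (V l).
(* An early decision of probability at most [b] loses at most [V l * b = e / (2 c)]. *)
pose b := e / (2 * c) / V l.
have ec0 : 0 < e / (2 * c) by rewrite divr_gt0// mulr_gt0 ?c0.
have a0 : 0 < a by rewrite lt_min V0 ec0.
have b0 : 0 < b by exact: divr_gt0 ec0 (V0 l).
have H1 := size_limit l1 a0; have H2 := early_to0 st b0.
have H3 := early_to0 st (ltr01 : (0 : R) < 1).
near=> eps.
have reg : regime K eps by near: eps.
have eps0 : 0 < eps by near: eps; exact: nbhs_right_gt.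
have [_ lo _] := regime_mean reg; rewrite NV//.
apply: le_trans _ (lee_wpmul2r _ (lo h)); last by rewrite lee_fin mulr_ge0 ?exprn_ge0 ?ltW.
have s : `|eps ^+ 2 * (ssize S eps l)%:R - V l| <= a by near: eps.
have eb : early P (p eps) h <= b by near: eps.
have e1 : early P (p eps) h <= 1 by near: eps.
have eb0 := early_ge0 P (p eps) h.
rewrite -EFinM lee_fin targetE -/l; move: s; rewrite ler_distl => /andP[s _].
have aV : a <= V l by rewrite ge_min lexx orbT.
have ae : a <= e / (2 * c) by rewrite ge_min lexx.
have bV : V l * b = e / (2 * c) by rewrite /b mulrC divfK// gt_eqF.
rewrite (_ : _ - e = c * (V l - e / (2 * c) - e / (2 * c))); last by field; rewrite gt_eqF.
rewrite (_ : _ * _ * (c * _) =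
    c * (eps ^+ 2 * (ssize S eps l)%:R * (1 - early P (p eps) h))); last by ring.
rewrite ler_pM2l ?c0//.
have : (V l - a) * (1 - early P (p eps) h) <=
    eps ^+ 2 * (ssize S eps l)%:R * (1 - early P (p eps) h).
  by rewrite ler_wpM2r// subr_ge0.
apply: le_trans.
have : V l * early P (p eps) h <= V l * b by rewrite ler_wpM2l// ltW.
have : 0 <= a * early P (p eps) h by rewrite mulr_ge0// ltW.
move: ae; rewrite bV; set ec := e / _; nra.
Unshelve. all: by end_near. Qed.

Lemma mean_ratio_limits :
  [/\ ((target (j - 1))%:E <= limf_einf (fun eps => mean_stop_size S X eps / (N eps)%:E) 0^'+)%E,
      (limf_einf (fun eps => mean_stop_size S X eps / (N eps)%:E) 0^'+
         <= limf_esup (fun eps => mean_stop_size S X eps / (N eps)%:E) 0^'+)%E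
    & (limf_esup (fun eps => mean_stop_size S X eps / (N eps)%:E) 0^'+ <= (target j)%:E)%E] /\
  (star -> (mean_stop_size S X eps / (N eps)%:E)%E @[eps --> 0^'+] --> (target j)%:E).
Proof.
split; first split.
- apply: limf_einf_ge => e e0.
  apply: filterS (mean_ratio_ge stage_before_lt e0) => eps; apply: le_trans.
  rewrite lee_fin lerD2r !targetE ler_pM2l ?c0// /V; apply: ler_pM.
  + exact/ltW/C_gt0.
  + exact/ltW/Upsilon_gt0.
  + by apply: C_le; exact: pred_ge.
  + by apply: Upsilon_le; exact: pred_ge.
- exact: limf_einf_le_esup.
- by apply: limf_esup_le => e e0; exact: mean_ratio_le.
- move=> st; apply: cvge_from_bounds => e e0.
  by apply: filterS2 (mean_ratio_ge st e0) (mean_ratio_le e0) => eps -> ->.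
Qed.

End mean_sample_size.

(** The excess of the bound over the mean is at most [n_j (early + rate) + K], while the mean is at
    least [n_1]. As [n_j / n_1] stays bounded and [K / n_1] tends to 0, the excess is relatively
    negligible. *)
Lemma size_bound_ratio :
  ((mean_stop_size S X eps)^-1 * size_bound S X eps)%E @[eps --> 0^'+] --> 1%E.
Proof.
have Vj : 0 < C j * Upsilon S j by rewrite mulr_gt0 ?Upsilon_gt0.
have V1 : 0 < C 1 * Upsilon S 1 by rewrite mulr_gt0 ?Upsilon_gt0.
(* Bounds [n_j / n_1]: for small [eps], [eps^2 n_j] is at most twice its limit and [eps^2 n_1] at
   least half of its limit. *)
pose G := 4 * (C j * Upsilon S j) / (C 1 * Upsilon S 1).
have G0 : 0 < G by apply: divr_gt0 => //; exact: mulr_gt0.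
apply: cvge_from_bounds => e e0.
have eG : 0 < e / (2 * G) by apply: divr_gt0 => //; exact: mulr_gt0.
have e2 : 0 < e / 2 by rewrite divr_gt0.
have [K H] := errors 1 eG; have H1 := rate_to0 K e2.
have H2 := size_limit j1 Vj; have H3 := size_limit (lexx 1) (divr_gt0 V1 (ltr0n _ 2)).
near=> eps.
have [reg small] : regime K eps /\
  1 * early P (p eps) m.-1 + K / (ssize S eps 1)%:R <= e / (2 * G) by near: eps.
have eps0 : 0 < eps by near: eps; exact: nbhs_right_gt.
have s1 : K / (ssize S eps 1)%:R <= e / 2 by near: eps.
have s2 : `|eps ^+ 2 * (ssize S eps j)%:R - C j * Upsilon S j| <= C j * Upsilon S j by near: eps.
have s3 : `|eps ^+ 2 * (ssize S eps 1)%:R - C 1 * Upsilon S 1| <= C 1 * Upsilon S 1 / 2 by near: eps.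
have [up lo bnd] := regime_mean reg; have le := mean_le_size_bound eps0.
have n1 : (0 : R) < (ssize S eps 1)%:R by rewrite ltr0n; case: reg.
have := lo 0; rewrite addr0 /early big_nil subr0 mulr1 => {}lo.
have [r rE] : exists r, mean_stop_size S X eps = r%:E.
  by move: lo up; case: (mean_stop_size S X eps) => [r||]//; exists r.
have [s sE] : exists s, size_bound S X eps = s%:E.
  by move: le bnd; rewrite rE -EFinD; case: (size_bound S X eps) => [s||]//; exists s.
rewrite rE lee_fin in lo; rewrite rE sE lee_fin in le; rewrite rE sE -EFinD lee_fin in bnd.
have r0 : 0 < r by exact: lt_le_trans lo.
rewrite rE sE inver gt_eqF// -EFinM !lee_fin mulrC.
have er0 : 0 <= e * r by apply: mulr_ge0; exact: ltW.
apply/andP; split; first by rewrite ler_pdivlMr// mulrBl mul1r; lra.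
rewrite ler_pdivrMr//; apply: le_trans bnd _; rewrite mulrDl mul1r lerD2l.
apply: (@le_trans _ _ (e * (ssize S eps 1)%:R)); last by rewrite ler_pM2l.
have nG : (ssize S eps j)%:R <= G * (ssize S eps 1)%:R.
  have q0 : 0 < eps ^+ 2 by rewrite exprn_gt0.
  rewrite -(ler_pM2l q0) mulrCA; move: s2 s3; rewrite !ler_distl => /andP[_ s2] /andP[s3 _].
  apply: le_trans s2 _; apply: (@le_trans _ _ (G * (C 1 * Upsilon S 1 - C 1 * Upsilon S 1 / 2))).
    by rewrite le_eqVlt; apply/orP; left; apply/eqP; rewrite /G; field; rewrite !gt_eqF ?Upsilon_gt0.
  by rewrite ler_pM2l.
rewrite (splitr e) mulrDl; apply: lerD; last by rewrite -ler_pdivrMr.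
rewrite mul1r in small.
apply: (@le_trans _ _ ((ssize S eps j)%:R * (e / (2 * G)))); first by rewrite ler_wpM2l.
apply: le_trans (ler_wpM2r (ltW eG) nG) _.
by rewrite le_eqVlt; apply/orP; left; apply/eqP; field; rewrite gt_eqF.
Unshelve. all: by end_near. Qed.

End scheme.

Theorem theorem8 (R : realType)
  (Theta : set R) (kappa : R -> R) (delta zcrit : R)
  (S : scheme R) (C : int -> R)
  (Theta_interval : is_interval Theta)
  (delta01 : 0 < delta < 1)
  (* zcrit is the quantile of order 1 - delta / 2 *)
  (zcritE : Phi zcrit = 1 - delta / 2)
  (* the functions of the stopping rule *)
  (scrL_cont : forall z eps : R, 0 < eps ->
     {for (z, eps), continuous (fun p : R * R => scrL S p.1 p.2)})
  (scrU_cont : forall z eps : R, 0 < eps ->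
     {for (z, eps), continuous (fun p : R * R => scrU S p.1 p.2)})
  (scr_le : forall z eps : R, 0 < eps -> scrL S z eps <= z <= scrU S z eps)
  (scr_lt : forall theta eps : R, 0 < eps -> Theta theta ->
     scrL S theta eps < theta < scrU S theta eps)
  (kappa_gt0 : forall theta, Theta theta -> 0 < kappa theta)
  (kappa_cont : {within Theta, continuous kappa})
  (scr_margin : asymptotic_margin Theta kappa (scrL S) (scrU S))
  (* the functions of the confidence interval *)
  (calL_meas : forall eps : R, 0 < eps -> measurable_fun setT (fun z => calL S z eps))
  (calU_meas : forall eps : R, 0 < eps -> measurable_fun setT (fun z => calU S z eps))
  (cal_margin : asymptotic_margin Theta kappa (calL S) (calU S))
  (* the sample sizes *)
  (C_gt0 : forall l, 0 < C l)
  (C_incr : forall k l : int, k < l -> C k < C l)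
  (C_ratio_inf : (1 < ratio_inf C)%E)
  (C_ratio_sup : (ratio_sup C < +oo)%E)
  (C_infty : C k%:Z @[k --> \oo] --> +oo)
  (dlt01 : forall l, 0 < dlt S l < 1)
  (dlt_noninc : forall k l : int, k <= l -> dlt S l <= dlt S k)
  (Upsilon_ratio_inf : (1 <= ratio_inf (Upsilon S))%E)
  (Upsilon_ratio_sup : (ratio_sup (Upsilon S) < +oo)%E)
  (rho_ge0 : 0 <= rho S)
  (tau_lim : (tau S eps)%:~R @[eps --> 0^'+] --> (1 : R))
  (ssize_gt0 : forall (eps : R) (l : int), 0 < eps -> tau S eps <= l -> (0 < ssize S eps l)%N)
  (ssize_incr : forall (eps : R) (k l : int), 0 < eps -> tau S eps <= k -> k < l ->
     (ssize S eps k < ssize S eps l)%N)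
  (ssize_unif : forall e : R, 0 < e -> \forall eps \near 0^'+,
     forall l : int, 1 <= l ->
       `|eps ^+ 2 * (ssize S eps l)%:R / (C l * Upsilon S l) - 1| < e)
  (* the random variable and its samples *)
  (d : measure_display) (T : measurableType d) (P : probability T R)
  (X0 : {RV P >-> R}) (X : nat -> {RV P >-> R}) (mu nu : R)
  (X_iid : iid_samples_of X0 X)
  (X0_moment6 : ('E_P[(fun w => `|X0 w| ^+ 6)%R] < +oo)%E)
  (X0_mean : 'E_P[X0]%E = mu%:E)
  (X0_var : 'V_P[X0]%E = nu%:E)
  (mu_Theta : Theta mu)
  (nu_gt0 : 0 < nu) :
  let xi (l : int) := kappa mu * Num.sqrt (C l * Upsilon S l / nu) in
  let Lambda (l : int) := kappa mu ^+ 2 * C l / nu in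
  let N (eps : R) := nu * zcrit ^+ 2 / (kappa mu * eps) ^+ 2 in
  forall j : int, first_index 1 (fun l => 1 < Lambda l) = Some j ->
  let star := j = 1 \/ (1 < j /\ Lambda (j - 1) < 1) in
  (* I *)
  (\forall eps \near 0^'+,
     P [set w | (stop_size S X eps w < +oo)%E] = 1%E /\
     (mean_stop_size S X eps < +oo)%E) /\
  (* II *)
  ({ae P, forall w,
     [/\ ((j - 1)%:~R%:E <= limf_einf (fun eps => stop_index S X eps w) 0^'+)%E,
         (limf_einf (fun eps => stop_index S X eps w) 0^'+
            <= limf_esup (fun eps => stop_index S X eps w) 0^'+)%E
       & (limf_esup (fun eps => stop_index S X eps w) 0^'+ <= j%:~R%:E)%E]} /\
   (star -> {ae P, forall w,
     stop_index S X eps w @[eps --> 0^'+] --> (j%:~R%:E : \bar R)})) /\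
  (* III *)
  (((2 * (Phi (xi (j - 1)) + Phi (xi j)) - 3)%:E
      <= limf_einf (fun eps => P (covered S X eps mu)) 0^'+)%E /\
   (star ->
      P (covered S X eps mu) @[eps --> 0^'+] --> (2 * Phi (xi j) - 1)%:E)) /\
  (* IV *)
  ([/\ (((xi (j - 1) / zcrit) ^+ 2)%:E
          <= limf_einf (fun eps => mean_stop_size S X eps / (N eps)%:E) 0^'+)%E,
       (limf_einf (fun eps => mean_stop_size S X eps / (N eps)%:E) 0^'+
          <= limf_esup (fun eps => mean_stop_size S X eps / (N eps)%:E) 0^'+)%E
     & (limf_esup (fun eps => mean_stop_size S X eps / (N eps)%:E) 0^'+
          <= ((xi j / zcrit) ^+ 2)%:E)%E] /\
   (star ->
      (mean_stop_size S X eps / (N eps)%:E)%E @[eps --> 0^'+]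
        --> ((xi j / zcrit) ^+ 2)%:E)) /\
  (* V *)
  (forall l : int,
     (forall eps : R, 0 < eps ->
        (P [set w | (l%:~R%:E < stop_index S X eps w)%E]
           <= P (undecided S X eps l))%E) /\
     (P (undecided S X eps l)
        - P [set w | (l%:~R%:E < stop_index S X eps w)%E])%E
       @[eps --> 0^'+] --> 0%E) /\
  (* VI *)
  ([/\ forall eps : R, 0 < eps ->
         [/\ (P_lower S X eps mu <= P (missed S X eps mu))%E,
             P [set w | (stop_size S X eps w < +oo)%E] = 1%E ->
               (P (missed S X eps mu) <= P_upper S X eps mu)%E
           & (P_upper S X eps mu <= Q S X eps mu)%E],
       (`|P (missed S X eps mu) - P_upper S X eps mu|)%E
         @[eps --> 0^'+] --> 0%E,
       (`|P (missed S X eps mu) - P_lower S X eps mu|)%E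
         @[eps --> 0^'+] --> 0%E
     & star ->
       (Q S X eps mu - P (missed S X eps mu))%E @[eps --> 0^'+] --> 0%E]) /\
  (* VII *)
  ((forall eps : R, 0 < eps ->
      (mean_stop_size S X eps <= size_bound S X eps)%E) /\
   ((mean_stop_size S X eps)^-1 * size_bound S X eps)%E
     @[eps --> 0^'+] --> 1%E).
Proof.
move=> xi Lambda N j0 hj star.
have [j01 Lj before] := (first_index_Some 1 j0 (fun l => 1 < Lambda l)).1 hj.
have [m jm] : exists m : nat, j0 = 1 + m%:Z.
  by exists `|j0 - 1|%N; rewrite gez0_abs ?subr_ge0// subrKC.
have k_gt0 := kappa_gt0 mu mu_Theta.
have [scrL_lim scrU_lim] := scr_margin mu mu_Theta.
have [calL_lim calU_lim] := cal_margin mu mu_Theta.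
have LambdaE l b : (Lambda l < b) = (kappa mu ^+ 2 * C l < b * nu).
  by rewrite /Lambda ltr_pdivrMr.
have stage_last : nu < kappa mu ^+ 2 * C (1 + m%:Z).
  by rewrite -jm; move: Lj; rewrite /Lambda ltr_pdivlMr// mul1r.
have stage_before i : (i < m)%N -> kappa mu ^+ 2 * C (1 + i%:Z) <= nu.
  move=> im; have := before (1 + i%:Z); rewrite lerDl jm ltrD2l ltz_nat => /(_ isT im).
  by rewrite -leNgt /Lambda ler_pdivrMr// mul1r.
(* Monotonicity of [C] spreads the strict inequality at stage [j - 1] to all earlier stages; for
   [j = 1] there are none. *)
have starP : star -> forall i : nat, (i < m)%N -> kappa mu ^+ 2 * C (1 + i%:Z) < nu.
  case=> [j1|[_ Lj1]] i im.
    have m0 : m = 0%N by move: jm; rewrite j1 -[LHS]addr0 => /addrI [].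
    by move: im; rewrite m0.
  move: Lj1; rewrite LambdaE mul1r; apply: le_lt_trans; rewrite ler_pM2l ?exprn_gt0//.
  have C_nondec a b : a <= b -> C a <= C b by eapply C_le; revgoals; eassumption.
  apply: C_nondec; rewrite jm [leRHS]addrC addKr.
  by rewrite -(PoszD 1) lez_nat.
(* [Phi 0] is one half, whereas [1 - delta / 2] exceeds one half. *)
have zc_neq0 : zcrit != 0.
  apply/eqP => z0; move: zcritE; rewrite z0 Phi0; case/andP: delta01 => _ d1 h.
  by move: d1 h; clear; lra.
have fin : \forall eps \near 0^'+, (mean_stop_size S X eps < +oo)%E.
  by eapply mean_finite; revgoals; eassumption.
rewrite jm; split; [|split; [|split; [|split; [|split; [|split]]]]].
- have H0 := nbhs_right_gt (0 : R); apply: filterS2 fin H0 => eps h eps0; split => //.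
  by eapply stops_almost_surely; revgoals; eassumption.
- have ae := slln_mean_var X_iid X0_moment6 X0_mean X0_var.
  split=> [|/starP st]; apply: filterS ae => w [mean_cvg var_cvg].
    by eapply proj1; eapply stop_index_limits; revgoals; eassumption.
  by move: st; eapply proj2; eapply stop_index_limits; revgoals; eassumption.
- split=> [|/starP st]; first by eapply coverage_liminf; revgoals; eassumption.
  by eapply coverage_cvg; revgoals; eassumption.
- split; first by eapply proj1; eapply mean_ratio_limits; revgoals; eassumption.
  by move=> /starP; eapply proj2; eapply mean_ratio_limits; revgoals; eassumption.
- move=> l; split; last by eapply undecided_sub_stop_index; revgoals; eassumption.
  by move=> eps eps0; eapply stop_index_le_undecided; revgoals; eassumption.
- split.
  + move=> eps eps0; split; first by eapply P_lower_le; revgoals; eassumption.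
      by move=> stops; eapply le_P_upper; revgoals; eassumption.
    by eapply P_upper_le_Q; revgoals; eassumption.
  + by eapply P_upper_cvg; revgoals; eassumption.
  + by eapply P_lower_cvg; revgoals; eassumption.
  + by move=> /starP st; eapply Q_cvg; revgoals; eassumption.
- split; last by eapply size_bound_ratio; revgoals; eassumption.
  by move=> eps eps0; eapply mean_le_size_bound; revgoals; eassumption.
Qed.
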